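(* There are exactly $194{,}160$ (combinatorial types of) generic metrics on six labelled points; that is, the metric fan $MF_6$ has exactly $194{,}160$ maximal cones. These correspond bijectively, via $d \mapsto \Delta_d$, to the regular triangulations of the second hypersimplex $\Delta(6,2)$. Under the action of the symmetric group $S_6$ they form exactly $339$ symmetry classes. In addition, the hypersimplex $\Delta(6,2)$ has exactly $3{,}840$ non-regular triangulations, and these form exactly $14$ symmetry classes under $S_6$.
   Context: Metric cone: $C_n = \{ d \in \mathbb{R}^{\binom{n}{2}} : d_{ij} \ge 0 \text{ and } d_{ij}+d_{jk} \ge d_{ik} \text{ for all } 1\le i,j,k\le n\}$, with $d_{ij}=d_{ji}$ and $d_{ii}=0$; its elements are called metrics on $\{1,\dots,n\}$. Second hypersimplex: $\Delta(n,2) = \mathrm{conv}\{e_i+e_j : 1\le i<j\le n\} \subset \mathbb{R}^n$. Its vertices $e_i+e_j$ are identified with the edges $\{i,j\}$ of the complete graph $K_n$, and a subgraph $G$ of $K_n$ (a set of edges) is identified with the subpolytope $\mathrm{conv}\{e_i+e_j : \{i,j\}\in G\}$. A triangulation of $\Delta(n,2)$ means a triangulation all of whose vertices are vertices of $\Delta(n,2)$. Induced subdivision: each metric $d$ defines a regular polyhedral subdivision $\Delta_d$ of $\Delta(n,2)$, in which a subgraph $G$ is a cell if there exists $x\in\mathbb{R}^n$ with $x_i+x_j=d_{ij}$ for $\{i,j\}\in G$ and $x_i+x_j>d_{ij}$ for $\{i,j\}\notin G$. A triangulation of $\Delta(n,2)$ is regular if it equals $\Delta_d$ for some metric $d$ (equivalently,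 it is regular in the usual sense, i.e. induced by some height vector $d\in\mathbb{R}^{\binom n2}$), and non-regular otherwise. Metric fan: $MF_n$ is the subdivision of $C_n$ in which two metrics $d,d'$ lie in the same (relatively open) cone if $\Delta_d=\Delta_{d'}$; its maximal cones are the closures of the sets $\{d\in C_n : \Delta_d=\Delta\}$ where $\Delta$ is a regular triangulation. A metric is generic if it lies in an open (full-dimensional) cone of $MF_n$. Generic metrics are counted up to lying in the same cone of $MF_n$. Symmetry: $S_n$ acts by permuting the labels $1,\dots,n$ (hence on metrics, on cones of $MF_n$, and on triangulations of $\Delta(n,2)$); symmetry classes are orbits of this action. *)

(* Defs.v *)
From HB Require Export structures.
From mathcomp Require Export all_boot all_order all_algebra all_fingroup.
From mathcomp Require Export boolp classical_sets functions cardinality.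
From mathcomp Require Export reals topology normedtype.

Set Implicit Arguments.
Unset Strict Implicit.
Unset Printing Implicit Defensive.

Export Order.TTheory GRing.Theory Num.Theory.
Export numFieldNormedType.Exports.

Local Open Scope classical_set_scope.
Local Open Scope ring_scope.

(* The labels 1, ..., n are the elements of 'I_n, and the edge {i, j} of K_n is
   the finite set [set i; j]. A vertex set of Delta(n,2) is a subgraph of K_n,
   and a polyhedral complex on these vertices is the set of the vertex sets of
   all its cells, the empty cell included. *)
Definition graph (n : nat) := {set {set 'I_n}}.
Definition complex (n : nat) := set (graph n).

Definition Kn (n : nat) : graph n := [set e : {set 'I_n} | #|e| == 2%N]%SET.

Section Hypersimplex.
Variables (R : realType) (n : nat).

Definition vertex (e : {set 'I_n}) : 'rV[R]_n :=
  \sum_(i in e) delta_mx ord0 i.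

Definition conv (G : graph n) : set 'rV[R]_n :=
  [set p | exists w : {set 'I_n} -> R,
     [/\ forall e, e \in G -> 0 <= w e,
         \sum_(e in G) w e = 1 &
         p = \sum_(e in G) w e *: vertex e]].

Definition hypersimplex2 : set 'rV[R]_n := conv (Kn n).

Definition affinely_independent (G : graph n) : Prop :=
  forall w : {set 'I_n} -> R,
    \sum_(e in G) w e = 0 -> \sum_(e in G) w e *: vertex e = 0 ->
    forall e, e \in G -> w e = 0.

Definition triangulation (T : complex n) : Prop :=
  [/\ forall G, T G -> G \subset Kn n /\ affinely_independent G,
      forall G H : graph n, T G -> H \subset G -> T H,
      \bigcup_(G in T) conv G = hypersimplex2 &
      forall G H : graph n, T G -> T H ->
        conv G `&` conv H = conv (G :&: H)%SET].

(* R^(n choose 2): symmetric matrices with zero diagonal. *)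
Definition dissimilarity : set 'M[R]_n :=
  [set d | (forall i, d i i = 0) /\ (forall i j, d i j = d j i)].

Definition metric_cone : set 'M[R]_n :=
  [set d | [/\ dissimilarity d,
               forall i j, 0 <= d i j &
               forall i j k, d i k <= d i j + d j k]].

Definition induced_subdivision (d : 'M[R]_n) : complex n :=
  [set G | G \subset Kn n /\
     exists x : 'rV[R]_n, forall i j : 'I_n, i != j ->
       if [set i; j]%SET \in G then x ord0 i + x ord0 j = d i j
       else d i j < x ord0 i + x ord0 j].

Definition regular_triangulations : set (complex n) :=
  [set T | triangulation T /\
     exists d, metric_cone d /\ induced_subdivision d = T].

Definition nonregular_triangulations : set (complex n) :=
  [set T | triangulation T /\ ~ regular_triangulations T].

(* The relatively open cone of the metric fan that contains d. *)
Definition fan_cell (d : 'M[R]_n) : set 'M[R]_n :=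
  [set d' | metric_cone d' /\ induced_subdivision d' = induced_subdivision d].

Definition metric_fan : set (set 'M[R]_n) :=
  [set closure (fan_cell d) | d in metric_cone].

Definition maximal_cones : set (set 'M[R]_n) :=
  [set C | metric_fan C /\ forall C', metric_fan C' -> C `<=` C' -> C' = C].

(* The interior is taken relatively to R^(n choose 2), not to all matrices. *)
Definition full_dimensional (C : set 'M[R]_n) : Prop :=
  exists2 d, C d & within dissimilarity (nbhs d) C.

Definition generic : set 'M[R]_n :=
  [set d | metric_cone d /\ full_dimensional (fan_cell d)].

Definition generic_types : set (set 'M[R]_n) :=
  [set fan_cell d | d in generic].

End Hypersimplex.

Arguments regular_triangulations R n : clear implicits.
Arguments nonregular_triangulations R n : clear implicits.
Arguments maximal_cones R n : clear implicits.
Arguments generic_types R n : clear implicits.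

Section Symmetry.
Variable n : nat.

(* s sends the distance between i and j to the pair s i, s j. *)
Definition relabel_matrix (R : realType) (s : 'S_n) (d : 'M[R]_n) : 'M[R]_n :=
  \matrix_(i, j) d ((s^-1)%g i) ((s^-1)%g j).

Definition relabel_cone (R : realType) (s : 'S_n) (C : set 'M[R]_n) :
    set 'M[R]_n :=
  relabel_matrix s @` C.

Definition relabel_graph (s : 'S_n) (G : graph n) : graph n :=
  [set [set s i | i in e]%SET | e : {set 'I_n} in G]%SET.

Definition relabel_complex (s : 'S_n) (T : complex n) : complex n :=
  relabel_graph s @` T.

(* The orbits of the elements of F under the action act. *)
Definition symmetry_classes (X : Type) (act : 'S_n -> X -> X) (F : set X) :
    set (set X) :=
  [set range (act^~ x) | x in F].

End Symmetry.

(* Main.v *)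
Require Import Defs.
From mathcomp Require Import zify lra.
From Stdlib Require Import NArith PeanoNat.

(** Let a nonnegative weighting of the edges of the complete graph stand for the
    weighted sum of the vertices of these edges.  A complex is a triangulation if and
    only if every point obtained in this way has exactly one weighting that is
    supported on a cell ([triP]).  Two weightings of the same point differ by a linear
    dependence between the vertices, and a dependence contains, with matching signs, a
    circuit: a closed walk whose edges alternately count positively and negatively.
    The walk is a four-cycle, a six-cycle, two triangles with a common label, or two
    triangles joined by an edge ([conformal]).  Each circuit has two sides, of which a
    triangulation contains at most one, and two triangulations coincide as soon as no
    circuit has one side in the first and the other side in the second ([tri_eq]).
    The subdivision induced by a vector of heights is described by comparing the total
    heights of the two sides of each circuit ([inducedP], a consequence of the lemma of
    Farkas).

    A fixed vector of heights that separates the sides of all circuits refines every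
    induced subdivision to a triangulation, and triangulations are stable under small
    changes of the heights.  Therefore a metric is generic exactly when it induces a
    triangulation ([genericP]), the closures of the generic cells are the maximal cones
    ([maximal_conesP]), and maximal cones correspond to regular triangulations
    ([cone_complex_bij]).  What remains is to count triangulations.

    Of the three pairs of disjoint edges on four labels, a triangulation contains
    exactly one.  This gives one of three choices for each of the fifteen sets of four
    labels.  A choice is impossible if it contradicts the following fact
    ([tri_extend]): if a linear functional vanishes on a cell and is negative at some
    vertex, then some vertex at which it is negative can be added to the cell.  A
    search over the choices, pruned by looking at all sets of four labels that avoid a
    given label, shows that every triangulation can be relabelled such that its choice
    is one of 141 listed ones ([group_found]).  For each of these at most seven circuits
    are left of which both sides are still possible.  Each way to forbid one side of
    each of them is either contradictory by [tri_extend], or equivalent to a listed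
    representative by a permutation that preserves the choice ([group_rep_found]).  A
    list of forbidden sides that meets every circuit determines a triangulation if its
    simplices cover ([avoid_tri]).  Coverage holds for the regular representatives
    since the forbidden sides are the lower sides for listed heights, and for the
    others since they arise by a flip from a complex of this kind ([flip_covering]).  A
    nonregular representative comes with circuits whose total sides are equal, while
    any heights inducing it would make every first side strictly lower
    ([certified_irregular]).

    Finally the representatives are pairwise inequivalent: their choices of pairs are,
    and within one choice all permutations preserving it are tried ([same_group],
    [lists_inequivalent]).  By the orbit-stabiliser theorem the orbit of a
    representative has 720 elements divided by the number of permutations fixing its
    forbidden sides, and the sums over the 339 regular and the 14 nonregular
    representatives are 194160 and 3840. *)

Set Implicit Arguments.
Unset Strict Implicit.
Unset Printing Implicit Defensive.

Delimit Scope nat_scope with N.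
Delimit Scope N_scope with num.

(** * Labels, edges and their codes *)
Local Open Scope ring_scope.

(** The labels are a plain enumeration, and permutations and tables are records of six
    entries, so that the finite checks below reduce to case analysis on constructors. *)
Inductive vx := V0 | V1 | V2 | V3 | V4 | V5.

Definition vs := [:: V0; V1; V2; V3; V4; V5].

Definition ov (v : vx) : 'I_6 :=
  match v with
  | V0 => @Ordinal 6 0 isT | V1 => @Ordinal 6 1 isT | V2 => @Ordinal 6 2 isT
  | V3 => @Ordinal 6 3 isT | V4 => @Ordinal 6 4 isT | V5 => @Ordinal 6 5 isT
  end.

Definition vo (i : 'I_6) : vx := nth V0 vs i.

Lemma ovK : cancel ov vo. Proof. by case. Qed.

Lemma voK : cancel vo ov.
Proof. by case=> [[|[|[|[|[|[|]]]]]] // lt_i6]; apply: val_inj. Qed.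

HB.instance Definition _ := Equality.copy vx (can_type ovK).

Definition eqv (a b : vx) : bool :=
  match a, b with
  | V0, V0 | V1, V1 | V2, V2 | V3, V3 | V4, V4 | V5, V5 => true
  | _, _ => false
  end.

Lemma eqvE a b : eqv a b = (a == b). Proof. by case: a; case: b. Qed.

Definition ltv (a b : vx) : bool :=
  match a, b with
  | _, V0 => false
  | V0, _ => true
  | _, V1 => false
  | V1, _ => true
  | _, V2 => false
  | V2, _ => true
  | _, V3 => false
  | V3, _ => true
  | _, V4 => false
  | V4, _ => true
  | V5, V5 => false
  end.

Lemma ltvE a b : ltv a b = (ov a < ov b)%N. Proof. by case: a; case: b. Qed.

Inductive hex (A : Type) := Hex of A & A & A & A & A & A.

Definition get A (t : hex A) (v : vx) : A :=
  let: Hex a b c d e f := t in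
  match v with V0 => a | V1 => b | V2 => c | V3 => d | V4 => e | V5 => f end.

Definition hexfun A (f : vx -> A) : hex A :=
  Hex (f V0) (f V1) (f V2) (f V3) (f V4) (f V5).

Lemma get_hexfun A (f : vx -> A) v : get (hexfun f) v = f v.
Proof. by case: v. Qed.

Lemma hex_ext A (s t : hex A) : get s =1 get t -> s = t.
Proof.
case: s => a b c d e f; case: t => a' b' c' d' e' f' eq_st.
by move: (eq_st V0) (eq_st V1) (eq_st V2) (eq_st V3) (eq_st V4) (eq_st V5) => /=
  -> -> -> -> -> ->.
Qed.

(** Unlike [&&] and [||], these connectives, and likewise [any] and [every], evaluate no
    more operands than they need under every evaluation strategy. *)
Notation "a &&& b" := (if a then b else false) (at level 40, left associativity).
Notation "a ||| b" := (if a then true else b) (at level 50, left associativity).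

Fixpoint any (A : Type) (p : A -> bool) (s : seq A) : bool :=
  if s is x :: s' then p x ||| any p s' else false.
Fixpoint every (A : Type) (p : A -> bool) (s : seq A) : bool :=
  if s is x :: s' then p x &&& every p s' else true.

Lemma anyE A (p : A -> bool) s : any p s = has p s.
Proof. by elim: s => //= x s ->. Qed.
Lemma everyE A (p : A -> bool) s : every p s = all p s.
Proof. by elim: s => //= x s ->. Qed.

Definition edge := (vx * vx)%type.
(** A list of edges; it codes a graph, or one side of a circuit, where an edge may occur
    twice. *)
Definition side := seq edge.

(** An edge is coded by its endpoints in increasing order, so that equal edges have
    equal codes. *)
Definition mk (a b : vx) : edge := if ltv a b then (a, b) else (b, a).
Definition eqe (e f : edge) : bool := eqv e.1 f.1 &&& eqv e.2 f.2.
Definition wf (e : edge) : bool := ltv e.1 e.2.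
Definition has_edge (A : side) (e : edge) : bool := any (eqe e) A.
Definition sub (A B : side) : bool := every (has_edge B) A.

Lemma eqeE e f : eqe e f = (e == f).
Proof. by case: e f => [a b] [c d]; rewrite /eqe !eqvE. Qed.

Lemma has_edgeE A e : has_edge A e = (e \in A).
Proof.
rewrite /has_edge anyE -has_pred1; apply: eq_has => f.
by rewrite eqeE /= eq_sym.
Qed.

Lemma subP A B : reflect {subset A <= B} (sub A B).
Proof. by rewrite /sub everyE; apply: (iffP allP) => sAB e /sAB; rewrite has_edgeE. Qed.

Definition E (e : edge) : {set 'I_6} := [set ov e.1; ov e.2]%SET.

Lemma E_mk a b : E (mk a b) = [set ov a; ov b]%SET.
Proof. by rewrite /mk /E; case: ifP => //= _; rewrite finset.setUC. Qed.

Lemma mk_wf a b : a != b -> wf (mk a b).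
Proof. by case: a; case: b. Qed.

Lemma E_inj : {in wf &, injective E}.
Proof.
move=> [a b] [c d]; rewrite !unfold_in /wf !ltvE /= => ltab ltcd eqE.
have ca : ov a \in E (c, d) by rewrite -eqE set21.
have cb : ov b \in E (c, d) by rewrite -eqE set22.
have ac : ov c \in E (a, b) by rewrite eqE set21.
move: ca cb ac; rewrite !inE /= !(inj_eq (can_inj ovK)).
case/orP=> /eqP e1; case/orP=> /eqP e2; case/orP=> /eqP e3; subst;
  rewrite ?ltnn // in ltab ltcd *.
by have := ltn_trans ltab ltcd; rewrite ltnn.
Qed.

(** * Graphs on six labels and permutations of the labels *)

Definition gr (A : side) : graph 6 := [set e in map E A]%SET.

Lemma gr_subset (A : side) (G : graph 6) :
  (gr A \subset G) = all (fun e => E e \in G) A.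
Proof.
apply/idP/allP => [/fintype.subsetP sAG e eA | sAG].
  by apply: sAG; rewrite inE map_f.
by apply/fintype.subsetP => f; rewrite inE => /mapP[e eA ->]; apply: sAG.
Qed.

Lemma mem_gr (A : side) e : wf e -> all wf A -> (E e \in gr A) = (e \in A).
Proof.
move=> we /allP wA; rewrite inE; apply/mapP/idP => [[f fA eq_ef]|eA].
  by rewrite (E_inj _ _ eq_ef) //; apply: wA.
by exists e.
Qed.

Lemma gr_sub (A B : side) : all wf A -> all wf B -> (gr A \subset gr B) = sub A B.
Proof.
move=> /allP wA wB; rewrite gr_subset /sub everyE; apply: eq_in_all => e eA.
by rewrite mem_gr ?wA // has_edgeE.
Qed.

Definition edges : side :=
  [seq e <- [seq (a, b) | a <- vs, b <- vs] | wf e].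

Lemma edges_wf e : (e \in edges) = wf e.
Proof. by case: e => [[] []]. Qed.

Lemma edges_uniq : uniq edges. Proof. by []. Qed.

Lemma KnE : Kn 6 = gr edges.
Proof.
apply/finset.setP => e; rewrite inE [RHS]inE; apply/cards2P/mapP.
  move=> [i [j [neq_ij ->]]]; exists (mk (vo i) (vo j)).
    by rewrite edges_wf mk_wf ?(inj_eq (can_inj voK)).
  by rewrite E_mk !voK.
move=> [[a b]]; rewrite edges_wf /wf ltvE /= => ltab ->.
by exists (ov a), (ov b); split=> //; rewrite -(inj_eq val_inj) neq_ltn ltab.
Qed.

Lemma E_Kn e : wf e -> E e \in Kn 6.
Proof. by move=> we; rewrite KnE inE map_f ?edges_wf. Qed.

Lemma KnP (e : {set 'I_6}) : reflect (exists2 f, wf f & e = E f) (e \in Kn 6).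
Proof.
rewrite KnE inE; apply: (iffP mapP) => -[f wf_f ->]; exists f => //.
  by rewrite -edges_wf.
by rewrite edges_wf.
Qed.

Lemma gr_Kn A : all wf A -> gr A \subset Kn 6.
Proof. by move=> wA; rewrite gr_subset (sub_all _ wA) // => e; apply: E_Kn. Qed.

Fixpoint arrangements (n : nat) (l : seq vx) : seq (seq vx) :=
  if n is n'.+1 then
    flatten [seq map (cons a) (arrangements n' [seq b <- l | ~~ eqv a b]) | a <- l]
  else [:: [::]].

Definition hex_of (s : seq vx) : hex vx :=
  if s is [:: a; b; c; d; e; f] then Hex a b c d e f
  else Hex V0 V0 V0 V0 V0 V0.
Definition seq_of (t : hex vx) : seq vx := map (get t) vs.

Definition perms : seq (hex vx) := map hex_of (arrangements 6 vs).

Lemma arrangementsP n l s :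
  reflect [/\ size s = n, uniq s & {subset s <= l}] (s \in arrangements n l).
Proof.
elim: n l s => [|n IHn] l s /=.
  rewrite inE; apply: (iffP eqP) => [-> //|[/size0nil]] //.
apply: (iffP flattenP) => [[_ /mapP[a al ->] /mapP[t /IHn[st ut tl] ->]]|].
  split; rewrite /= ?st //.
    rewrite ut andbT; apply/negP => /tl.
    by rewrite mem_filter eqvE eqxx.
  move=> b; rewrite inE => /predU1P[-> //|/tl].
  by rewrite mem_filter => /andP[].
case: s => [[]|a t] // [[st] /= /andP[nat ut] sub_l].
have al : a \in l by apply: sub_l; rewrite mem_head.
exists (map (cons a) (arrangements n [seq b <- l | ~~ eqv a b])).
  by apply/mapP; exists a.
apply/mapP; exists t => //; apply/IHn; split=> // b bt.
rewrite mem_filter sub_l ?inE ?bt ?orbT // andbT eqvE.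
by apply: contraNneq nat => ->.
Qed.

Lemma hex_ofK s : size s = 6 -> seq_of (hex_of s) = s.
Proof. by case: s => [|a[|b[|c[|d[|e[|f[|]]]]]]]. Qed.

Lemma seq_ofK t : hex_of (seq_of t) = t.
Proof. by case: t. Qed.

HB.instance Definition _ := Equality.copy (hex vx) (can_type seq_ofK).

Lemma get_nth t a : get t a = nth V0 (seq_of t) (ov a).
Proof. by case: a. Qed.

Lemma permsP t : reflect (injective (get t)) (t \in perms).
Proof.
apply: (iffP mapP) => [[s /arrangementsP[sz us _] ->] a b /eqP|inj_t].
  rewrite !get_nth hex_ofK // => eq_ab; apply: (can_inj ovK); apply: val_inj.
  by apply/eqP; rewrite -(nth_uniq V0 _ _ us) ?sz ?ltn_ord.
exists (seq_of t); last by rewrite seq_ofK.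
apply/arrangementsP; split=> //; first by rewrite map_inj_uniq.
by case.
Qed.

Lemma size_perms : size perms = 720.
Proof. by vm_compute. Qed.

Definition hexS (s : 'S_6) : hex vx := hexfun (fun v => vo (s (ov v))).

Lemma get_hexS s v : get (hexS s) v = vo (s (ov v)).
Proof. by rewrite get_hexfun. Qed.

Lemma hexS_perms s : hexS s \in perms.
Proof.
apply/permsP => a b; rewrite !get_hexS.
by move=> /(can_inj voK)/perm_inj/(can_inj ovK).
Qed.

Lemma hexS_inj : injective hexS.
Proof.
move=> s t eq_st; apply/permP => i.
have := congr1 (fun u => ov (get u (vo i))) eq_st.
by rewrite !get_hexS !voK.
Qed.

Lemma hexS_surj t : t \in perms -> exists s, hexS s = t.
Proof.
move=> /permsP inj_t.
have inj_f : injective (fun i => ov (get t (vo i))).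
  by move=> i j /(can_inj ovK)/inj_t/(can_inj voK).
exists (perm inj_f); apply: hex_ext => v.
by rewrite get_hexS permE !ovK.
Qed.

Lemma perm_hexS : perm_eq (map hexS (enum {:'S_6})) perms.
Proof.
have uS : uniq (map hexS (enum {:'S_6})).
  by rewrite (map_inj_uniq hexS_inj) enum_uniq.
have sS : {subset map hexS (enum {:'S_6}) <= perms}.
  by move=> _ /mapP[s _ ->]; apply: hexS_perms.
have szS : (size perms <= size (map hexS (enum {:'S_6})))%N.
  by rewrite size_map -cardE card_Sn size_perms.
have [eq_sz eqi] := uniq_min_size uS sS szS.
by apply: uniq_perm; rewrite ?(leq_size_uniq uS sS szS).
Qed.

Lemma card_hexS (P : pred (hex vx)) :
  #|[set s : 'S_6 | P (hexS s)]%SET| = count P perms.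
Proof.
rewrite -(seq.permP perm_hexS) count_map -sum1_card -sum1_count [RHS]big_enum_cond /=.
by apply: eq_bigl => s; rewrite inE.
Qed.

Definition move_edge (t : hex vx) (e : edge) : edge := mk (get t e.1) (get t e.2).
Definition move_side (t : hex vx) (A : side) : side := map (move_edge t) A.

Lemma move_edge_wf t e : t \in perms -> wf e -> wf (move_edge t e).
Proof.
move=> /permsP inj_t we; rewrite /move_edge mk_wf // (inj_eq inj_t).
by apply: contraTneq we; case: e => a b /= ->; case: b.
Qed.

Lemma move_side_wf t A : t \in perms -> all wf A -> all wf (move_side t A).
Proof. by move=> tP; rewrite all_map; apply: sub_all => e /=; apply: move_edge_wf. Qed.

Lemma relabel_E (s : 'S_6) e : [set s i | i in E e]%SET = E (move_edge (hexS s) e).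
Proof. by rewrite E_mk !get_hexS !voK /E imsetU1 imset_set1. Qed.

Lemma relabel_gr (s : 'S_6) A : relabel_graph s (gr A) = gr (move_side (hexS s) A).
Proof.
apply/finset.setP => e; apply/imsetP/idP => [[f]|]; rewrite inE.
  by move=> /mapP[g gA ->] ->; rewrite inE relabel_E map_f // map_f.
move=> /mapP[_ /mapP[f fA ->] ->].
by exists (E f); rewrite ?relabel_E // inE map_f.
Qed.

(** * Triangulations and representations of points *)
Local Open Scope classical_set_scope.
Local Open Scope ring_scope.

Section Geometry.
Variables (R : realType) (k : nat).
Notation n := k.+2.
Implicit Types (w : {set 'I_n} -> R) (F G : graph n) (T : complex n)
  (p y : 'rV[R]_n) (e : {set 'I_n}).

(** The point with homogeneous coordinates [w]. Weights off the edges do not count. *)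
Definition lin w : 'rV[R]_n := \sum_(e in Kn n) w e *: vertex R e.
(** The value at the vertex of [e] of the linear functional with coefficients [y]. *)
Definition ev y e : R := \sum_(i in e) y ord0 i.
Definition supported w G := forall e, e \notin G -> w e = 0.
Definition rep w G := (forall e, 0 <= w e) /\ supported w G.
Definition ind G e : R := (e \in G)%:R.

Lemma vertexE e i : vertex R e ord0 i = (i \in e)%:R.
Proof.
rewrite /vertex summxE; under eq_bigr do rewrite mxE eqxx /=.
have [ie|ie] := boolP (i \in e).
  rewrite (bigD1 i) //= eqxx big1 ?addr0 // => j /andP[_ neq_ji].
  by rewrite eq_sym (negbTE neq_ji).
by rewrite big1 // => j je; case: eqP => // eq_ij; rewrite eq_ij je in ie.
Qed.

Lemma linE w i : lin w ord0 i = \sum_(e in Kn n | i \in e) w e.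
Proof.
rewrite /lin summxE big_mkcondr; apply: eq_bigr => e _.
by rewrite mxE vertexE mulrC; case: ifP => _; rewrite ?mul1r ?mul0r.
Qed.

Lemma linD w1 w2 : lin (fun e => w1 e + w2 e) = lin w1 + lin w2.
Proof. by rewrite -big_split; apply: eq_bigr => e _; rewrite scalerDl. Qed.

Lemma linZ a w : lin (fun e => a * w e) = a *: lin w.
Proof. by rewrite scaler_sumr; apply: eq_bigr => e _; rewrite scalerA. Qed.

Lemma linB w1 w2 : lin (fun e => w1 e - w2 e) = lin w1 - lin w2.
Proof.
rewrite -[X in _ = _ + X]scaleN1r -linZ -linD.
by apply: eq_bigr => e _; rewrite mulN1r.
Qed.

Lemma eq_lin w1 w2 : (forall e, e \in Kn n -> w1 e = w2 e) -> lin w1 = lin w2.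
Proof. by move=> eq_w; apply: eq_bigr => e eK; rewrite eq_w. Qed.

Lemma lin_supp w G : G \subset Kn n -> supported w G ->
  lin w = \sum_(e in G) w e *: vertex R e.
Proof.
move=> /fintype.subsetP sGK sw; rewrite /lin (bigID (mem G)) /=.
rewrite [X in _ + X]big1 ?addr0 => [|e /andP[_ eG]]; last first.
  by rewrite sw // scale0r.
by apply: eq_bigl => e; rewrite andb_idl // => /sGK.
Qed.

Lemma sum_supp w G (f : {set 'I_n} -> R) : G \subset Kn n -> supported w G ->
  \sum_(e in Kn n) w e * f e = \sum_(e in G) w e * f e.
Proof.
move=> /fintype.subsetP sGK sw; rewrite (bigID (mem G)) /=.
rewrite [X in _ + X]big1 ?addr0 => [|e /andP[_ eG]]; last first.
  by rewrite sw // mul0r.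
by apply: eq_bigl => e; rewrite andb_idl // => /sGK.
Qed.

Lemma sum_supp1 w G : G \subset Kn n -> supported w G ->
  \sum_(e in Kn n) w e = \sum_(e in G) w e.
Proof.
move=> sGK sw; have := sum_supp (fun=> 1) sGK sw.
by rewrite -!big_distrl /= !mulr1.
Qed.

Lemma ev_lin y w :
  \sum_(e in Kn n) w e * ev y e = \sum_i y ord0 i * lin w ord0 i.
Proof.
under [RHS]eq_bigr do rewrite linE big_distrr big_mkcondr /=.
rewrite exchange_big; apply: eq_bigr => e _ /=.
rewrite big_distrr /= big_mkcond /=; apply: eq_bigr => i _.
by case: ifP => _ //; rewrite mulrC.
Qed.

Lemma ev_pair y i j : i != j -> ev y [set i; j]%SET = y ord0 i + y ord0 j.
Proof. by move=> neq_ij; rewrite /ev big_setU1 ?big_set1 // inE. Qed.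

Lemma ev_const e : e \in Kn n -> ev (const_mx 1) e = 2.
Proof.
rewrite inE => /eqP card_e; rewrite /ev; under eq_bigr do rewrite mxE.
by rewrite sumr_const card_e.
Qed.

(** The coordinate sum of a vertex is two, so that the point determines the total
    weight. *)
Lemma mass_lin w w' : lin w = lin w' ->
  \sum_(e in Kn n) w e = \sum_(e in Kn n) w' e.
Proof.
move=> eq_lin_w; have := ev_lin (const_mx 1) w; rewrite eq_lin_w -ev_lin.
under eq_bigr => e eK do rewrite ev_const //.
under [RHS]eq_bigr => e eK do rewrite ev_const //.
by rewrite -!big_distrl /= => /(mulIf _); apply; rewrite pnatr_eq0.
Qed.

Lemma convP G p : G \subset Kn n ->
  conv G p <-> exists w, [/\ rep w G, \sum_(e in Kn n) w e = 1 & p = lin w].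
Proof.
move=> sGK; split=> [[w [w_ge0 w1 ->]]|[w [[w_ge0 sw] w1 ->]]].
  pose w' e := if e \in G then w e else 0.
  have sw' : supported w' G by move=> e; rewrite /w' => /negbTE ->.
  exists w'; split; first split=> //.
  - by move=> e; rewrite /w'; case: ifP => // /w_ge0.
  - by rewrite -w1 (sum_supp1 sGK sw'); apply: eq_bigr => e eG; rewrite /w' eG.
  - by rewrite (lin_supp sGK sw'); apply: eq_bigr => e eG; rewrite /w' eG.
exists w; split=> //; last exact: lin_supp.
by rewrite -w1 (sum_supp1 sGK sw).
Qed.

(** The homogeneous form of a triangulation, without normalising weights to sum one:
    [tri_uniq] contains both the affine independence of cells and the condition on
    intersections. *)
Record tri T : Prop := Tri {
  tri_sub : forall G, T G -> G \subset Kn n;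
  tri_down : forall G H : graph n, T G -> H \subset G -> T H;
  tri_uniq : forall F G w w', T F -> T G -> rep w F -> rep w' G ->
    lin w = lin w' -> w =1 w';
  tri_cover : forall w, (forall e, 0 <= w e) ->
    exists F w', [/\ T F, rep w' F & lin w' = lin w] }.

Lemma rep_sub w G (H : graph n) : G \subset H -> rep w G -> rep w H.
Proof.
move=> /fintype.subsetP sGH [w_ge0 sw]; split=> // e eH.
by apply: sw; apply: contra eH; apply: sGH.
Qed.

Lemma repZ a w G : 0 <= a -> rep w G -> rep (fun e => a * w e) G.
Proof.
by move=> a_ge0 [w_ge0 sw]; split=> [e|e eG]; rewrite ?mulr_ge0 // sw ?mulr0.
Qed.

Lemma rep_eq0 w G : G \subset Kn n -> rep w G -> \sum_(e in Kn n) w e = 0 ->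
  forall e, w e = 0.
Proof.
move=> /fintype.subsetP sGK [w_ge0 sw] w0 e.
have [eG|/sw //] := boolP (e \in G).
apply/eqP; move/eqP: w0; rewrite psumr_eq0 // => /allP/(_ e).
by rewrite mem_index_enum => /(_ isT)/implyP; apply; apply: sGK.
Qed.

Lemma rep_ind G : rep (ind G) G.
Proof.
by split=> e; rewrite /ind ?ler0n // => /negbTE ->.
Qed.

Lemma lin_ind G : G \subset Kn n -> lin (ind G) = \sum_(e in G) vertex R e.
Proof.
move=> sGK; rewrite (lin_supp sGK (rep_ind G).2).
by apply: eq_bigr => e eG; rewrite /ind eG scale1r.
Qed.

Lemma sum_ind G : G \subset Kn n ->
  \sum_(e in Kn n) ind G e = \sum_(e in G) 1.
Proof.
move=> sGK; rewrite (sum_supp1 sGK (rep_ind G).2).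
by apply: eq_bigr => e eG; rewrite /ind eG.
Qed.

(** Scaling by the total weight passes between convex combinations and arbitrary
    weights. For independence, the positive and the negative part of a dependence on a
    cell represent the same point. *)
Lemma triP T : triangulation R T <-> tri T.
Proof.
split=> [[Tind Tdown Tcov Tcap]|Tt].
  have TK G : T G -> G \subset Kn n by case/Tind.
  have mass_ge0 w : (forall e, 0 <= w e) -> 0 <= \sum_(e in Kn n) w e.
    by move=> w_ge0; rewrite sumr_ge0.
  split=> //.
    move=> F G w w' TF TG rw rw' eqL.
    have eqm := mass_lin eqL.
    have [m0|m_gt0] : \sum_(e in Kn n) w e = 0 \/ 0 < \sum_(e in Kn n) w e.
      have := mass_ge0 w rw.1; rewrite le_eqVlt => /predU1P[<-|]; first by left.
      by right.
      by move=> e; rewrite (rep_eq0 (TK _ TF) rw) // (rep_eq0 (TK _ TG) rw') // -eqm.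
    set m := \sum_(e in Kn n) w e in eqm m_gt0.
    have mV : 0 <= m^-1 by rewrite invr_ge0 ltW.
    pose v e := m^-1 * w e; pose v' e := m^-1 * w' e.
    have cF : conv F (lin v).
      apply/convP; [exact: TK|exists v; split=> //; first exact: repZ].
      by rewrite -big_distrr /= mulVf // gt_eqF.
    have cG : conv G (lin v).
      apply/convP; [exact: TK|exists v'; split=> //; first exact: repZ].
        by rewrite -big_distrr /= -eqm mulVf // gt_eqF.
      by rewrite !linZ eqL.
    have : (conv F `&` conv G) (lin v) by split.
    rewrite Tcap // => /convP[|u [ru u1 eqLu]].
      by apply: fintype.subset_trans (TK _ TF); apply: finset.subsetIl.
    have indep H v1 v2 : T H -> rep v1 H -> rep v2 H -> lin v1 = lin v2 -> v1 =1 v2.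
      move=> TH r1 r2 eq12 e; have [eH|eH] := boolP (e \in H); last first.
        by rewrite r1.2 ?r2.2.
      have [sHK] := Tind H TH.
      have sd : supported (fun e => v1 e - v2 e) H.
        by move=> f fH; rewrite r1.2 ?r2.2 ?subrr.
      move=> /(_ (fun e => v1 e - v2 e)) ind_d; apply/eqP; rewrite -subr_eq0.
      rewrite ind_d ?eqxx //.
        by rewrite -(sum_supp1 sHK sd) sumrB (mass_lin eq12) subrr.
      by rewrite -lin_supp // linB eq12 subrr.
    have uF := indep F v u TF (repZ mV rw) (rep_sub (finset.subsetIl _ _) ru) eqLu.
    have eqLu' : lin v' = lin u by rewrite -eqLu !linZ eqL.
    have uG := indep G v' u TG (repZ mV rw') (rep_sub (finset.subsetIr _ _) ru) eqLu'.
    move=> e; apply: (@mulfI _ m^-1); first by rewrite invr_eq0 gt_eqF.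
    by rewrite -/(v e) uF -uG.
  have [e0 e0K] : exists e0, e0 \in Kn n.
    by exists [set ord0; lift ord0 ord0]%SET; rewrite inE cards2.
  have e0hyp : hypersimplex2 (vertex R e0).
    apply/convP => //; exists (ind [set e0]%SET); split.
    - by apply: rep_sub (rep_ind _); rewrite finset.sub1set.
    - by rewrite sum_ind ?finset.sub1set // big_set1.
    - by rewrite lin_ind ?finset.sub1set // big_set1.
  move=> w w_ge0.
  have [m0|m_gt0] : \sum_(e in Kn n) w e = 0 \/ 0 < \sum_(e in Kn n) w e.
    have := mass_ge0 w w_ge0; rewrite le_eqVlt => /predU1P[<-|]; by [left|right].
    move: e0hyp; rewrite -Tcov => -[F TF _].
    exists finset.set0, (fun=> 0); split=> //.
    - exact: Tdown TF (finset.sub0set _).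
    - apply: eq_lin => e eK; apply/esym.
      by apply/eqP; move/eqP: m0; rewrite psumr_eq0 // => /allP/(_ e); rewrite mem_index_enum eK; apply.
  set M := \sum_(e in Kn n) w e in m_gt0.
  have : hypersimplex2 (lin (fun e => M^-1 * w e)).
    apply/convP => //.
    exists (fun e => if e \in Kn n then M^-1 * w e else 0); split.
    - split=> [e|e /negbTE -> //].
      by case: ifP => // _; rewrite mulr_ge0 // invr_ge0 ltW.
    - rewrite (eq_bigr (fun e => M^-1 * w e)) => [|e -> //].
      by rewrite -big_distrr /= mulVf // gt_eqF.
    - by apply: eq_lin => e ->.
  rewrite -Tcov => -[F TF /convP[|v [rv _ eqL]]]; first exact: TK.
  exists F, (fun e => M * v e); split=> //; first exact: repZ (ltW _) _.
  by rewrite linZ -eqL linZ scalerA mulfV ?scale1r // gt_eqF.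
case: Tt => TK Tdown Tuniq Tcov; split=> //.
- move=> G TG; split; first exact: TK.
  move=> w w0 L0.
  pose pos (u : R) := if 0 <= u then u else 0.
  have pos_ge0 u : 0 <= pos u by rewrite /pos; case: ifP.
  pose v (s : R) e := if e \in G then pos (s * w e) else 0.
  have rv s : rep (v s) G.
    by split=> [e|e /negbTE]; rewrite /v; [case: ifP|move=> ->].
  have eqL : lin (v 1) = lin (v (-1)).
    apply/eqP; rewrite -subr_eq0 -linB (@lin_supp _ G) ?TK //; last first.
      by move=> e /negbTE eG; rewrite /v eG subrr.
    apply/eqP; rewrite -[RHS]L0; apply: eq_bigr => e eG; congr (_ *: _).
    rewrite /v eG /pos mul1r mulN1r oppr_ge0.
    by case: (ltgtP 0 (w e)) => [||<-]; rewrite ?subr0 ?sub0r ?opprK.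
  move=> e eG; have := Tuniq _ _ _ _ TG TG (rv 1) (rv (-1)) eqL e.
  rewrite /v eG /pos mul1r mulN1r oppr_ge0.
  by case: (ltgtP 0 (w e)) => // ?; lra.
- apply/seteqP; split=> [p [F TF]|p].
    move=> /(convP _ (TK _ TF))[w [rw w1 ->]].
    by apply/convP => //; exists w; split=> //; apply: rep_sub rw; apply: TK.
  move=> /(convP _ (fintype.subxx _))[w [rw w1 ->]].
  have [F [v [TF rv eqL]]] := Tcov w rw.1.
  exists F => //; apply/convP; first exact: TK.
  by exists v; rewrite eqL (mass_lin eqL).
- move=> G H TG TH; have sIK : G :&: H \subset Kn n.
    exact: fintype.subset_trans (finset.subsetIl _ _) (TK _ TG).
  apply/seteqP; split=> p.
    move=> [/(convP _ (TK _ TG))[w [rw w1 ->]] /(convP _ (TK _ TH))[v [rv v1 eqL]]].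
    have eq_wv := Tuniq _ _ _ _ TG TH rw rv eqL.
    apply/convP => //; exists w; split=> //; split; first exact: rw.1.
    move=> e; rewrite inE negb_and => /orP[/rw.2 //|/rv.2].
    by rewrite eq_wv.
  move=> /(convP _ sIK)[w [rw w1 ->]].
  by split; apply/convP; rewrite ?TK //; exists w; split=> //;
    apply: rep_sub rw; rewrite ?finset.subsetIl ?finset.subsetIr.
Qed.
End Geometry.

(** * Extending a cell on one side of a hyperplane *)

Section Extension.
Variables (R : realType) (k : nat).
Notation n := k.+2.
Implicit Types (w : {set 'I_n} -> R) (F G : graph n) (T : complex n)
  (p y : 'rV[R]_n) (e : {set 'I_n}).

Lemma tri_free T F w : tri R T -> T F -> supported w F -> lin w = 0 -> w =1 (fun=> 0).
Proof.
move=> tT TF sw L0; have /triP[Tind _ _ _] := tT.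
have [sFK ind_F] := Tind F TF.
have w0 e : e \in F -> w e = 0.
  apply: ind_F; rewrite -?lin_supp // -sum_supp1 //.
  rewrite (@mass_lin _ _ w (fun=> 0)) ?big1 // L0 /lin big1 // => f _.
  by rewrite scale0r.
by move=> e; have [/w0|/sw] := boolP (e \in F).
Qed.

(** The infinite pigeonhole principle. *)
Lemma frequent_value (A : finType) (F : nat -> A) :
  exists a, forall N, exists2 i, (N <= i)%N & F i = a.
Proof.
apply: contrapT => /forallNP noA.
have /choice[N NP] : forall a, exists N, forall i, (N <= i)%N -> F i <> a.
  move=> a; have /existsNP[N noN] := noA a; exists N => i leNi Fi.
  by apply: noN; exists i.
pose M := \max_a N a.
by apply: (NP (F M) M) => //; apply: leq_bigmax.
Qed.

(** Move the sum of the vertices of [G] a little towards the vertex of [f]. By the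
    pigeonhole principle some cell [H] contains arbitrarily small moves, hence, by
    linearity, also the sum itself, and therefore all of [G]. The functional [y] is
    negative at the moved points, hence at a vertex of [H]. *)
Lemma tri_extend T G y f : tri R T -> T G -> (forall e, e \in G -> ev y e = 0) ->
  f \in Kn n -> ev y f < 0 ->
  exists e, [/\ e \in Kn n, ev y e < 0 & T (e |: G)%SET].
Proof.
move=> tT TG yG fK yf.
have sG := tri_sub tT TG.
have sf : [set f]%SET \subset Kn n by rewrite finset.sub1set.
pose u (t : R) e := ind R G e + t * ind R [set f]%SET e.
have u_ge0 t e : 0 <= t -> 0 <= u t e.
  by move=> t_ge0; rewrite addr_ge0 ?mulr_ge0 ?ler0n.
pose t (i : nat) : R := i.+1%:R^-1.
have t_gt0 i : 0 < t i by rewrite invr_gt0.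
have /choice[F /choice[w Fw]] : forall i, exists F, exists w,
    [/\ T F, rep w F & lin w = lin (u (t i))].
  by move=> i; apply: (tri_cover tT) => e; apply: u_ge0; apply: ltW.
have [H HP] := frequent_value F.
have [a _ Fa] := HP 0%N.
have TH : T H by rewrite -Fa; case: (Fw a).
have linu s : lin (u s) = lin (ind R G) + s *: lin (ind R [set f]%SET).
  by rewrite linD linZ.
(* the combination of two moves within [H] in which [f] cancels *)
pose W b e := (t a * w b e - t b * w a e) / (t a - t b).
have tba b : (a < b)%N -> 0 < t a - t b.
  by move=> ltab; rewrite subr_gt0 ltf_pV2 ?posrE ?ltr0n // ltr_nat.
have linW b : (a < b)%N -> lin (W b) = lin (ind R G).
  move=> ltab; have := tba b ltab; set s := t a - t b => s_gt0.
  have -> : lin (W b) = s^-1 *: (t a *: lin (w b) - t b *: lin (w a)).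
    by rewrite -!linZ -linB -linZ; apply: eq_lin => e _; rewrite /W mulrC.
  have [_ _ ->] := Fw b; have [_ _ ->] := Fw a; rewrite !linu.
  have -> (A B : 'rV[R]_n) : t a *: (A + t b *: B) - t b *: (A + t a *: B) = s *: A.
    rewrite !scalerDr !scalerA [t b * t a]mulrC opprD addrACA subrr addr0.
    by rewrite -scalerBl.
  by rewrite scalerA mulVf ?scale1r // gt_eqF.
have sW b : F b = H -> supported (W b) H.
  move=> Fb e eH; have [_ [_ sb] _] := Fw b; have [_ [_ sa] _] := Fw a.
  by rewrite /W sb ?Fb // sa ?Fa // !mulr0 subrr mul0r.
have [b ltab Fb] := HP a.+1.
have eqW c : (a < c)%N -> F c = H -> W c =1 W b.
  move=> ltac Fc e; apply/eqP; rewrite -subr_eq0; apply/eqP.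
  have sd : supported (fun e => W c e - W b e) H.
    by move=> g gH; rewrite !sW ?subrr.
  by apply: (tri_free tT TH sd); rewrite linB !linW ?subrr.
(* [W b] is the same for all later moves within [H], and a negative weight would
   survive in a sufficiently small one *)
have W_ge0 e : 0 <= W b e.
  rewrite leNgt; apply/negP => Wlt0.
  have wa_ge0 : 0 <= w a e by case: (Fw a) => _ [].
  pose x := (w a e - W b e) / (- W b e * t a).
  have x_ge0 : 0 <= x.
    by rewrite divr_ge0 ?mulr_ge0 ?oppr_ge0 ?(ltW Wlt0) ?(ltW (t_gt0 a)) //; lra.
  have [c lec Fc] := HP (maxn a.+1 (Num.truncn x).+1).
  have [ltac ltxc] : (a < c)%N /\ (Num.truncn x < c)%N.
    by move: lec; rewrite geq_max => /andP[].
  have := eqW c ltac Fc e; rewrite /W => /(canRL (mulfVK _)) => eqc.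
  have {}eqc : t a * w c e - t c * w a e = W b e * (t a - t c).
    by apply: eqc; rewrite gt_eqF // tba.
  have wc_ge0 : 0 <= w c e by case: (Fw c) => _ [].
  have h1 : - W b e * t a <= t c * (w a e - W b e).
    have := mulr_ge0 (ltW (t_gt0 a)) wc_ge0; rewrite -subr_ge0 => h.
    by rewrite -subr_ge0; move: h eqc; rewrite !mulrBr !mulNr; lra.
  have h2 : t c * x < 1.
    rewrite mulrC -ltr_pdivlMr ?t_gt0 // div1r invrK.
    have := truncnS_gt x; move/lt_le_trans; apply.
    by rewrite ler_nat ltnS ltnW.
  have pos : 0 < - W b e * t a by rewrite mulr_gt0 ?oppr_gt0.
  by move: h2; rewrite /x mulrA ltr_pdivrMr // mul1r ltNge h1.
have rW : rep (W b) H by split=> //; apply: sW.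
have eqWG : W b =1 ind R G.
  have [Q [v [TQ rv linv]]] := tri_cover tT (rep_ind R G).1.
  move=> e; rewrite (tri_uniq tT TH TG rW (rep_ind R G)) //; exact: linW.
have sGH : G \subset H.
  apply/fintype.subsetP => e eG; apply: contraT => eH.
  have := eqWG e; rewrite /ind eG (sW b Fb) // => /eqP.
  by rewrite eq_sym oner_eq0.
have [_ [wa_ge0 sa] lina] := Fw a.
have : \sum_(e in Kn n) w a e * ev y e < 0.
  rewrite ev_lin lina -ev_lin; under eq_bigr do rewrite mulrDl.
  rewrite big_split /= (sum_supp _ sG (rep_ind R G).2) big1 ?add0r; last first.
    by move=> e /yG ->; rewrite mulr0.
  under eq_bigr do rewrite -mulrA.
  rewrite -big_distrr /= (sum_supp _ sf (rep_ind R _).2) big_set1 /ind set11 mul1r.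
  by rewrite pmulr_rlt0.
move=> sum_lt0.
have [e eK we_lt0] : exists2 e, e \in Kn n & w a e * ev y e < 0.
  apply: contrapT => noe; move: sum_lt0; apply/negP; rewrite -leNgt.
  apply: sumr_ge0 => e eK; rewrite leNgt; apply/negP => lt0.
  by apply: noe; exists e.
exists e; split=> //.
  by rewrite ltNge; apply/negP => y_ge0; move: we_lt0; rewrite ltNge mulr_ge0.
apply: (tri_down tT TH); rewrite finset.subUset sGH andbT finset.sub1set.
apply: contraT => eH; move: we_lt0.
by rewrite sa ?Fa // mul0r ltxx.
Qed.
End Extension.

(** * Circuits as closed walks *)
Local Open Scope ring_scope.

Definition circuit := (side * side)%type.

Fixpoint walk_edges (x0 : vx) (w : seq vx) : side :=
  if w is a :: w' then mk a (head x0 w') :: walk_edges x0 w' else [::].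

Fixpoint alternate (A : side) : circuit :=
  if A is e :: A' then let: (p, m) := alternate A' in (e :: m, p)
  else ([::], [::]).

Definition closed_walk (w : seq vx) : circuit :=
  alternate (walk_edges (head V0 w) w).

Definition swap (Z : circuit) : circuit := (Z.2, Z.1).

(** A closed walk together with a condition on the labelling that keeps one labelling of
    each class under the symmetries of the walk. *)
Definition template := (seq vx * (hex vx -> bool))%type.

Definition four_cycle : template :=
  ([:: V0; V1; V2; V3], fun t => let: Hex a b c d e f := t in
    ltv a b &&& ltv a c &&& ltv a d &&& ltv b d &&& ltv e f).
Definition six_cycle : template :=
  ([:: V0; V1; V2; V3; V4; V5], fun t => let: Hex a b c d e f := t in
    ltv a b &&& ltv a c &&& ltv a d &&& ltv a e &&& ltv a f &&& ltv b f).
Definition bowtie : template :=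
  ([:: V0; V1; V2; V0; V3; V4], fun t => let: Hex a b c d e f := t in
    ltv b c &&& ltv d e &&& ltv b d).
Definition dumbbell : template :=
  ([:: V0; V1; V2; V0; V3; V4; V5; V3], fun t => let: Hex a b c d e f := t in
    ltv b c &&& ltv e f &&& ltv a d).

Definition instances (t : template) : seq circuit :=
  [seq closed_walk (map (get s) t.1) | s <- perms & t.2 s].

Definition half_circs : seq circuit :=
  instances four_cycle ++ instances six_cycle ++ instances bowtie ++
  instances dumbbell.
(** Both orientations of every circuit. *)
Definition circs : seq circuit := half_circs ++ map swap half_circs.

Definition sub2 (Z Y : circuit) : bool := sub Z.1 Y.1 &&& sub Z.2 Y.2.

(** This check justifies the conditions in the templates: no labelling of the walk is
    lost, up to orientation. *)
Definition listed (t : template) : bool :=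
  let cs := instances t in
  every (fun s => let Z := closed_walk (map (get s) t.1) in
                any (fun Y => sub2 Y Z ||| sub2 Y (swap Z)) cs) perms.

Lemma templates_listed :
  [&& listed four_cycle, listed six_cycle, listed bowtie & listed dumbbell].
Proof. vm_cast_no_check (erefl true). Qed.

(** An exhaustive exploration of alternating walks. At the label [v] the walk has just
    arrived by an edge in [M] if [pos] holds and in [P] otherwise, and it leaves by an
    edge of the opposite sign, either to a label in [used] or to the first label in
    [fresh]; the labels in [fresh] are interchangeable. It succeeds if every branch
    contains a circuit or gives some edge both signs. *)
Fixpoint dfs (cs : seq circuit) (fuel : nat) (used fresh : seq vx) (v : vx)
    (pos : bool) (P M : side) : bool :=
  any (fun Z => sub2 Z (P, M)) cs ||| any (has_edge M) P |||
  if fuel is fuel'.+1 then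
    every (fun u => eqv u v |||
      (if pos then dfs cs fuel' used fresh u false (mk v u :: P) M
       else dfs cs fuel' used fresh u true P (mk v u :: M))) used &&&
    (if fresh is u :: fresh' then
      if pos then dfs cs fuel' (u :: used) fresh' u false (mk v u :: P) M
      else dfs cs fuel' (u :: used) fresh' u true P (mk v u :: M)
     else true)
  else false.

Lemma dfs_circs :
  dfs circs 11 [:: V1; V0] [:: V2; V3; V4; V5] V1 false [:: (V0, V1)] [::].
Proof. vm_cast_no_check (erefl true). Qed.

Lemma sub2P Z Y : reflect (sub Z.1 Y.1 /\ sub Z.2 Y.2) (sub2 Z Y).
Proof. by rewrite /sub2; apply: (iffP andP). Qed.

Section Conformal.
Variable R : realType.
Implicit Types (w : {set 'I_6} -> R) (Z : circuit).

(** At the label [a] the weights of the incident edges sum to zero, so that they cannot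
    all have the same sign. *)
Lemma lin_alternates w a b : lin w = 0 -> a != b -> w (E (mk a b)) != 0 ->
  exists2 c, a != c & w (E (mk a c)) * w (E (mk a b)) < 0.
Proof.
move=> L0 neq_ab wab; apply: contrapT => noc.
have nn c : a != c -> 0 <= w (E (mk a c)) * w (E (mk a b)).
  by move=> neq_ac; rewrite leNgt; apply/negP => lt0; apply: noc; exists c.
have := congr1 (fun M : 'rV[R]_6 => M ord0 (ov a)) L0.
rewrite linE mxE => /(congr1 ( *%R^~ (w (E (mk a b))))); rewrite mul0r big_distrl /=.
have aab : ov a \in E (mk a b) by rewrite E_mk set21.
rewrite (bigD1 (E (mk a b))) /= ?E_Kn ?mk_wf // => s0.
suff : 0 < w (E (mk a b)) * w (E (mk a b)) +
           \sum_(i | (i \in Kn 6) && (ov a \in i) && (i != E (mk a b)))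
              w i * w (E (mk a b)) by rewrite s0 ltxx.
rewrite ltr_pwDl ?sumr_ge0 //; first by rewrite -expr2 exprn_even_gt0.
move=> _ /andP[/andP[/KnP[[c d] wf_cd ->] /= ain] _].
have neq_cd : c != d by apply: contraTneq wf_cd => ->; case: d {ain}.
have mkE : (c, d) = mk c d by rewrite /mk; move: wf_cd; rewrite /wf /= => ->.
move: ain; rewrite !inE /= !(inj_eq (can_inj ovK)) => /orP[] /eqP eq_a; subst.
  by rewrite mkE nn.
by rewrite mkE E_mk finset.setUC -E_mk nn // eq_sym.
Qed.

Definition pulled w (f : vx -> vx) e := w (E (mk (f e.1) (f e.2))).

Lemma mkC a b : mk a b = mk b a.
Proof. by case: a; case: b. Qed.

Lemma pulled_mk w f a b : pulled w f (mk a b) = w (E (mk (f a) (f b))).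
Proof. by rewrite /pulled [mk a b]/mk; case: ifP => //= _; rewrite mkC. Qed.

(** The walk is followed inside the support of [w]: [lin_alternates] provides the next
    edge with the right sign. When it leads to a label not yet used, the transposition
    with the first fresh label changes the identification [f] so that the exploration
    applies. *)
Lemma dfs_sound w cs n used fresh v pos P M f :
  lin w = 0 -> dfs cs n used fresh v pos P M -> injective f ->
  uniq (used ++ fresh) -> (forall u, u \in used ++ fresh) -> v \in used ->
  all (fun e => (e.1 \in used) && (e.2 \in used)) (P ++ M) ->
  (forall e, e \in P -> 0 < pulled w f e) ->
  (forall e, e \in M -> pulled w f e < 0) ->
  (exists2 u, v != u & mk v u \in (if pos then M else P)) ->
  exists g Y, [/\ injective g, Y \in cs,
    forall e, e \in Y.1 -> 0 < pulled w g e & forall e, e \in Y.2 -> pulled w g e < 0].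
Proof.
move=> L0; elim: n used fresh v pos P M f => [|n IHn] used fresh v pos P M f /=;
  rewrite !anyE.
  case: ifP => // /orP[] h _ inj_f _ _ _ _ HP HM _.
    have /hasP[Y Ycs /sub2P[/subP s1 /subP s2]] := h.
    by exists f, Y; split=> // e; [move=> /s1/HP|move=> /s2/HM].
  have /hasP[e eP] := h; rewrite has_edgeE => /HM.
  by rewrite ltNge ltW ?HP.
case: ifP => [/orP[] h _ inj_f _ _ _ _ HP HM _|_].
- have /hasP[Y Ycs /sub2P[/subP s1 /subP s2]] := h.
  by exists f, Y; split=> // e; [move=> /s1/HP|move=> /s2/HM].
- have /hasP[e eP] := h; rewrite has_edgeE => /HM.
  by rewrite ltNge ltW ?HP.
rewrite everyE; case: ifP => // /allP dfs_used dfs_fresh inj_f uniq_uf all_uf vu PMu HP HM.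
case=> u0 neq_vu0 vu0.
have wn0 : w (E (mk (f v) (f u0))) != 0.
  rewrite -pulled_mk; case: (pos) vu0 => [/HM|/HP]; first by move=> /lt_eqF ->.
  by move=> /gt_eqF ->.
have [|c neq_c sgn_c] := lin_alternates L0 _ wn0; first by rewrite (inj_eq inj_f).
have sgn : if pos then 0 < w (E (mk (f v) c)) else w (E (mk (f v) c)) < 0.
  move: vu0 sgn_c; case: (pos) => [/HM|/HP]; rewrite pulled_mk => s0.
    by rewrite nmulr_llt0.
  by rewrite pmulr_llt0.
have [u def_c] : exists u, f u = c.
  have uf : uniq (map f vs) by rewrite map_inj_uniq.
  have [] := uniq_min_size uf (_ : {subset _ <= vs}) (leqnn _); first by case.
  by move=> _ /(_ c); have -> : c \in vs by [case: (c)]; move=> /mapP[u _ ->]; exists u.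
have neq_vu : v != u by apply: contraNneq neq_c => ->; rewrite def_c.
have step g used' fresh' u' : g v = f v -> g u' = c -> {in used, g =1 f} ->
  injective g -> uniq (used' ++ fresh') -> (forall x, x \in used' ++ fresh') ->
  {subset used <= used'} -> u' \in used' ->
  (if pos then dfs cs n used' fresh' u' false (mk v u' :: P) M
   else dfs cs n used' fresh' u' true P (mk v u' :: M)) ->
  exists g Y, [/\ injective g, Y \in cs,
    forall e, e \in Y.1 -> 0 < pulled w g e & forall e, e \in Y.2 -> pulled w g e < 0].
  move=> gv gu eq_gf inj_g uniq' all' sub' u'in dfs'.
  have neq_vu' : v != u' by apply: contraNneq neq_c => eq_vu; rewrite -gu -eq_vu gv.
  have mkin : ((mk v u').1 \in used') && ((mk v u').2 \in used').
    by rewrite /mk; case: ifP => _ /=; rewrite u'in sub'.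
  have PMu' : all (fun e => (e.1 \in used') && (e.2 \in used')) (P ++ M).
    by apply: sub_all PMu => e /andP[/sub' -> /sub' ->].
  have same e : e \in P ++ M -> pulled w g e = pulled w f e.
    by move=> /(allP PMu)/andP[e1 e2]; rewrite /pulled !eq_gf.
  have HP' e : e \in P -> 0 < pulled w g e.
    by move=> eP; rewrite same ?HP // mem_cat eP.
  have HM' e : e \in M -> pulled w g e < 0.
    by move=> eM; rewrite same ?HM // mem_cat eM orbT.
  have pullmk : pulled w g (mk v u') = w (E (mk (f v) c)) by rewrite pulled_mk gv gu.
  move: sgn dfs'; case: (pos) => sgn' dfs'; apply: IHn dfs' inj_g uniq' all' u'in _ _ _ _ => //=.
  - by rewrite mkin.
  - by move=> e; rewrite inE => /predU1P[->|/HP' //]; rewrite pullmk.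
  - by exists v; rewrite 1?eq_sym // mkC mem_head.
  - by move: PMu'; rewrite !all_cat /= mkin => /andP[-> ->].
  - by move=> e; rewrite inE => /predU1P[->|/HM' //]; rewrite pullmk.
  - by exists v; rewrite 1?eq_sym // mkC mem_head.
have [u_used|u_new] := boolP (u \in used).
  have := dfs_used u u_used; rewrite eqvE eq_sym (negbTE neq_vu) => dfs'.
  exact: (step f used fresh u).
have : u \in fresh by move: (all_uf u); rewrite mem_cat (negbTE u_new).
case: fresh uniq_uf all_uf dfs_fresh {dfs_used} step => // u1 fresh' uniq_uf all_uf dfs' step _.
(* exchange the label that is reached with the first fresh one *)
pose tr x := if x == u1 then u else if x == u then u1 else x.
have trK : involutive tr.
  move=> x; rewrite /tr; have [->|n1] := eqVneq x u1; first by rewrite eqxx; case: eqVneq.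
  by have [->|n2] := eqVneq x u; rewrite ?eqxx // (negbTE n1) (negbTE n2).
have u1_new : u1 \notin used.
  by move: uniq_uf; rewrite cat_uniq /= => /and3P[_ /norP[]].
apply: (step (f \o tr) (u1 :: used) fresh' u1) => //=.
- rewrite /tr; case: eqVneq => [eq_v|_]; first by rewrite -eq_v vu in u1_new.
  by rewrite (negbTE neq_vu).
- by rewrite /tr eqxx.
- move=> x x_used; rewrite /= /tr; case: eqVneq => [eq_x|_].
    by rewrite -eq_x x_used in u1_new.
  by case: eqVneq => // eq_x; rewrite -eq_x x_used in u_new.
- exact: inj_comp inj_f (inv_inj trK).
- by move: uniq_uf; rewrite -[u1 :: fresh']cat1s uniq_catCA.
- by move=> x; have := all_uf x; rewrite !inE !mem_cat inE orbCA.
- by move=> x x_used; rewrite inE x_used orbT.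
- by rewrite mem_head.
Qed.
End Conformal.

(** * Every affine dependence contains a circuit *)

Lemma closed_walk_map (g : vx -> vx) w :
  let mg := map (fun e : edge => mk (g e.1) (g e.2)) in
  closed_walk (map g w) = (mg (closed_walk w).1, mg (closed_walk w).2).
Proof.
move=> mg; have g_mk a b : mk (g (mk a b).1) (g (mk a b).2) = mk (g a) (g b).
  by rewrite [mk a b]/mk; case: ifP => //= _; rewrite mkC.
have walk_map x0 v : walk_edges (g x0) (map g v) = mg (walk_edges x0 v).
  by elim: v => //= a v ->; rewrite g_mk; case: v.
have alt_map A : alternate (mg A) = (mg (alternate A).1, mg (alternate A).2).
  by elim: A => //= e A ->; case: (alternate A).
case: w => // a w; rewrite /closed_walk -alt_map -walk_map.
by [].
Qed.

Definition edge_start (a b : vx) : bool :=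
  eqv a b ||| any (fun t => eqv (get t V0) a &&& eqv (get t V1) b) perms.

Lemma edge_starts : every (fun a => every (edge_start a) vs) vs.
Proof. vm_cast_no_check (erefl true). Qed.

Lemma vsE v : v \in vs. Proof. by case: v. Qed.

Lemma instances_walk t Z : Z \in instances t ->
  exists2 s, s \in perms & Z = closed_walk (map (get s) t.1).
Proof. by case/mapP=> s; rewrite mem_filter => /andP[_ sP] ->; exists s. Qed.

Lemma half_circsP Z : Z \in half_circs ->
  exists t, [/\ listed t, {subset instances t <= half_circs} & Z \in instances t].
Proof.
have := templates_listed; case/and4P=> l1 l2 l3 l4.
rewrite /half_circs !mem_cat => /or4P[] Zi; [exists four_cycle|exists six_cycle
  |exists bowtie|exists dumbbell].
all: by split; [assumption|move=> Y Yi; rewrite /half_circs !mem_cat Yi ?orbT|assumption].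
Qed.

Lemma swapK : involutive swap. Proof. by case. Qed.

Lemma circsE Z : (Z \in circs) = (Z \in half_circs) || (swap Z \in half_circs).
Proof. by rewrite mem_cat -{2}[Z]swapK (mem_map (inv_inj swapK)). Qed.

Lemma swap_circs Z : Z \in circs -> swap Z \in circs.
Proof. by rewrite !circsE swapK orbC. Qed.

Lemma walk_listed t s : listed t -> {subset instances t <= half_circs} -> s \in perms ->
  exists2 Z, Z \in circs & sub2 Z (closed_walk (map (get s) t.1)).
Proof.
rewrite /listed everyE => /allP l_t sub_t /l_t; rewrite anyE.
case/hasP=> Y /sub_t Yc /orP[] sY; first by exists Y; rewrite // circsE Yc.
exists (swap Y); first by apply: swap_circs; rewrite circsE Yc.
by move: sY; rewrite /sub2 /=; do 2!case: (sub _ _).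
Qed.

Section ConformalCircuit.
Variable R : realType.
Implicit Types (w : {set 'I_6} -> R) (Z : circuit).

(** Starting with a positive edge, the exploration of alternating walks must find a
    circuit whose edges have the signs of [w]. *)
Lemma conformal w : lin w = 0 -> (exists2 e, e \in Kn 6 & w e != 0) ->
  exists Z, [/\ Z \in circs, forall e, e \in Z.1 -> 0 < w (E e) &
                forall e, e \in Z.2 -> w (E e) < 0].
Proof.
move=> L0 [_ /KnP[[a b] wf_ab ->] wab].
have neq_ab : a != b by apply: contraTneq wf_ab => ->; case: (b).
have mk_ab : (a, b) = mk a b by rewrite /mk; move: wf_ab; rewrite /wf /= => ->.
rewrite mk_ab in wab.
have [c [neq_ac wac]] : exists c, a != c /\ 0 < w (E (mk a c)).
  have [gt0|lt0|eq0] := ltgtP 0 (w (E (mk a b))); last by rewrite -eq0 eqxx in wab.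
    by exists b.
  have [c neq_ac] := lin_alternates L0 neq_ab wab.
  by rewrite nmulr_llt0 // => wc; exists c.
have [t tP [t0 t1]] : exists2 t, t \in perms & get t V0 = a /\ get t V1 = c.
  have := edge_starts; rewrite everyE => /allP/(_ a (vsE a)).
  rewrite everyE => /allP/(_ c (vsE c)); rewrite /edge_start eqvE (negbTE neq_ac) anyE.
  by case/hasP=> t tP; rewrite !eqvE => /andP[/eqP ? /eqP ?]; exists t.
have inj_t := permsP t tP.
have [|||||||g [Y [inj_g Yc Yp Ym]]] := dfs_sound L0 dfs_circs inj_t.
- by [].
- by case.
- by [].
- by [].
- by move=> e; rewrite inE => /eqP ->; rewrite /pulled /= t0 t1.
- by [].
- by exists V0.
have [tw [l_tw sub_tw [s sP defY]]] : exists t, [/\ listed t, {subset instances t <= half_circs} &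
    exists2 s, s \in perms & Y = closed_walk (map (get s) t.1) \/
                             Y = swap (closed_walk (map (get s) t.1))].
  move: Yc; rewrite circsE => /orP[] /half_circsP[u [lu su /instances_walk[s sP eqY]]];
    exists u; split=> //; exists s => //; first by left.
  by right; rewrite -eqY swapK.
pose h := hexfun (fun v => g (get s v)).
have hP : h \in perms.
  by apply/permsP => x y; rewrite !get_hexfun => /inj_g; apply: (permsP s sP).
have eq_h : map (get h) tw.1 = map g (map (get s) tw.1).
  by rewrite -map_comp; apply: eq_map => v; rewrite get_hexfun.
have [Z Zc] := walk_listed l_tw sub_tw hP; rewrite eq_h closed_walk_map /= => /andP[/subP s1 /subP s2].
have pullE (A : side) e : e \in map (fun e : edge => mk (g e.1) (g e.2)) A ->
  exists2 e', e' \in A & w (E e) = pulled w g e'.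
  by move=> /mapP[e' e'A ->]; exists e'.
case: defY => eqY; subst Y.
  exists Z; split=> // e; first by move=> /s1/pullE[e' /Yp + ->].
  by move=> /s2/pullE[e' /Ym + ->].
exists (swap Z); split=> [|e|e]; first exact: swap_circs.
  by move=> /s2/pullE[e' /Yp + ->].
by move=> /s1/pullE[e' /Ym + ->].
Qed.
End ConformalCircuit.

(** * Circuits decide between triangulations *)
Local Open Scope classical_set_scope.
Local Open Scope ring_scope.

(** Degrees at each label being equal on the two sides is what makes a circuit an affine
    dependence. *)
Definition vdeg (v : vx) (A : side) : nat :=
  foldr (fun e n => if eqv v e.1 ||| eqv v e.2 then n.+1 else n) 0%N A.

Definition circuit_ok (Z : circuit) : bool :=
  every wf Z.1 &&& every wf Z.2 &&& ~~ nilp Z.1 &&&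
  every (fun e => ~~ has_edge Z.2 e) Z.1 &&&
  every (fun v => vdeg v Z.1 == vdeg v Z.2) vs.

Lemma half_circs_ok : every circuit_ok half_circs.
Proof. vm_cast_no_check (erefl true). Qed.

Lemma circuit_okP Z : reflect
  [/\ all wf Z.1, all wf Z.2, exists e, e \in Z.1,
      forall e, e \in Z.1 -> e \notin Z.2 & forall v, vdeg v Z.1 = vdeg v Z.2]
  (circuit_ok Z).
Proof.
rewrite /circuit_ok !everyE -!/(_ && _) -!andbA.
apply: (iffP and5P) => [[w1 w2 ne /allP dj /allP dg]|[w1 w2 [e e1] dj dg]].
  split=> // [|e /dj|v]; last exact/eqP/dg/vsE.
    by case: Z.1 ne => // e A _; exists e; rewrite mem_head.
  by rewrite has_edgeE.
split=> //; first by case: Z.1 e1.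
  by apply/allP => f /dj; rewrite has_edgeE.
by apply/allP => v _; rewrite dg.
Qed.

Lemma vdeg_gt0 A e : e \in A -> (0 < vdeg e.1 A)%N.
Proof.
elim: A => //= f A IHA; rewrite inE => /predU1P[<-|/IHA]; first by rewrite !eqvE eqxx.
by case: ifP.
Qed.

Lemma swap_ok Z : circuit_ok Z -> circuit_ok (swap Z).
Proof.
move=> /circuit_okP[w1 w2 [e e1] dj dg]; apply/circuit_okP; split=> //.
- have := vdeg_gt0 e1; rewrite dg /=; case: Z.2 => // f A _.
  by exists f; rewrite mem_head.
- by move=> f f2; apply/negP => /dj; rewrite f2.
Qed.

Lemma circs_ok Z : Z \in circs -> circuit_ok Z.
Proof.
have := half_circs_ok; rewrite everyE => /allP okP.
rewrite circsE => /orP[/okP //|/okP /swap_ok]; by rewrite swapK.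
Qed.

Lemma circs_wf1 Z : Z \in circs -> all wf Z.1.
Proof. by move=> /circs_ok/circuit_okP[]. Qed.

Lemma circs_wf2 Z : Z \in circs -> all wf Z.2.
Proof. by move=> /circs_ok/circuit_okP[]. Qed.

Lemma circs_neq0 Z : Z \in circs -> exists e, e \in Z.1.
Proof. by move=> /circs_ok/circuit_okP[]. Qed.

Lemma circs_disj Z e : Z \in circs -> e \in Z.1 -> e \notin Z.2.
Proof. by move=> /circs_ok/circuit_okP[_ _ _ + _]; apply. Qed.

Lemma circs_vdeg Z v : Z \in circs -> vdeg v Z.1 = vdeg v Z.2.
Proof. by move=> /circs_ok/circuit_okP[]. Qed.

Section Circuits.
Variable R : realType.
Implicit Types (w h : {set 'I_6} -> R) (Z : circuit) (F G : graph 6)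
  (T : complex 6) (A : side) (L : seq side).

Definition cnt A (e : {set 'I_6}) : R := (count_mem e (map E A))%:R.
Definition wt h A : R := \sum_(e <- A) h (E e).
Definition height h w : R := \sum_(e in Kn 6) w e * h e.

Lemma cnt_cons e A f : cnt (e :: A) f = (E e == f)%:R + cnt A f.
Proof. by rewrite /cnt /= natrD. Qed.

Lemma cnt_ge0 A e : 0 <= cnt A e. Proof. exact: ler0n. Qed.

Lemma cnt_gt0 A e : (0 < cnt A e) = (e \in gr A).
Proof. by rewrite /cnt ltr0n -has_count has_pred1 inE. Qed.

Lemma rep_cnt A : rep (cnt A) (gr A).
Proof.
split=> [e|e]; first exact: cnt_ge0.
by rewrite -cnt_gt0 lt_neqAle cnt_ge0 andbT negbK eq_sym => /eqP.
Qed.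

Lemma cnt_sum A (V : lmodType R) (f : {set 'I_6} -> V) : all wf A ->
  \sum_(e in Kn 6) cnt A e *: f e = \sum_(e <- A) f (E e).
Proof.
elim: A => [_|e A IHA /= /andP[we wA]].
  by rewrite big_nil big1 // => e _; rewrite /cnt scale0r.
rewrite big_cons -IHA //; under eq_bigr do rewrite cnt_cons scalerDl.
rewrite big_split /=; congr (_ + _); rewrite (bigD1 (E e)) ?E_Kn //=.
rewrite eqxx scale1r big1 ?addr0 // => f' /andP[_ nf].
by rewrite eq_sym (negbTE nf) scale0r.
Qed.

Lemma height_cnt h A : all wf A -> height h (cnt A) = wt h A.
Proof. by move=> wA; rewrite /height (@cnt_sum A R^o). Qed.

Lemma vdeg_sum v A : all wf A ->
  \sum_(e <- A) vertex R (E e) ord0 (ov v) = (vdeg v A)%:R.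
Proof.
elim: A => [_|e A IHA /= /andP[we wA]]; first by rewrite big_nil.
rewrite big_cons IHA // vertexE !inE !(inj_eq (can_inj ovK)) /= !eqvE.
by case: (v == e.1) => /=; case: (v == e.2) => /=; rewrite ?add0r // -natrD add1n.
Qed.

Lemma lin_circ Z : Z \in circs -> lin (cnt Z.1) = lin (cnt Z.2).
Proof.
move=> Zc; apply/rowP => i; rewrite /lin !cnt_sum ?circs_wf1 ?circs_wf2 //.
rewrite !summxE -(voK i) !vdeg_sum ?circs_wf1 ?circs_wf2 //.
by rewrite circs_vdeg.
Qed.

(** Apply [conformal] to the difference of the two weightings: it is positive only where
    [w] is and negative only where [w'] is. *)
Lemma circuit_between w w' G G' : rep w G -> rep w' G' -> G \subset Kn 6 ->
  G' \subset Kn 6 -> lin w = lin w' -> w =1 w' \/ exists Z, [/\ Z \in circs,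
     gr Z.1 \subset G, gr Z.2 \subset G',
     (forall e, e \in Z.1 -> 0 < w (E e)) & (forall e, e \in Z.2 -> 0 < w' (E e))].
Proof.
move=> [w_ge0 sw] [w'_ge0 sw'] sG sG' eqL.
have [[e eK ne]|no] := pselect (exists2 e, e \in Kn 6 & w e - w' e != 0); last first.
  left=> e; have [eK|eK] := boolP (e \in Kn 6).
    by apply/eqP; rewrite -subr_eq0; apply: contraT => ne; case: no; exists e.
  rewrite sw ?sw' //; apply: contra eK; apply/fintype.subsetP => //.
right; have [||Z [Zc Zp Zm]] := @conformal R (fun e => w e - w' e).
- by rewrite linB eqL subrr.
- by exists e.
have wp f : f \in Z.1 -> 0 < w (E f).
  by move=> /Zp; rewrite subr_gt0; apply: le_lt_trans.
have wm f : f \in Z.2 -> 0 < w' (E f).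
  by move=> /Zm; rewrite subr_lt0; apply: le_lt_trans.
exists Z; split=> //; rewrite gr_subset; apply/allP => f fZ; apply: contraT => fG.
  by have := wp f fZ; rewrite sw ?ltxx.
by have := wm f fZ; rewrite sw' ?ltxx.
Qed.

(** The two sides of a circuit are weightings of the same point. *)
Lemma tri_circ T Z : tri R T -> Z \in circs -> T (gr Z.1) -> T (gr Z.2) -> False.
Proof.
move=> tT Zc T1 T2.
have eqc := tri_uniq tT T1 T2 (rep_cnt _) (rep_cnt _) (lin_circ Zc).
have [e e1] := circs_neq0 Zc.
have : 0 < cnt Z.1 (E e) by rewrite cnt_gt0 inE map_f.
have we : wf e by have /allP/(_ e e1) := circs_wf1 Zc.
by rewrite eqc cnt_gt0 mem_gr ?circs_wf2 // (negbTE (circs_disj Zc e1)).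
Qed.

(** The sum of the vertices of a cell of [T] is represented on a cell of [T']; by
    [circuit_between] the two weightings agree, so that the cell of [T] is a face of
    that cell. *)
Lemma tri_subset T T' : tri R T -> tri R T' ->
  (forall Z, Z \in circs -> T (gr Z.1) -> T' (gr Z.2) -> False) -> T `<=` T'.
Proof.
move=> tT tT' noZ F TF.
have [F' [w [TF' rw Lw]]] := tri_cover tT' (rep_ind R F).1.
have [eqw|[Z [Zc Z1 Z2 _ _]]] :=
  circuit_between (rep_ind R F) rw (tri_sub tT TF) (tri_sub tT' TF') (esym Lw).
  apply: (tri_down tT' TF'); apply/fintype.subsetP => e eF.
  apply: contraT => /rw.2; rewrite -eqw /ind eF => /eqP.
  by rewrite oner_eq0.
by case: (noZ Z Zc); [apply: (tri_down tT TF)|apply: (tri_down tT' TF')].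
Qed.

Lemma tri_eq T T' : tri R T -> tri R T' ->
  (forall Z, Z \in circs -> T (gr Z.1) -> T' (gr Z.2) -> False) -> T = T'.
Proof.
move=> tT tT' noZ; apply/seteqP; split; apply: tri_subset => // Z Zc T1 T2.
exact: (noZ (swap Z) (swap_circs Zc)).
Qed.

(** Compare the sum of the vertices of [G] with its representation on a cell. *)
Lemma tri_maximal T G : tri R T -> G \subset Kn 6 ->
  T G \/ exists Z, [/\ Z \in circs, T (gr Z.1) & gr Z.2 \subset G].
Proof.
move=> tT sG; have [F [w [TF rw Lw]]] := tri_cover tT (rep_ind R G).1.
have [eqw|[Z [Zc Z1 Z2 _ _]]] := circuit_between rw (rep_ind R G) (tri_sub tT TF) sG Lw.
  left; apply: (tri_down tT TF); apply/fintype.subsetP => e eG.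
  apply: contraT => /rw.2; rewrite eqw /ind eG => /eqP.
  by rewrite oner_eq0.
by right; exists Z; split=> //; apply: (tri_down tT TF).
Qed.

(** The weight is transported from the first to the second side until an edge of the
    first side is exhausted. *)
Lemma move_along w Z : (forall e, 0 <= w e) -> Z \in circs ->
  (forall e, e \in Z.1 -> 0 < w (E e)) ->
  exists t w', [/\ 0 < t, forall e, 0 <= w' e,
    forall e, w' e = w e - t * (cnt Z.1 e - cnt Z.2 e) &
    exists2 e, e \in Z.1 & w' (E e) = 0].
Proof.
move=> w_ge0 Zc wZ.
pose r e := w (E e) / cnt Z.1 (E e).
have [e0 e0Z r_min] : exists2 e0, e0 \in Z.1 & forall e, e \in Z.1 -> r e0 <= r e.
  have [e eZ] := circs_neq0 Zc; elim: (Z.1) e eZ => // a A IHA e _.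
  case: A IHA => [|b A] IHA.
    by exists a; rewrite ?mem_head // => f; rewrite inE => /eqP ->.
  have [c cA c_min] := IHA b (mem_head _ _).
  have [le_ac|lt_ca] := lerP (r a) (r c).
    exists a; rewrite ?mem_head // => f; rewrite inE => /predU1P[-> //|/c_min].
    exact: le_trans.
  exists c; first by rewrite inE cA orbT.
  by move=> f; rewrite inE => /predU1P[->|/c_min //]; apply: ltW.
have cZ e : e \in Z.1 -> 0 < cnt Z.1 (E e) by move=> eZ; rewrite cnt_gt0 inE map_f.
have cZ2 e : e \in Z.1 -> cnt Z.2 (E e) = 0.
  move=> eZ; apply: (rep_cnt _).2; rewrite mem_gr ?circs_wf2 ?circs_disj //.
  by have /allP := circs_wf1 Zc; apply.
have t_gt0 : 0 < r e0 by rewrite divr_gt0 ?wZ ?cZ.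
exists (r e0), (fun e => w e - r e0 * (cnt Z.1 e - cnt Z.2 e)); split=> // [e|].
  have [|e1] := boolP (e \in gr Z.1).
    rewrite inE => /mapP[f fZ ->]; rewrite cZ2 // subr0 subr_ge0.
    by rewrite -ler_pdivlMr ?cZ // r_min.
  rewrite (rep_cnt _).2 // sub0r mulrN opprK addr_ge0 // mulr_ge0 ?cnt_ge0 //.
  exact: ltW.
by exists e0; rewrite // cZ2 // subr0 divfK ?subrr // gt_eqF ?cZ.
Qed.

Lemma lin_move w w' t Z : Z \in circs ->
  (forall e, w' e = w e - t * (cnt Z.1 e - cnt Z.2 e)) -> lin w' = lin w.
Proof.
move=> Zc eqw'; rewrite (eq_lin (fun e _ => eqw' e)) linB linZ linB (lin_circ Zc).
by rewrite subrr scaler0 subr0.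
Qed.

Lemma height_move h w w' t Z : Z \in circs ->
  (forall e, w' e = w e - t * (cnt Z.1 e - cnt Z.2 e)) ->
  height h w' = height h w + t * (wt h Z.2 - wt h Z.1).
Proof.
move=> Zc eqw'; rewrite -!height_cnt ?circs_wf1 ?circs_wf2 // /height.
rewrite -sumrB big_distrr /= -big_split /=; apply: eq_bigr => e _.
by rewrite eqw'; lra.
Qed.

End Circuits.

(** * Complexes given by forbidden sides, and flips *)

(** The graphs that contain no member of [L]; for suitable [L] this is the triangulation
    with minimal non-faces among [L]. *)
Definition avoid (L : seq side) : complex 6 :=
  [set G : graph 6 | G \subset Kn 6 /\ forall A, A \in L -> ~~ (gr A \subset G)].

(** This is what makes representations on graphs in [avoid L] unique. *)
Definition transversal (L : seq side) : Prop :=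
  forall Z, Z \in circs -> exists2 A, A \in L & sub A Z.1 \/ sub A Z.2.

Section Avoid.
Variable R : realType.
Implicit Types (w h : {set 'I_6} -> R) (Z : circuit) (F G : graph 6)
  (T : complex 6) (A : side) (L : seq side).

Definition covering T : Prop := forall w, (forall e, 0 <= w e) ->
  exists F w', [/\ T F, rep w' F & lin w' = lin w].

Lemma sub_gr A B G : sub A B -> gr B \subset G -> gr A \subset G.
Proof.
move=> /subP sAB; rewrite !gr_subset => /allP sBG.
by apply/allP => e /sAB/sBG.
Qed.

Lemma avoid_tri L : transversal L -> covering (avoid L) -> tri R (avoid L).
Proof.
move=> trL cov; split=> //.
- by move=> G [].
- move=> G H [sGK avG] sHG; split; first exact: fintype.subset_trans sGK.
  by move=> A /avG; apply: contra => /fintype.subset_trans; apply.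
- move=> F G w w' [sF avF] [sG avG] rw rw' eqL.
  have [//|[Z [Zc Z1 Z2 _ _]]] := circuit_between rw rw' sF sG eqL.
  have [A AL [sA|sA]] := trL Z Zc.
    by have := avF A AL; rewrite (sub_gr sA Z1).
  by have := avG A AL; rewrite (sub_gr sA Z2).
Qed.

Definition inKn w := rep w (Kn 6).

Definition support w : graph 6 := [set e in Kn 6 | w e != 0]%SET.

Lemma support_sub w : support w \subset Kn 6.
Proof. by apply/fintype.subsetP => e; rewrite inE => /andP[]. Qed.

Lemma rep_support w : inKn w -> rep w (support w).
Proof.
move=> [w_ge0 sw]; split=> // e; rewrite inE negb_and negbK.
by case/orP=> [/sw //|/eqP].
Qed.

Lemma support_gt0 w e : (forall e, 0 <= w e) -> e \in support w -> 0 < w e.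
Proof. by move=> w_ge0; rewrite inE lt_neqAle eq_sym w_ge0 andbT => /andP[]. Qed.

Lemma gr_support A w : (forall e, 0 <= w e) -> gr A \subset support w ->
  forall e, e \in A -> 0 < w (E e).
Proof.
move=> w_ge0; rewrite gr_subset => /allP sA e /sA; exact: support_gt0.
Qed.

(** By [conformal] this is the affine independence of the vertices. *)
Definition circuit_free G := forall Z, Z \in circs ->
  ~~ ((gr Z.1 \subset G) && (gr Z.2 \subset G)).

Lemma circuit_free_uniq G w w' : G \subset Kn 6 -> circuit_free G -> rep w G -> rep w' G ->
  lin w = lin w' -> w =1 w'.
Proof.
move=> sG cfG rw rw' eqL.
have [//|[Z [Zc Z1 Z2 _ _]]] := circuit_between rw rw' sG sG eqL.
by have := cfG Z Zc; rewrite Z1 Z2.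
Qed.

Lemma move_inKn w w' t Z : Z \in circs -> inKn w -> (forall e, 0 <= w' e) ->
  (forall e, w' e = w e - t * (cnt R Z.1 e - cnt R Z.2 e)) -> inKn w'.
Proof.
move=> Zc [_ sw] w'_ge0 eqw'; split=> // e eK.
have cnt0 A : all wf A -> cnt R A e = 0.
  move=> wA; apply: (rep_cnt R A).2; apply: contra eK.
  by apply/fintype.subsetP; apply: gr_Kn.
by rewrite eqw' sw // !cnt0 ?circs_wf1 ?circs_wf2 // subrr mulr0 subr0.
Qed.

(** Moving along a circuit inside the support, in the direction that does not lower the
    total height, removes an edge from the support. *)
Lemma reduce h w : inKn w -> exists w', [/\ inKn w', circuit_free (support w'),
  lin w' = lin w & height h w <= height h w'].
Proof.
have [n] := ubnP #|support w|; elim: n w => // n IHn w /ltnSE le_n Kw.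
have [|/existsNP[Z0 /not_implyP[Z0c /negP]]] := pselect (circuit_free (support w)).
  by exists w; split.
rewrite negbK => /andP[Z01 Z02].
have [Z [Zc Z1 Z2 le_h]] : exists Z, [/\ Z \in circs, gr Z.1 \subset support w,
    gr Z.2 \subset support w & wt h Z.1 <= wt h Z.2].
  have [le12|lt21] := lerP (wt h Z0.1) (wt h Z0.2); first by exists Z0.
  by exists (swap Z0); split=> //; [apply: swap_circs|apply: ltW].
have [t [w' [t_gt0 w'_ge0 eqw' [e eZ w'e]]]] :=
  move_along Kw.1 Zc (gr_support Kw.1 Z1).
have Kw' := move_inKn Zc Kw w'_ge0 eqw'.
have sup : support w' \proper support w.
  apply/properP; split; last first.
    exists (E e); first by move: Z1; rewrite gr_subset => /allP; apply.
    by rewrite inE w'e eqxx andbF.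
  apply/fintype.subsetP => f; rewrite !inE => /andP[fK]; rewrite fK /=.
  apply: contraNneq => wf0; have cnt0 A : gr A \subset support w -> cnt R A f = 0.
    move=> sA; apply: (rep_cnt R A).2.
    by apply: contraTN isT => /(fintype.subsetP sA); rewrite inE wf0 eqxx andbF.
  by rewrite eqw' wf0 !cnt0 // subrr mulr0 subr0.
have [w'' [Kw'' cf L'' v'']] := IHn w' (leq_trans (proper_card sup) le_n) Kw'.
exists w''; split=> //; first by rewrite L'' (lin_move Zc eqw').
apply: le_trans v''; rewrite (height_move h Zc eqw') lerDl mulr_ge0 ?subr_ge0 //.
exact: ltW.
Qed.

Definition optimal h w := inKn w /\
  forall w', inKn w' -> lin w' = lin w -> height h w' <= height h w.

Lemma eq_height h w w' : w =1 w' -> height h w = height h w'.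
Proof. by move=> eqw; apply: eq_bigr => e _; rewrite eqw. Qed.

(** By [reduce] only the finitely many weightings on circuit-free supports compete. *)
Lemma optimal_exists h w : inKn w -> exists2 w', optimal h w' & lin w' = lin w.
Proof.
move=> Kw; pose good F u := [/\ rep u F, circuit_free F & lin u = lin w].
pose u_ F := xget (fun=> 0) (good F).
pose P F := `[< F \subset Kn 6 /\ exists u, good F u >].
have goodP F : P F -> good F (u_ F).
  by move=> /asboolP[_ [u gu]]; apply: (xgetI _ gu).
have good_sup w' : inKn w' -> circuit_free (support w') -> lin w' = lin w ->
    P (support w') /\ u_ (support w') =1 w'.
  move=> Kw' cf' L'; have gw' : good (support w') w'.
    by split=> //; apply: rep_support.
  have PF : P (support w').
    by apply/asboolP; split; [apply: support_sub|exists w'].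
  split=> //; have [ru _ Lu] := goodP _ PF.
  apply: (circuit_free_uniq (support_sub _) cf' ru); first exact: rep_support.
  by rewrite Lu.
have [w0 [K0 cf0 L0 _]] := reduce h Kw; have [P0 _] := good_sup _ K0 cf0 L0.
case: (arg_maxP (fun F => height h (u_ F)) P0) => F PF Fmax.
have [rF cfF LF] := goodP F PF; have /asboolP[sF _] := PF.
exists (u_ F); last by [].
split=> [|w' Kw' L']; first exact: rep_sub rF.
have [v [Kv cfv Lv le_v]] := reduce h Kw'.
have [Pv eqv_] := good_sup v Kv cfv (etrans Lv (etrans L' LF)).
by apply: le_trans le_v _; rewrite -(eq_height h eqv_); apply: Fmax.
Qed.

(** The members of [L] contain a side that is strictly lower than the opposite side; a
    representation of maximal height cannot use it. *)
Definition losing h L := forall A, A \in L ->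
  exists2 Z, Z \in circs & sub Z.1 A /\ wt h Z.1 < wt h Z.2.

Lemma optimal_avoid h L w : losing h L -> optimal h w -> avoid L (support w).
Proof.
move=> loseL [Kw w_max]; split; first exact: support_sub.
move=> A AL; apply/negP => sA; have [Z Zc [/sub_gr/(_ sA) sZ lt_h]] := loseL A AL.
have [t [w' [t_gt0 w'_ge0 eqw' _]]] := move_along Kw.1 Zc (gr_support Kw.1 sZ).
have := w_max w' (move_inKn Zc Kw w'_ge0 eqw') (lin_move Zc eqw').
by rewrite (height_move h Zc eqw') gerDl pmulr_rle0 // subr_le0 leNgt lt_h.
Qed.

(** Weights of sets that are not edges do not affect the point and are discarded. *)
Definition clip w e := if e \in Kn 6 then w e else 0.

Lemma clip_inKn w : (forall e, 0 <= w e) -> inKn (clip w).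
Proof.
move=> w_ge0; split=> e; rewrite /clip; first by case: ifP.
by move=> /negbTE ->.
Qed.

Lemma lin_clip w : lin (clip w) = lin w.
Proof. by apply: eq_lin => e eK; rewrite /clip eK. Qed.

Lemma losing_covering h L : losing h L -> covering (avoid L).
Proof.
move=> loseL w w_ge0; have [w' opt L'] := optimal_exists h (clip_inKn w_ge0).
exists (support w'), w'; split; first exact: optimal_avoid opt.
  by apply: rep_support; case: opt.
by rewrite L' lin_clip.
Qed.

Lemma losing_tri h L : losing h L -> transversal L -> tri R (avoid L).
Proof. by move=> loseL trL; apply: avoid_tri (losing_covering loseL). Qed.

(** Over the sum of [Z.2], the weighting by [Z.2] is the unique one of maximal height.
    *)
Lemma losing_strict h L Z F : losing h L -> transversal L -> avoid L F ->
  Z \in circs -> gr Z.2 \subset F -> wt h Z.1 < wt h Z.2.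
Proof.
move=> loseL trL avF Zc sZ.
have tT := losing_tri loseL trL.
have KZ2 : inKn (cnt R Z.2) by apply: rep_sub (rep_cnt _ _); rewrite gr_Kn ?circs_wf2.
have KZ1 : inKn (cnt R Z.1) by apply: rep_sub (rep_cnt _ _); rewrite gr_Kn ?circs_wf1.
have [w opt Lw] := optimal_exists h KZ2.
have avZ : avoid L (gr Z.2) := tri_down tT avF sZ.
have eqw : w =1 cnt R Z.2.
  apply: (tri_uniq tT (optimal_avoid loseL opt) avZ _ (rep_cnt _ _) Lw).
  by apply: rep_support; case: opt.
rewrite -!height_cnt ?circs_wf1 ?circs_wf2 // lt_neqAle.
have optZ v : inKn v -> lin v = lin (cnt R Z.2) -> height h v <= height h (cnt R Z.2).
  by move=> Kv Lv; rewrite -(eq_height h eqw); apply: opt.2; rewrite ?Lw.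
rewrite optZ ?(lin_circ R Zc) // andbT; apply/eqP => eq_h.
have opt1 : optimal h (cnt R Z.1).
  by split=> // v Kv Lv; rewrite eq_h optZ // Lv (lin_circ R Zc).
have av1 := optimal_avoid loseL opt1.
have avZ1 : avoid L (gr Z.1).
  apply: (tri_down tT av1); rewrite gr_subset; apply/allP => e eZ.
  by rewrite inE E_Kn ?gt_eqF ?cnt_gt0 ?inE ?map_f //; have /allP := circs_wf1 Zc; apply.
exact: (tri_circ tT Zc).
Qed.

Definition setm (A B C : side) : side := [seq e <- A | ~~ has_edge B e] ++ C.
(** A condition for [L] to describe the complex obtained from the one of [L0] by moving
    weight along [Z] until [Z.1] is broken. If a member [A] of [L] does not contain
    [Z.1], then it was excluded before, and so was what remains of [A] before the move:
    the edges in [Z.2] may have been gained, and those in [Z.1] were present. *)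
Definition flip_ok (L0 : seq side) (Z : circuit) (L : seq side) : bool :=
  every (fun A => sub Z.1 A |||
    (any (fun B => sub B A) L0 &&& any (fun B => sub B (setm A Z.2 Z.1)) L0)) L.

(** A representation avoiding [L0] that uses all of [Z.1] is moved along [Z] until it no
    longer does. *)
Lemma flip_covering L0 Z L : (forall A, A \in L -> all wf A) -> Z \in circs ->
  flip_ok L0 Z L -> covering (avoid L0) -> covering (avoid L).
Proof.
rewrite /flip_ok everyE => wfL Zc /allP okL cov w w_ge0.
have [F [w1 [[sFK avF] rw1 L1]]] := cov w w_ge0.
have Kw1 : inKn w1 := rep_sub sFK rw1.
have sup_F : support w1 \subset F.
  apply/fintype.subsetP => e; rewrite inE => /andP[_]; apply: contraNT.
  by move=> /rw1.2 ->.
have avB B G : G \subset F -> B \in L0 -> ~~ (gr B \subset G).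
  by move=> sGF /avF; apply: contra => /fintype.subset_trans; apply.
have [sZ|nsZ] := boolP (gr Z.1 \subset support w1); last first.
  exists (support w1), w1; split=> //; last exact: rep_support.
  split; first exact: support_sub.
  move=> A /okL; case: ifP => [s1 _|_].
    by apply: contra nsZ; apply: sub_gr.
  case: ifP => //; rewrite anyE => /hasP[B BL sBA] _.
  by apply: contra (avB B _ sup_F BL); apply: sub_gr.
have [t [w2 [t_gt0 w2_ge0 eqw2 [e eZ w2e]]]] :=
  move_along Kw1.1 Zc (gr_support Kw1.1 sZ).
have Kw2 := move_inKn Zc Kw1 w2_ge0 eqw2.
exists (support w2), w2; split; [|exact: rep_support|by rewrite (lin_move Zc eqw2)].
split; first exact: support_sub.
move=> A AL; have := okL A AL; case: ifP => [/subP s1 _|_].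
  apply/negP; rewrite gr_subset => /allP/(_ e (s1 e eZ)).
  by rewrite inE w2e eqxx andbF.
case: ifP => // _; rewrite anyE => /hasP[B BL /subP sB].
apply/negP => sA; have /negP := avB B _ sup_F BL; apply.
rewrite gr_subset; apply/allP => f /sB; rewrite mem_cat mem_filter has_edgeE.
case/orP=> [/andP[f2 fA]|f1]; last by move: sZ; rewrite gr_subset => /allP; apply.
move: sA; rewrite gr_subset => /allP/(_ f fA); rewrite !inE => /andP[fK nz].
rewrite fK; apply: contraNneq nz => w1f; rewrite eqw2 w1f.
have cnt2 : cnt R Z.2 (E f) = 0.
  by apply: (rep_cnt R Z.2).2; rewrite mem_gr ?circs_wf2 // (allP (wfL A AL)).
have cnt1 : cnt R Z.1 (E f) = 0.
  apply/eqP; rewrite eq_le cnt_ge0 andbT leNgt cnt_gt0; apply/negP => f1.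
  by have := fintype.subsetP sZ _ f1; rewrite inE w1f eqxx andbF.
by rewrite cnt1 cnt2 subrr mulr0 subr0.
Qed.

End Avoid.

(** * The lemma of Farkas *)

Section Farkas.
Variables (R : realFieldType) (N : nat).
Implicit Types (S : seq ('rV[R]_N * R)) (a x : 'rV[R]_N) (b : R).

Definition dot a x : R := \sum_j a ord0 j * x ord0 j.

(** The inequalities that follow from those in [S] by nonnegative combinations. *)
Inductive conic S : 'rV[R]_N -> R -> Prop :=
| ConicZero : conic S 0 0
| ConicAdd t c a b : 0 <= t -> c \in S -> conic S a b -> conic S (t *: c.1 + a) (t * c.2 + b).

Lemma conicD S a b a' b' : conic S a b -> conic S a' b' -> conic S (a + a') (b + b').
Proof.
move=> Sab Sab'; elim: Sab => [|t c a1 b1 t0 cS _ IH]; first by rewrite !add0r.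
by rewrite -!addrA; apply: ConicAdd.
Qed.

Lemma conicZ S a b t : 0 <= t -> conic S a b -> conic S (t *: a) (t * b).
Proof.
move=> t0; elim=> [|u c a1 b1 u0 cS _ IH].
  by rewrite scaler0 mulr0; apply: ConicZero.
by rewrite scalerDr mulrDr scalerA mulrA; apply: ConicAdd => //; apply: mulr_ge0.
Qed.

Lemma conic_in S c : c \in S -> conic S c.1 c.2.
Proof.
move=> cS; have := ConicAdd (ler01) cS (ConicZero S).
by rewrite scale1r mul1r !addr0.
Qed.

Lemma conic_trans S S' a b : (forall c, c \in S' -> conic S c.1 c.2) ->
  conic S' a b -> conic S a b.
Proof.
move=> sub; elim=> [|t c a1 b1 t0 /sub cS _ IH]; first exact: ConicZero.
by apply: conicD => //; apply: conicZ.
Qed.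

(** A number separating two finite sets, used to choose the eliminated coordinate. *)
Lemma between (A B : seq R) : (forall u v, u \in A -> v \in B -> u <= v) ->
  exists t, (forall u, u \in A -> u <= t) /\ (forall v, v \in B -> t <= v).
Proof.
have max_of (s : seq R) : exists t, (forall u, u \in s -> u <= t) /\ (s <> [::] -> t \in s).
  elim: s => [|u s [t [t_max t_in]]]; first by exists 0.
  have [le_ut|lt_tu] := lerP u t.
    case: s t_max t_in => [|v s] t_max t_in.
      by exists u; split=> [v|]; rewrite inE // => /eqP ->.
    exists t; split=> [v'|_]; first by rewrite inE => /predU1P[-> //|/t_max].
    by rewrite inE t_in ?orbT.
  exists u; split=> [v|_]; last by rewrite mem_head.
  by rewrite inE => /predU1P[-> //|/t_max/le_trans]; apply; apply: ltW.
move=> leAB; case: A leAB => [|a A] leAB.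
  have [t [t_max _]] := max_of (map -%R B).
  by exists (- t); split=> // v vB; rewrite lerNl t_max // map_f.
have [t [t_max t_in]] := max_of (a :: A); exists t; split=> // v.
by apply: leAB; apply: t_in.
Qed.

Lemma dotDl a a' x : dot (a + a') x = dot a x + dot a' x.
Proof. by rewrite -big_split; apply: eq_bigr => j _; rewrite mxE mulrDl. Qed.

Lemma dotZl t a x : dot (t *: a) x = t * dot a x.
Proof. by rewrite /dot big_distrr; apply: eq_bigr => j _ /=; rewrite mxE mulrA. Qed.

Lemma dot_shift a x (j : 'I_N) t :
  dot a (x + t *: delta_mx ord0 j) = dot a x + t * a ord0 j.
Proof.
rewrite /dot; under eq_bigr do rewrite !mxE eqxx /= mulrDr.
rewrite big_split /=; congr (_ + _); rewrite (bigD1 j) //= eqxx mulr1 mulrC big1 ?addr0 //.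
by move=> i /negbTE ->; rewrite !mulr0.
Qed.

(** Fourier-Motzkin elimination of the variables from the last to the first; here the
    inequalities only involve the first [k] variables. *)
Lemma farkas_elim k S : (k <= N)%N ->
  (forall c, c \in S -> forall j : 'I_N, (k <= j)%N -> c.1 ord0 j = 0) ->
  (exists x, forall c, c \in S -> c.2 <= dot c.1 x) \/
  (exists2 b, 0 < b & conic S 0 b).
Proof.
elim: k S => [|k IHk] S leN S0.
  have [/hasP[c cS c_gt0]|/hasPn noc] := boolP (has (fun c => 0 < c.2) S).
    right; exists c.2 => //; have -> : 0 = c.1; last exact: conic_in.
    by apply/rowP => j; rewrite mxE S0.
  left; exists 0 => c cS; rewrite /dot big1 => [|j _]; last by rewrite mxE mulr0.
  by rewrite leNgt noc.
pose j := Ordinal leN.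
pose co (c : 'rV[R]_N * R) := c.1 ord0 j.
pose P := [seq c <- S | 0 < co c]; pose M := [seq c <- S | co c < 0].
pose O := [seq c <- S | co c == 0].
pose comb (p q : 'rV[R]_N * R) :=
  ((- co q) *: p.1 + co p *: q.1, (- co q) * p.2 + co p * q.2).
pose S' := O ++ [seq comb p q | p <- P, q <- M].
have S'S c : c \in S' -> conic S c.1 c.2.
  rewrite mem_cat => /orP[|/allpairsP[[p q] /= []]].
    by rewrite mem_filter => /andP[_]; apply: conic_in.
  rewrite !mem_filter => /andP[p0 pS] /andP[q0 qS] ->.
  apply: conicD; apply: conicZ; rewrite ?oppr_ge0 ?ltW //; exact: conic_in.
have S'0 c : c \in S' -> forall i : 'I_N, (k <= i)%N -> c.1 ord0 i = 0.
  rewrite mem_cat => /orP[|/allpairsP[[p q] /= []]].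
    rewrite mem_filter => /andP[/eqP c0 cS] i; rewrite leq_eqVlt => /predU1P[eq_i|].
      by rewrite -c0; congr (_ _ _); apply: val_inj.
    exact: S0.
  rewrite !mem_filter => /andP[p0 pS] /andP[q0 qS] -> i; rewrite !mxE leq_eqVlt => /predU1P[eq_i|lt_i].
    have -> : i = j by apply: val_inj.
    by rewrite -/(co p) -/(co q) mulNr mulrC addNr.
  by rewrite (S0 p) // (S0 q) // !mulr0 addr0.
have [[x xS']|[b b0 cb]] := IHk S' (ltnW leN) S'0; last first.
- by right; exists b => //; apply: conic_trans cb.
- pose y := x - x ord0 j *: delta_mx ord0 j.
  have dot_y c t : dot c.1 (y + t *: delta_mx ord0 j) = dot c.1 x + (t - x ord0 j) * co c.
    by rewrite /y -addrA -scaleNr -scalerDl dot_shift addrC [- _ + _]addrC addrC.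
  left; pose lo c := x ord0 j + (c.2 - dot c.1 x) / co c.
  have [|t [tP tM]] := @between (map lo P) (map lo M).
    move=> _ _ /mapP[p pP ->] /mapP[q qM ->].
    have := xS' (comb p q); rewrite mem_cat allpairs_f // orbT => /(_ isT).
    rewrite /comb /= dotDl !dotZl /lo lerD2l.
    move: pP qM; rewrite !mem_filter => /andP[p0 _] /andP[q0 _].
    rewrite ler_pdivrMr // mulrAC ler_ndivlMr //; lra.
  exists (y + t *: delta_mx ord0 j) => c cS; rewrite dot_y.
  have [c0|c0|c0] := ltgtP 0 (co c).
  + have /tP : lo c \in map lo P by rewrite map_f // mem_filter c0.
    by rewrite /lo -lerBrDl ler_pdivrMr // => ?; lra.
  + have /tM : lo c \in map lo M by rewrite map_f // mem_filter c0.
    by rewrite /lo -lerBlDl ler_ndivlMr // => ?; lra.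
  + have := xS' c; rewrite mem_cat mem_filter -c0 eqxx cS => /(_ isT).
    by rewrite mulr0 addr0.
Qed.

Lemma farkas (I : finType) (a : I -> 'rV[R]_N) (b : I -> R) :
  (forall l : I -> R, (forall i, 0 <= l i) -> \sum_i l i *: a i = 0 ->
    \sum_i l i * b i <= 0) ->
  exists x, forall i, b i <= dot (a i) x.
Proof.
move=> cert; pose S := [seq (a i, b i) | i <- enum I].
have [|[x xS]|[c c0 /= cc]] := @farkas_elim N S (leqnn N).
- by move=> c _ j; rewrite leqNgt ltn_ord.
- by exists x => i; apply: (xS (a i, b i)); rewrite map_f ?mem_enum.
have multipliers u v : conic S u v -> exists l : I -> R, [/\ forall i, 0 <= l i,
    \sum_i l i *: a i = u & \sum_i l i * b i = v].
  elim=> [|t d u1 v1 t0 /mapP[i _ ->] _ [l [l0 la lb]]].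
    exists (fun=> 0); split=> //; rewrite big1 // => i _; by rewrite ?scale0r ?mul0r.
  exists (fun k => (k == i)%:R * t + l k); split.
  - by move=> k; rewrite addr_ge0 // mulr_ge0 ?ler0n.
  - rewrite -la (eq_bigr _ (fun k _ => scalerDl _ _ _)) big_split /=; congr (_ + _).
    rewrite (bigD1 i) //= eqxx mul1r big1 ?addr0 // => k /negbTE ->.
    by rewrite mul0r scale0r.
  - rewrite -lb (eq_bigr _ (fun k _ => mulrDl _ _ _)) big_split /=; congr (_ + _).
    rewrite (bigD1 i) //= eqxx mul1r big1 ?addr0 // => k /negbTE ->.
    by rewrite !mul0r.
have [l [l0 la lb]] := multipliers _ _ cc.
by have := cert l l0 la; rewrite lb leNgt c0.
Qed.
End Farkas.

(** * Induced subdivisions in terms of circuits *)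

Section Induced.
Variable R : realType.
Implicit Types (w h : {set 'I_6} -> R) (Z : circuit) (F G : graph 6)
  (T : complex 6) (A : side) (L : seq side) (x : 'rV[R]_6).

(** The subdivision induced by heights on the edges; [x] is a supporting functional of
    the lifted configuration, tight exactly on the cell. *)
Definition induced h : complex 6 :=
  [set G : graph 6 | G \subset Kn 6 /\ exists x, forall e, e \in Kn 6 ->
     if e \in G then ev x e = h e else h e < ev x e].

Lemma seq_argmin (X : eqType) (s : seq X) (f : X -> R) (x0 : X) : x0 \in s ->
  exists2 y, y \in s & forall z, z \in s -> f y <= f z.
Proof.
elim: s x0 => // a s IHs x0 _; case: s IHs => [|b s] IHs.
  by exists a; rewrite ?mem_head // => z; rewrite inE => /eqP ->.
have [c cs c_min] := IHs b (mem_head _ _).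
have [le_ac|lt_ca] := lerP (f a) (f c).
  exists a; rewrite ?mem_head // => z; rewrite inE => /predU1P[-> //|/c_min].
  exact: le_trans.
exists c; first by rewrite inE cs orbT.
by move=> z; rewrite inE => /predU1P[->|/c_min //]; apply: ltW.
Qed.

(** Finitely many strict inequalities survive small perturbations. *)
Lemma small_factor (X : eqType) (s : seq X) (g c : X -> R) :
  (forall z, z \in s -> 0 < g z) ->
  exists2 t, 0 < t & forall u z, 0 <= u -> u <= t -> z \in s -> u * c z < g z.
Proof.
elim: s => [_|a s IHs g_gt0]; first by exists 1.
have [|t t0 tP] := IHs; first by move=> z zs; rewrite g_gt0 // inE zs orbT.
have ga : 0 < g a by rewrite g_gt0 ?mem_head.
have ca : 0 < `|c a| + 1 by rewrite ltr_wpDl.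
exists (Num.min t (g a / (`|c a| + 1))); first by rewrite lt_min t0 divr_gt0.
move=> u z u0; rewrite le_min => /andP[ut ua]; rewrite inE => /predU1P[->|]; last exact: tP.
apply: le_lt_trans (_ : u * `|c a| < _); first by rewrite ler_wpM2l // ler_norm.
have : u * (`|c a| + 1) <= g a by rewrite -ler_pdivlMr.
have [->|u_gt0] := eqVneq u 0; first by rewrite !mul0r.
apply: lt_le_trans; rewrite ltr_pM2l ?ltrDl // lt_neqAle eq_sym u_gt0 //.
Qed.

Lemma wt_ev x Z : Z \in circs -> wt (ev x) Z.1 = wt (ev x) Z.2.
Proof.
move=> Zc; rewrite -!height_cnt ?circs_wf1 ?circs_wf2 // /height !ev_lin.
by rewrite (lin_circ R Zc).
Qed.

Lemma mem_circ1 Z e : Z \in circs -> e \in Z.1 -> E e \in Kn 6.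
Proof. by move=> Zc eZ; apply: E_Kn; have /allP := circs_wf1 Zc; apply. Qed.

Lemma wt_le h h' A : (forall e, e \in A -> h (E e) <= h' (E e)) -> wt h A <= wt h' A.
Proof. by move=> le_h; rewrite /wt big_seq [leRHS]big_seq; apply: ler_sum. Qed.

Lemma eq_wt h h' A : (forall e, e \in A -> h (E e) = h' (E e)) -> wt h A = wt h' A.
Proof. by move=> eq_h; rewrite /wt big_seq [RHS]big_seq; apply: eq_bigr. Qed.

Lemma wt_lt h h' A e0 : (forall e, e \in A -> h (E e) <= h' (E e)) ->
  e0 \in A -> h (E e0) < h' (E e0) -> wt h A < wt h' A.
Proof.
move=> le_h e0A lt0; rewrite /wt (big_rem e0) //= [ltRHS](big_rem e0) //=; apply: ltr_leD => //.
by apply: wt_le => e /mem_rem; apply: le_h.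
Qed.

(** A dependence is a conformal sum of circuits, and its height changes by the sum of
    their changes. *)
Lemma decompose h m : lin m = 0 ->
  (forall Z, Z \in circs -> (forall e, e \in Z.2 -> m (E e) < 0) -> wt h Z.1 <= wt h Z.2) ->
  height h m <= 0.
Proof.
have [n] := ubnP #|support m|; elim: n m => // n IHn m /ltnSE le_n L0 ok.
have [[e eK me]|no] := pselect (exists2 e, e \in Kn 6 & m e != 0); last first.
  rewrite /height big1 // => e eK; have [-> |me] := eqVneq (m e) 0; first by rewrite mul0r.
  by case: no; exists e.
have [Z [Zc Zp Zm]] := conformal L0 (ex_intro2 _ _ e eK me).
pose c1 := cnt R Z.1; pose c2 := cnt R Z.2.
have z12 f : f \in Z.1 -> c2 (E f) = 0.
  move=> f1; apply: (rep_cnt R Z.2).2; rewrite mem_gr ?circs_wf2 ?circs_disj //.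
  by have /allP := circs_wf1 Zc; apply.
have z21 f : f \in Z.2 -> c1 (E f) = 0.
  move=> f2; apply: (rep_cnt R Z.1).2; rewrite mem_gr ?circs_wf1 //.
    exact: (circs_disj (swap_circs Zc)).
  by have /allP := circs_wf2 Zc; apply.
have c1_gt0 f : f \in Z.1 -> 0 < c1 (E f) by move=> f1; rewrite cnt_gt0 inE map_f.
have c2_gt0 f : f \in Z.2 -> 0 < c2 (E f) by move=> f2; rewrite cnt_gt0 inE map_f.
pose z f := c1 f - c2 f.
have z_neq0 f : f \in Z.1 ++ Z.2 -> z (E f) != 0.
  rewrite mem_cat /z => /orP[f1|f2]; first by rewrite z12 // subr0 gt_eqF ?c1_gt0.
  by rewrite z21 // sub0r oppr_eq0 gt_eqF ?c2_gt0.
have [f0 f0Z] := circs_neq0 Zc.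
have f0Z' : f0 \in Z.1 ++ Z.2 by rewrite mem_cat f0Z.
have [f fZ f_min] := seq_argmin (fun f => m (E f) / z (E f)) f0Z'.
set t := m (E f) / z (E f) in f_min.
have t_gt0 : 0 < t.
  move: fZ; rewrite /t /z mem_cat => /orP[f1|f2].
    by rewrite z12 // subr0 divr_gt0 ?Zp ?c1_gt0.
  by rewrite z21 // sub0r invrN mulrN -mulNr divr_gt0 ?oppr_gt0 ?Zm ?c2_gt0.
pose m' g := m g - t * z g.
have m'1 g : g \in Z.1 -> 0 <= m' (E g).
  move=> g1; have gZ : g \in Z.1 ++ Z.2 by rewrite mem_cat g1.
  by have := f_min g gZ; rewrite /m' /z z12 // subr0 ler_pdivlMr ?c1_gt0 // subr_ge0.
have m'2 g : g \in Z.2 -> m' (E g) <= 0.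
  move=> g2; have gZ : g \in Z.1 ++ Z.2 by rewrite mem_cat g2 orbT.
  have := f_min g gZ; rewrite /m' /z z21 // sub0r ler_ndivlMr ?oppr_lt0 ?c2_gt0 //.
  by rewrite subr_le0.
have m'_out g : g \notin gr Z.1 -> g \notin gr Z.2 -> m' g = m g.
  by move=> g1 g2; rewrite /m' /z /c1 /c2 !(rep_cnt R _).2 // subrr mulr0 subr0.
have m'_lt0 g : m' g < 0 -> m g < 0.
  have [|g1] := boolP (g \in gr Z.1).
    by rewrite inE => /mapP[k k1 ->]; rewrite ltNge m'1.
  have [|g2] := boolP (g \in gr Z.2).
    by rewrite inE => /mapP[k k2 ->] _; apply: Zm.
  by rewrite m'_out.
have L0' : lin m' = 0 by rewrite (@lin_move _ m m' t Z).
have sup : support m' \proper support m.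
  apply/properP; split.
    apply/fintype.subsetP => g; rewrite !inE => /andP[gK]; rewrite gK /=.
    apply: contraNneq => mg; rewrite m'_out ?mg //; rewrite inE; apply/negP => /mapP[k kZ eq_g].
      by have := Zp k kZ; rewrite -eq_g mg ltxx.
    by have := Zm k kZ; rewrite -eq_g mg ltxx.
  exists (E f); last by rewrite inE /m' /t divfK ?z_neq0 // subrr eqxx andbF.
  rewrite inE; move: fZ; rewrite mem_cat => /orP[f1|f2].
    by rewrite (mem_circ1 Zc) // gt_eqF ?Zp.
  by rewrite (mem_circ1 (swap_circs Zc)) // lt_eqF ?Zm.
have := IHn m' (leq_trans (proper_card sup) le_n) L0'
  (fun Y Yc Ym => ok Y Yc (fun g gY => m'_lt0 _ (Ym g gY))).
have -> : height h m' = height h m + t * (wt h Z.2 - wt h Z.1) by apply: height_move.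
apply: le_trans; rewrite lerDl mulr_ge0 ?subr_ge0 ?ok //; exact: ltW.
Qed.

Lemma dot_vertex e x : e \in Kn 6 -> dot (vertex R e) x = ev x e.
Proof.
move=> _; rewrite /dot /ev [RHS]big_mkcond /=; apply: eq_bigr => i _.
by rewrite vertexE; case: ifP => _; rewrite ?mul1r ?mul0r.
Qed.

Lemma dotN a x : dot (- a) x = - dot a x.
Proof. by rewrite -scaleN1r dotZl mulN1r. Qed.

(** By the lemma of Farkas, an obstruction is a dependence that is negative only on [F];
    by [decompose] the circuits with second side in [F] exclude it. *)
Lemma tight_exists h F : F \subset Kn 6 ->
  (forall Z, Z \in circs -> gr Z.2 \subset F -> wt h Z.1 <= wt h Z.2) ->
  exists x, forall e, e \in Kn 6 -> h e <= ev x e /\ (e \in F -> ev x e = h e).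
Proof.
move=> sFK okF.
pose a (i : {set 'I_6} * bool) : 'rV[R]_6 :=
  if i.2 then (if i.1 \in Kn 6 then vertex R i.1 else 0)
  else (if i.1 \in F then - vertex R i.1 else 0).
pose b (i : {set 'I_6} * bool) : R :=
  if i.2 then (if i.1 \in Kn 6 then h i.1 else 0)
  else (if i.1 \in F then - h i.1 else 0).
have [l l0 la|x xP] := @farkas R 6 _ a b; last first.
  exists x => e eK; have := xP (e, true); have := xP (e, false).
  rewrite /a /b /= eK dot_vertex // => hF hK; split=> // eF.
  by move: hF; rewrite eF dotN dot_vertex // lerN2 => hF; apply/eqP; rewrite eq_le hF hK.
pose m e := l (e, true) - (if e \in F then l (e, false) else 0).
have pairE (V : zmodType) (f : {set 'I_6} * bool -> V) :
    \sum_i f i = \sum_e f (e, true) + \sum_e f (e, false).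
  rewrite -big_split /=; transitivity (\sum_e \sum_c f (e, c)).
    by rewrite pair_bigA; apply: eq_bigr => -[].
  by apply: eq_bigr => e _; rewrite big_bool.
have split_m (V : lmodType R) (f : {set 'I_6} -> V) :
    \sum_(e in Kn 6) m e *: f e = \sum_e l (e, true) *: (if e \in Kn 6 then f e else 0) +
      \sum_e l (e, false) *: (if e \in F then - f e else 0).
  rewrite big_mkcond -big_split /=; apply: eq_bigr => e _; rewrite /m.
  case: ifP => eK.
    by case: ifP => _; [rewrite scalerBl scalerN|rewrite subr0 scaler0 addr0].
  have -> : e \in F = false by apply: contraFF eK; apply/fintype.subsetP.
  by rewrite !scaler0 addr0.
have Lm : lin m = 0 by rewrite -[RHS]la pairE /lin split_m.
have -> : \sum_i l i * b i = height h m.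
  by rewrite pairE; apply/esym; apply: (split_m R^o h).
apply: decompose => // Z Zc Zm; apply: okF => //; rewrite gr_subset.
apply/allP => e /Zm; rewrite /m; apply: contraLR => /negbTE ->.
by rewrite subr0 -leNgt.
Qed.

Lemma ev_sum (I : finType) (P : pred I) (X : I -> 'rV[R]_6) e :
  ev (\sum_(i | P i) X i) e = \sum_(i | P i) ev (X i) e.
Proof.
rewrite /ev exchange_big /=; apply: eq_bigr => i _; by rewrite summxE.
Qed.

Lemma evZ t x e : ev (t *: x) e = t * ev x e.
Proof. by rewrite /ev big_distrr; apply: eq_bigr => i _; rewrite mxE. Qed.

(** The functional must be tight on [G] and strict elsewhere. If the height of a single
    edge outside [G] is raised a little, a functional tight on [G] still exists; the
    average of these functionals over all edges works. *)
Lemma inducedP h G : G \subset Kn 6 ->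
  induced h G <-> (forall Z, Z \in circs -> gr Z.2 \subset G ->
    wt h Z.1 < wt h Z.2 \/ (wt h Z.1 = wt h Z.2 /\ gr Z.1 \subset G)).
Proof.
move=> sGK; split=> [[_ [x xP]] Z Zc sZ|okG].
  have le_h e : e \in Z.1 -> h (E e) <= ev x (E e).
    by move=> eZ; have := xP _ (mem_circ1 Zc eZ); case: ifP => _ => [->|/ltW].
  have <- : wt (ev x) Z.2 = wt h Z.2.
    apply: eq_wt => e eZ; have := xP _ (mem_circ1 (swap_circs Zc) eZ).
    by move: sZ; rewrite gr_subset => /allP/(_ e eZ) ->.
  rewrite -(wt_ev x Zc).
  have [s1|] := boolP (gr Z.1 \subset G).
    right; split=> //; apply: eq_wt => e eZ; have := xP _ (mem_circ1 Zc eZ).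
    by move: s1; rewrite gr_subset => /allP/(_ e eZ) ->.
  rewrite gr_subset => /allPn[e eZ eG]; left; apply: (wt_lt le_h eZ).
  by have := xP _ (mem_circ1 Zc eZ); rewrite (negbTE eG).
split=> //.
pose s := [seq Z <- circs | (gr Z.2 \subset G) && (wt h Z.1 < wt h Z.2)].
have [|t t0 tP] := @small_factor _ s (fun Z => wt h Z.2 - wt h Z.1) (fun Z => (size Z.1)%:R).
  by move=> Z; rewrite mem_filter => /andP[/andP[_]]; rewrite subr_gt0.
have bump e : exists x, e \in Kn 6 -> forall f, f \in Kn 6 ->
    [/\ h f <= ev x f, f \in G -> ev x f = h f & e \notin G -> e = f -> h f < ev x f].
  have [eG|eG] := boolP (e \in G).
    have [|x xP] := @tight_exists h G sGK.
      by move=> Z Zc /(okG Z Zc)[/ltW//|[-> _]].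
    by exists x => _ f /xP[? ?]; split.
  pose h' f := h f + t * (e == f)%:R.
  have [|x xP] := @tight_exists h' G sGK.
    move=> Z Zc sZ; have -> : wt h' Z.2 = wt h Z.2.
      apply: eq_wt => f fZ; rewrite /h'; case: eqP => [eq_ef|_]; rewrite ?mulr0 ?addr0 //.
      by move: sZ; rewrite gr_subset => /allP/(_ f fZ); rewrite -eq_ef (negbTE eG).
    have [lt12|[eq12 s1]] := okG Z Zc sZ; last first.
      rewrite -eq12 le_eqVlt; apply/orP; left; apply/eqP/eq_wt => f fZ.
      rewrite /h'; case: eqP => [eq_ef|_]; rewrite ?mulr0 ?addr0 //.
      by move: s1; rewrite gr_subset => /allP/(_ f fZ); rewrite -eq_ef (negbTE eG).
    have Zs : Z \in s by rewrite mem_filter sZ lt12.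
    have := tP t Z (ltW t0) (lexx _) Zs; rewrite ltrBrDl => /ltW; apply: le_trans.
    rewrite /wt big_split /= lerD2l -big_distrr /= ler_wpM2l ?(ltW t0) //.
    rewrite -[X in _ <= X%:R]sum1_size natr_sum; apply: ler_sum => f _.
    by case: (_ == _); rewrite ?lexx ?ler01.
  exists x => _ f fK; have [le_x eq_x] := xP f fK.
  have ge0 : 0 <= t * (e == f)%:R by rewrite mulr_ge0 ?ler0n // ltW.
  split; first by apply: le_trans le_x; rewrite lerDl.
    move=> fG; rewrite eq_x // /h'; case: eqP => [eq_ef|_]; rewrite ?mulr0 ?addr0 //.
    by rewrite -eq_ef (negbTE eG) in fG.
  by move=> _ eq_ef; apply: lt_le_trans le_x; rewrite /h' eq_ef eqxx mulr1 ltrDl.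
have /choice[X XP] := bump.
pose N : R := #|Kn 6|%:R.
have e0K : E (V0, V1) \in Kn 6 by rewrite E_Kn.
have N0 : 0 < N by rewrite ltr0n card_gt0; apply/set0Pn; exists (E (V0, V1)).
exists (N^-1 *: \sum_(e in Kn 6) X e) => f fK.
have sumN (r : R) : \sum_(e in Kn 6) r = N * r by rewrite sumr_const mulr_natl.
rewrite evZ ev_sum; case: ifP => fG.
  rewrite (eq_bigr (fun=> h f)) => [|e eK]; last by have [_ + _] := XP e eK f fK; apply.
  by rewrite sumN mulKf // gt_eqF.
rewrite ltr_pdivlMl // -sumN (bigD1 f) //= [ltRHS](bigD1 f) //=; apply: ltr_leD.
  by have [_ _] := XP f fK f fK; apply; rewrite ?fG.
by apply: ler_sum => e /andP[eK _]; have [] := XP e eK f fK.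
Qed.

Lemma losing_induced h L : losing h L -> transversal L -> induced h = avoid L.
Proof.
move=> loseL trL; apply/seteqP; split=> [G iG|G avG].
  have [sGK _] := iG; split=> // A AL; apply/negP => sA.
  have [Z Zc [/sub_gr/(_ sA) sZ lt_h]] := loseL A AL.
  have [|[]] := (proj1 (inducedP h sGK) iG) (swap Z) (swap_circs Zc) sZ => /=.
    by rewrite ltNge ltW.
  by move=> eq_h; rewrite eq_h ltxx in lt_h.
have [sGK _] := avG; apply/inducedP => // Z Zc sZ; left.
exact: losing_strict loseL trL avG Zc sZ.
Qed.

Lemma height_ev_rep w h x F : inKn w -> rep w F ->
  (forall e, e \in Kn 6 -> if e \in F then ev x e = h e else h e < ev x e) ->
  height (ev x) w = height h w.
Proof.
move=> Kw [_ sw] xP; apply: eq_bigr => e eK; have := xP e eK.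
by case: ifPn => [_ ->|/sw ->]; rewrite ?mul0r.
Qed.

(** The supporting functional of [H] and that of the cell of [T] containing the sum of
    the vertices of [H] give the same value to this sum; hence the latter is tight on
    [H] as well. *)
Lemma tri_induced T h : tri R T -> T `<=` induced h -> induced h = T.
Proof.
move=> tT sT; apply/seteqP; split=> // H [sH [x xP]].
have KH : inKn (ind R H) := rep_sub sH (rep_ind R H).
have [F [w [TF rw Lw]]] := tri_cover tT (rep_ind R H).1.
have [sF [y yP]] := sT F TF; have Kw : inKn w := rep_sub sF rw.
have val_le u z (G : graph 6) : inKn u ->
    (forall e, e \in Kn 6 -> if e \in G then ev z e = h e else h e < ev z e) ->
    height h u <= height (ev z) u.
  move=> Ku zP; apply: ler_sum => e eK; apply: ler_wpM2l; first by case: Ku.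
  by have := zP e eK; case: ifP => _ => [->|/ltW].
have eq_val_ev z : height (ev z) w = height (ev z) (ind R H) by rewrite /height !ev_lin Lw.
have le1 : height (ev y) (ind R H) <= height h (ind R H).
  rewrite -eq_val_ev (height_ev_rep Kw rw yP) -(height_ev_rep KH (rep_ind R H) xP).
  by rewrite -eq_val_ev (val_le _ _ _ Kw xP).
apply: (tri_down tT TF); apply/fintype.subsetP => e eH; apply: contraT => eF.
have eK := fintype.subsetP sH _ eH.
suff : height h (ind R H) < height (ev y) (ind R H) by rewrite ltNge le1.
rewrite /height (bigD1 e) //= [ltRHS](bigD1 e) //=; apply: ltr_leD.
  by rewrite /ind eH !mul1r; have := yP e eK; rewrite (negbTE eF).
apply: ler_sum => f /andP[fK _]; rewrite ler_wpM2l ?ler0n //.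
by have := yP f fK; case: ifP => _ => [->|/ltW].
Qed.

End Induced.

(** * Generic refinements *)

Definition table := hex (hex nat).
Definition entry (m : table) (e : edge) : nat := get (get m e.1) e.2.
Definition table_of (hs : seq nat) : table :=
  hexfun (fun a => hexfun (fun b => nth 0%N hs (find (eqe (a, b)) edges))).
Definition weight (m : table) (A : side) : nat :=
  foldr (fun e n => (entry m e + n)%N) 0%N A.

(** Fifteen heights for which the two sides of every circuit have different total
    heights. *)
Definition generic_table : table := table_of [:: 10; 0; 4; 10; 1; 11; 3; 0; 1; 1; 6; 11; 8; 5; 3]%N.

Lemma generic_tableP :
  every (fun Z => ~~ eqn (weight generic_table Z.1) (weight generic_table Z.2)) half_circs.
Proof. vm_cast_no_check (erefl true). Qed.

Section Fan.
Variable R : realType.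
Implicit Types (w h g : {set 'I_6} -> R) (Z : circuit) (F G : graph 6)
  (T : complex 6) (A : side) (L : seq side) (x : 'rV[R]_6) (d : 'M[R]_6).

Definition heights (m : table) (e : {set 'I_6}) : R :=
  \sum_(f <- edges | E f == e) (entry m f)%:R.

Lemma heightsE m f : wf f -> heights m (E f) = (entry m f)%:R.
Proof.
move=> wf_f; rewrite /heights -big_filter (_ : [seq _ <- _ | _] = [:: f]) ?big_seq1 //.
have fe : f \in edges by rewrite edges_wf.
rewrite -(filter_pred1_uniq edges_uniq fe); apply: eq_in_filter => f'.
by rewrite edges_wf => wf_f' /=; apply/eqP/eqP => [/E_inj ->|->].
Qed.

Lemma wt_heights m A : all wf A -> wt (heights m) A = (weight m A)%:R.
Proof.
elim: A => [_|e A IHA /= /andP[we wA]]; first by rewrite /wt big_nil.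
by rewrite /wt big_cons -/(wt _ _) IHA // heightsE // natrD.
Qed.

Definition generic_heights := heights generic_table.

Lemma generic_heights_neq Z : Z \in circs -> wt generic_heights Z.1 != wt generic_heights Z.2.
Proof.
move=> Zc; rewrite !wt_heights ?circs_wf1 ?circs_wf2 // eqr_nat.
have := generic_tableP; rewrite everyE => /allP gP.
move: Zc; rewrite circsE => /orP[/gP|/gP]; rewrite ?eqnE //.
by rewrite eq_sym.
Qed.

(** The lower sides of all circuits for [h] plus a small multiple of the generic
    heights. *)
Definition losers h : seq side :=
  [seq Z.1 | Z <- circs & (wt h Z.1 < wt h Z.2) ||
     (wt h Z.1 == wt h Z.2) && (wt generic_heights Z.1 < wt generic_heights Z.2)].

Lemma losersP h A : reflect (exists2 Z, Z \in circs & Z.1 = A /\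
   ((wt h Z.1 < wt h Z.2) \/ (wt h Z.1 = wt h Z.2 /\ wt generic_heights Z.1 < wt generic_heights Z.2)))
  (A \in losers h).
Proof.
apply: (iffP mapP) => [[Z]|[Z Zc [<- lt12]]].
  rewrite mem_filter => /andP[lt12 Zc] ->; exists Z => //; split=> //.
  by case/orP: lt12 => [|/andP[/eqP]]; [left|right].
exists Z; rewrite // mem_filter Zc andbT.
by case: lt12 => [->|[-> ->]] //; rewrite eqxx orbT.
Qed.

Lemma losers_transversal h : transversal (losers h).
Proof.
move=> Z Zc; have [lt12|lt21|eq12] := ltgtP (wt h Z.1) (wt h Z.2).
- exists Z.1; last by left; apply/subP.
  by apply/losersP; exists Z => //; split=> //; left.
- exists Z.2; last by right; apply/subP.
  by apply/losersP; exists (swap Z); [apply: swap_circs|split=> //; left].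
have [lt12|lt21|eqg] := ltgtP (wt generic_heights Z.1) (wt generic_heights Z.2).
- exists Z.1; last by left; apply/subP.
  by apply/losersP; exists Z => //; split=> //; right.
- exists Z.2; last by right; apply/subP.
  by apply/losersP; exists (swap Z); [apply: swap_circs|split=> //; right].
by have := generic_heights_neq Zc; rewrite eqg eqxx.
Qed.

Definition perturb h (t : R) e := h e + t * generic_heights e.

Lemma wt_perturb h t A : wt (perturb h t) A = wt h A + t * wt generic_heights A.
Proof. by rewrite /wt big_split /= big_distrr. Qed.

Lemma perturb_losing h : exists2 t0, 0 < t0 &
  forall t, 0 < t -> t <= t0 -> losing (perturb h t) (losers h).
Proof.
pose s := [seq Z <- circs | wt h Z.1 < wt h Z.2].
have [|t0 t0_gt0 t0P] := @small_factor _ _ s (fun Z => wt h Z.2 - wt h Z.1)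
    (fun Z => wt generic_heights Z.1 - wt generic_heights Z.2).
  by move=> Z; rewrite mem_filter subr_gt0 => /andP[].
exists t0 => // t t_gt0 le_t A /losersP[Z Zc [<- lt12]]; exists Z => //; split; first exact/subP.
rewrite !wt_perturb; case: lt12 => [lt12|[-> ltg]]; last by rewrite ltrD2l ltr_pM2l.
have := t0P t Z (ltW t_gt0) le_t; rewrite mem_filter lt12 Zc => /(_ isT); lra.
Qed.

(** A characterisation in which [h] only enters through the subdivision it induces: the
    refinement by generic heights takes place inside each cell. *)
Lemma avoid_losersP h F : avoid (losers h) F <-> F \subset Kn 6 /\ exists G,
  [/\ induced h G, F \subset G & forall Z, Z \in circs -> gr Z.2 \subset F ->
      gr Z.1 \subset G -> wt generic_heights Z.1 < wt generic_heights Z.2].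
Proof.
split=> [[sF avF]|[sF [G [iG sFG gG]]]].
  split=> //; have [|x xP] := @tight_exists R h F sF.
    move=> Z Zc sZ; rewrite leNgt; apply/negP => lt21.
    have : Z.2 \in losers h.
      by apply/losersP; exists (swap Z); [apply: swap_circs|split=> //; left].
    by move/avF; rewrite sZ.
  pose G : graph 6 := [set e in Kn 6 | ev x e == h e]%SET.
  have sG : G \subset Kn 6 by apply/fintype.subsetP => e; rewrite inE => /andP[].
  have sFG : F \subset G.
    apply/fintype.subsetP => e eF; have eK := fintype.subsetP sF _ eF.
    by rewrite inE eK; have [_ /(_ eF) ->] := xP e eK; rewrite eqxx.
  exists G; split=> // [|Z Zc Z2 Z1].
    split=> //; exists x => e eK; rewrite inE eK /=; case: eqP => // /eqP neq.
    by rewrite lt_neqAle eq_sym neq; have [] := xP e eK.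
  have xZ A : gr A \subset G -> wt (ev x) A = wt h A.
    rewrite gr_subset => /allP sA; apply: eq_wt => e /sA.
    by rewrite inE => /andP[_ /eqP].
  have eqh : wt h Z.1 = wt h Z.2.
    by rewrite -xZ // -xZ ?(wt_ev x Zc) // (fintype.subset_trans Z2).
  rewrite ltNge le_eqVlt eq_sym (negbTE (generic_heights_neq Zc)) /=; apply/negP => ltg.
  have : Z.2 \in losers h.
    by apply/losersP; exists (swap Z); [apply: swap_circs|split=> //; right].
  by move/avF; rewrite Z2.
split=> // A /losersP[Z Zc [eqA lt12]]; apply/negP; rewrite -eqA => sZ.
have sG : G \subset Kn 6 by case: iG.
have [lt21|[eq21 Z2]] := (proj1 (inducedP h sG) iG) (swap Z) (swap_circs Zc) (fintype.subset_trans sZ sFG).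
  by move: lt21 lt12 => /= lt21 [|[eq12 _]]; [rewrite ltNge ltW|rewrite eq12 ltxx in lt21].
case: lt12 => [|[_ ltg]]; first by move: eq21 => /= ->; rewrite ltxx.
have := gG (swap Z) (swap_circs Zc) sZ Z2.
by rewrite /= ltNge ltW.
Qed.

Lemma eq_losers h h' : induced h = induced h' -> avoid (losers h) = avoid (losers h').
Proof.
by move=> eq_i; apply/seteqP; split=> F /avoid_losersP[sF [G [iG sFG gG]]];
  apply/avoid_losersP; split=> //; exists G; rewrite ?eq_i // -?eq_i.
Qed.

Lemma perturb_tri h : exists2 t0, 0 < t0 & forall t, 0 < t -> t <= t0 ->
  induced (perturb h t) = avoid (losers h).
Proof.
have [t0 t0_gt0 t0P] := perturb_losing h; exists t0 => // t t_gt0 le_t.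
exact: losing_induced (t0P t t_gt0 le_t) (@losers_transversal h).
Qed.

(** The refinement is itself induced, by perturbed heights. *)
Lemma losers_tri h : tri R (avoid (losers h)).
Proof.
have [t0 t0_gt0 t0P] := perturb_losing h.
exact: losing_tri (t0P t0 t0_gt0 (lexx _)) (@losers_transversal h).
Qed.

(** The finitely many strict inequalities that describe the triangulation persist. *)
Lemma induced_open h : tri R (induced h) -> exists2 t0, 0 < t0 &
  forall h', (forall e, e \in Kn 6 -> `|h' e - h e| <= t0) -> induced h' = induced h.
Proof.
move=> tT.
pose s := [seq Z <- circs | wt h Z.1 < wt h Z.2].
have [|t0 t0_gt0 t0P] := @small_factor _ _ s (fun Z => wt h Z.2 - wt h Z.1)
    (fun Z => (size Z.1 + size Z.2)%:R).
  by move=> Z; rewrite mem_filter subr_gt0 => /andP[].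
exists t0 => // h' le_h'; apply: tri_induced => // F TF.
have sF : F \subset Kn 6 by case: TF.
apply/inducedP => // Z Zc Z2; left.
have lt12 : wt h Z.1 < wt h Z.2.
  have [//|[_ Z1]] := (proj1 (inducedP h sF) TF) Z Zc Z2.
  by case: (tri_circ tT Zc); apply: (tri_down tT TF).
have wtA A : all wf A -> `|wt h' A - wt h A| <= t0 * (size A)%:R.
  elim: A => [_|e A IHA /= /andP[we wA]]; first by rewrite /wt !big_nil subrr normr0 mulr0.
  rewrite /wt !big_cons opprD addrACA; apply: le_trans (ler_normD _ _) _.
  by rewrite mulrS mulrDr mulr1 lerD ?le_h' ?E_Kn ?IHA.
have := t0P t0 Z (ltW t0_gt0) (lexx _); rewrite mem_filter lt12 Zc => /(_ isT).
rewrite natrD mulrDr.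
have := wtA _ (circs_wf1 Zc); have := wtA _ (circs_wf2 Zc).
rewrite !ler_norml => /andP[? ?] /andP[? ?]; lra.
Qed.

End Fan.

(** * Relabelling complexes *)

Section Relabel.
Variable n : nat.
Implicit Types (s t : 'S_n) (e : {set 'I_n}) (G H : graph n) (T : complex n).

Definition image_edge s e : {set 'I_n} := [set s i | i in e]%SET.

Lemma image_edgeM s t e : image_edge (s * t)%g e = image_edge t (image_edge s e).
Proof. by rewrite /image_edge -imset_comp; apply: eq_imset => i; rewrite /= permM. Qed.

Lemma image_edge1 e : image_edge 1%g e = e.
Proof. by rewrite /image_edge (eq_imset _ (@perm1 _)) imset_id. Qed.

Lemma image_edgeK s : cancel (image_edge s) (image_edge s^-1%g).
Proof. by move=> e; rewrite -image_edgeM mulgV image_edge1. Qed.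

Lemma image_edgeVK s : cancel (image_edge s^-1%g) (image_edge s).
Proof. by move=> e; rewrite -image_edgeM mulVg image_edge1. Qed.

Lemma mem_image_edge s e i : (s i \in image_edge s e) = (i \in e).
Proof. by rewrite mem_imset //; apply: perm_inj. Qed.

Lemma image_edge_Kn s e : (image_edge s e \in Kn n) = (e \in Kn n).
Proof. by rewrite !inE card_imset //; apply: perm_inj. Qed.

Lemma relabel_graphE s G : relabel_graph s G = (image_edge s @: G)%SET.
Proof. by []. Qed.

Lemma mem_relabel s G e : (image_edge s e \in relabel_graph s G) = (e \in G).
Proof. by rewrite relabel_graphE mem_imset //; apply: can_inj (image_edgeK s). Qed.

Lemma relabel_graphM s t G : relabel_graph (s * t)%g G = relabel_graph t (relabel_graph s G).
Proof.
rewrite !relabel_graphE -imset_comp; apply: eq_imset => e.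
by rewrite /= image_edgeM.
Qed.

Lemma relabel_graph1 G : relabel_graph 1%g G = G.
Proof. by rewrite relabel_graphE (eq_imset _ (@image_edge1)) imset_id. Qed.

Lemma relabel_graphK s : cancel (relabel_graph s) (relabel_graph s^-1%g).
Proof. by move=> G; rewrite -relabel_graphM mulgV relabel_graph1. Qed.

Lemma relabel_graphVK s : cancel (relabel_graph s^-1%g) (relabel_graph s).
Proof. by move=> G; rewrite -relabel_graphM mulVg relabel_graph1. Qed.

Lemma relabel_subset s G H : (relabel_graph s G \subset relabel_graph s H) = (G \subset H).
Proof.
apply/fintype.subsetP/fintype.subsetP => sGH e.
  by move=> eG; have := sGH (image_edge s e); rewrite !mem_relabel; apply.
by rewrite -[e](image_edgeVK s) !mem_relabel; apply: sGH.
Qed.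

Lemma relabel_Kn s G : (relabel_graph s G \subset Kn n) = (G \subset Kn n).
Proof.
have eqK : relabel_graph s (Kn n) = Kn n.
  apply/finset.setP => e; rewrite -[e](image_edgeVK s).
  by rewrite mem_relabel !image_edge_Kn.
by rewrite -{1}eqK relabel_subset.
Qed.

Lemma relabel_complexE s T G : relabel_complex s T G <-> T (relabel_graph s^-1%g G).
Proof.
split=> [[H TH <-]|TG]; first by rewrite relabel_graphK.
by exists (relabel_graph s^-1%g G); rewrite ?relabel_graphVK.
Qed.

Lemma relabel_complexM s t T : relabel_complex (s * t)%g T = relabel_complex t (relabel_complex s T).
Proof.
by apply/seteqP; split=> G; rewrite !relabel_complexE invMg relabel_graphM.
Qed.

Lemma relabel_complex1 T : relabel_complex 1%g T = T.
Proof.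
by apply/seteqP; split=> G; rewrite relabel_complexE invg1 relabel_graph1.
Qed.

Lemma relabel_complexK s : cancel (relabel_complex s) (relabel_complex s^-1%g).
Proof. by move=> T; rewrite -relabel_complexM mulgV relabel_complex1. Qed.

End Relabel.

Section RelabelTri.
Variables (R : realType) (k : nat).
Notation n := k.+2.
Implicit Types (s : 'S_n) (w : {set 'I_n} -> R).

Definition relabel_weight s w e := w (image_edge s^-1%g e).

(** Relabelling permutes the edges of the complete graph. *)
Lemma big_Kn_image s (V : nmodType) (f : {set 'I_n} -> V) :
  \sum_(e in Kn n) f (image_edge s e) = \sum_(e in Kn n) f e.
Proof.
rewrite [RHS](reindex (image_edge s)) /=; last first.
  by exists (image_edge s^-1%g) => e _; rewrite ?image_edgeK ?image_edgeVK.
by apply: eq_bigl => e; rewrite image_edge_Kn.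
Qed.

Lemma lin_relabel s w w' : lin w = lin w' -> lin (relabel_weight s w) = lin (relabel_weight s w').
Proof.
have linS u i : lin (relabel_weight s u) ord0 (s i) = lin u ord0 i.
  rewrite /lin !summxE -(big_Kn_image s); apply: eq_bigr => e _.
  by rewrite !mxE !vertexE mem_image_edge /relabel_weight image_edgeK.
move=> eqL; apply/rowP => i; rewrite -[i](permKV s) !linS.
by rewrite eqL.
Qed.

Lemma rep_relabel s w G : rep w G -> rep (relabel_weight s w) (relabel_graph s G).
Proof.
move=> [w_ge0 sw]; split=> [e|e]; first exact: w_ge0.
by rewrite -{1}[e](image_edgeVK s) mem_relabel => /sw.
Qed.

Lemma relabel_tri s T : tri R T -> tri R (relabel_complex s T).
Proof.
move=> tT; split.
- by move=> G /relabel_complexE/(tri_sub tT); rewrite relabel_Kn.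
- move=> G H /relabel_complexE TG sHG; apply/relabel_complexE.
  by apply: (tri_down tT TG); rewrite relabel_subset.
- move=> F G w w' /relabel_complexE TF /relabel_complexE TG rw rw' eqL e.
  have := tri_uniq tT TF TG (rep_relabel s^-1%g rw) (rep_relabel s^-1%g rw') (lin_relabel _ eqL).
  by move=> /(_ (image_edge s^-1%g e)); rewrite /relabel_weight invgK image_edgeVK.
- move=> w w_ge0.
  have [e|F [v [TF rv Lv]]] := tri_cover tT (w := relabel_weight s^-1%g w); first exact: w_ge0.
  exists (relabel_graph s F), (relabel_weight s v); split.
  + by apply/relabel_complexE; rewrite relabel_graphK.
  + exact: rep_relabel.
  + rewrite (lin_relabel s Lv); apply: eq_lin => e _.
    by rewrite /relabel_weight invgK image_edgeVK.
Qed.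
End RelabelTri.

(** * The metric fan *)

Section Cones.
Variable R : realType.
Implicit Types (h : {set 'I_6} -> R) (Z : circuit) (G : graph 6)
  (T : complex 6) (d : 'M[R]_6) (s : 'S_6).

Local Notation Delta := (@induced_subdivision R 6).

(** Defined on sets of labels, without deciding which endpoint comes first. *)
Definition dist d (e : {set 'I_6}) : R := (\sum_(i in e) \sum_(j in e) d i j) / 2.
Definition mat h : 'M[R]_6 := \matrix_(i, j) if i == j then 0 else h [set i; j]%SET.

Lemma dist_pair d i j : dissimilarity d -> i != j -> dist d [set i; j]%SET = d i j.
Proof.
move=> [d0 dC] neq_ij; rewrite /dist !big_setU1 ?inE //= !big_set1.
by rewrite !big_setU1 ?inE //= !big_set1 !d0 [d j i]dC add0r addr0; lra.
Qed.

Lemma Kn_pair n (e : {set 'I_n}) : e \in Kn n -> exists i j, i != j /\ e = [set i; j]%SET.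
Proof. by rewrite inE => /cards2P[i [j [neq ->]]]; exists i, j. Qed.

Lemma pair_Kn n (i j : 'I_n) : i != j -> [set i; j]%SET \in Kn n.
Proof. by move=> neq; rewrite inE cards2 neq. Qed.

Lemma eq_induced h h' : (forall e, e \in Kn 6 -> h e = h' e) -> induced h = induced h'.
Proof.
by move=> eq_h; apply/seteqP; split=> G [sG [x xP]]; split=> //; exists x => e eK;
  have := xP e eK; rewrite eq_h.
Qed.

Lemma induced_dist d : dissimilarity d -> Delta d = induced (dist d).
Proof.
move=> dd; apply/seteqP; split=> G [sG [x xP]]; split=> //; exists x.
  move=> _ /Kn_pair[i [j [neq ->]]]; rewrite dist_pair // ev_pair //.
  exact: xP.
by move=> i j neq; have := xP _ (pair_Kn neq); rewrite dist_pair // ev_pair.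
Qed.

Lemma mat_dissimilarity h : dissimilarity (mat h).
Proof.
split=> i => [|j]; first by rewrite mxE eqxx.
by rewrite !mxE eq_sym finset.setUC.
Qed.

Lemma dist_mat h e : e \in Kn 6 -> dist (mat h) e = h e.
Proof.
move=> /Kn_pair[i [j [neq ->]]]; rewrite dist_pair //; last exact: mat_dissimilarity.
by rewrite mxE (negbTE neq).
Qed.

Lemma induced_mat h : Delta (mat h) = induced h.
Proof.
rewrite induced_dist; last exact: mat_dissimilarity.
exact/eq_induced/dist_mat.
Qed.

Lemma dissimilarityD d d' : dissimilarity d -> dissimilarity d' -> dissimilarity (d + d').
Proof.
move=> [d0 dC] [d0' dC']; split=> i => [|j]; first by rewrite mxE d0 d0' addr0.
by rewrite !mxE dC dC'.
Qed.

Lemma dissimilarityZ t d : dissimilarity d -> dissimilarity (t *: d).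
Proof.
move=> [d0 dC]; split=> i => [|j]; first by rewrite mxE d0 mulr0.
by rewrite !mxE dC.
Qed.

Lemma distD d d' e : dist (d + d') e = dist d e + dist d' e.
Proof.
rewrite /dist -mulrDl; congr (_ / _); rewrite -big_split; apply: eq_bigr => i _ /=.
by rewrite -big_split; apply: eq_bigr => j _; rewrite mxE.
Qed.

Lemma distZ t d e : dist (t *: d) e = t * dist d e.
Proof.
rewrite /dist mulrA; congr (_ / _); rewrite big_distrr; apply: eq_bigr => i _ /=.
by rewrite big_distrr; apply: eq_bigr => j _; rewrite mxE.
Qed.

Lemma metricD d d' : metric_cone d -> metric_cone d' -> metric_cone (d + d').
Proof.
move=> [dd d0 dt] [dd' d0' dt']; split; first exact: dissimilarityD.
  by move=> i j; rewrite mxE addr_ge0.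
by move=> i j l; rewrite !mxE addrACA lerD.
Qed.

Lemma metricZ t d : 0 <= t -> metric_cone d -> metric_cone (t *: d).
Proof.
move=> t0 [dd d0 dt]; split; first exact: dissimilarityZ.
  by move=> i j; rewrite mxE mulr_ge0.
by move=> i j l; rewrite !mxE -mulrDr ler_wpM2l.
Qed.

(** Adding a constant to all heights shifts the supporting functionals by half of it. *)
Lemma induced_shift h c : induced (fun e => h e + c) = induced h.
Proof.
have sub h' c' : induced h' `<=` induced (fun e => h' e + c').
  move=> G [sG [x xP]]; split=> //; exists (x + const_mx (c' / 2)) => e eK.
  have -> : ev (x + const_mx (c' / 2)) e = ev x e + c'.
    rewrite /ev; under eq_bigr do rewrite !mxE.
    rewrite big_split /=; congr (_ + _); rewrite sumr_const.
    by move: eK; rewrite inE => /eqP ->; lra.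
  by have := xP e eK; case: ifP => _ => [->|]; rewrite ?ltrD2r.
apply/seteqP; split; last exact: sub.
move=> G /(sub _ (- c)); rewrite (eq_induced (h' := h)) // => e _.
by rewrite addrK.
Qed.

(** Distances between [c] and [2 * c] satisfy every triangle inequality. *)
Lemma mat_metric h c : (forall e, e \in Kn 6 -> c <= h e <= 2 * c) -> metric_cone (mat h).
Proof.
move=> hc; have c_ge0 : 0 <= c.
  by have /andP[] := hc _ (pair_Kn (isT : (ord0 : 'I_6) != lift ord0 ord0)); lra.
split; first exact: mat_dissimilarity.
  move=> i j; rewrite mxE; case: ifPn => // neq.
  by have /andP[le_c _] := hc _ (pair_Kn neq); apply: le_trans le_c.
move=> i j l; rewrite !mxE.
have [->|nij] := eqVneq i j; first by rewrite add0r.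
have [<-|njl] := eqVneq j l; first by rewrite (negbTE nij) addr0.
have /andP[le1 _] := hc _ (pair_Kn nij); have /andP[le2 _] := hc _ (pair_Kn njl).
case: eqVneq => [_|nil]; first by lra.
by have /andP[_ le3] := hc _ (pair_Kn nil); lra.
Qed.

Lemma metric_shift h : exists2 c, metric_cone (mat (fun e => h e + c)) &
  forall e, e \in Kn 6 -> `|h e| <= c.
Proof.
pose M := \sum_(e in Kn 6) `|h e|.
have hM e : e \in Kn 6 -> `|h e| <= M.
  by move=> eK; rewrite /M (bigD1 e) //= lerDl sumr_ge0.
have M0 : 0 <= M by rewrite sumr_ge0.
(* the shifted heights are between [2 * M] and [4 * M] *)
exists (3 * M); last by move=> e /hM; lra.
by apply: (@mat_metric _ (2 * M)) => e /hM; rewrite ler_norml => /andP[? ?]; apply/andP; split; lra.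
Qed.

(** After adding a large constant, arbitrary heights form a metric. *)
Lemma metric_of_heights h : exists2 d, metric_cone d & Delta d = induced h.
Proof.
have [c mc _] := metric_shift h; exists (mat (fun e => h e + c)) => //.
by rewrite induced_mat induced_shift.
Qed.

Lemma metric_dissimilarity d : metric_cone d -> dissimilarity d.
Proof. by case. Qed.

Lemma regularP T : regular_triangulations R 6 T <-> tri R T /\ exists h, induced h = T.
Proof.
split=> [[tT [d [md eqT]]]|[tT [h eqT]]].
  split; first exact: (proj1 (triP R T) tT).
  exists (dist d); rewrite -eqT induced_dist //.
  exact: metric_dissimilarity.
split; first exact: (proj2 (triP R T) tT).
by have [d md eq_d] := metric_of_heights h; exists d; rewrite eq_d.
Qed.

(** The topology of the space of matrices, entrywise. *)
Definition near (e : R) d d' := forall i j, `|d i j - d' i j| < e.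

Lemma nbhs_near d (P : set 'M[R]_6) :
  nbhs d P <-> exists2 e, 0 < e & forall d', near e d d' -> P d'.
Proof.
split=> [/nbhs_ballP[e e0 sP]|[e e0 sP]].
  by exists e => // d' nd; apply: sP; split.
by apply/nbhs_ballP; exists e => // d' [_ bd]; apply: sP.
Qed.

Lemma closure_near (P : set 'M[R]_6) d :
  closure P d <-> forall e, 0 < e -> exists2 d', P d' & near e d d'.
Proof.
split=> [cP e e0|nP B /nbhs_near[e e0 sB]].
  have /cP[d' [Pd' nd]] : nbhs d (near e d) by apply/nbhs_near; exists e.
  by exists d'.
by have [d' Pd' nd] := nP e e0; exists d'; split=> //; apply: sB.
Qed.

Lemma fan_cell_refl d : metric_cone d -> fan_cell d d.
Proof. by []. Qed.

Lemma eq_fan_cell d d' : Delta d = Delta d' -> fan_cell d = fan_cell d'.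
Proof. by move=> eq_d; rewrite /fan_cell eq_d. Qed.

Lemma near_dist e d d' f : dissimilarity d -> dissimilarity d' -> near e d d' ->
  f \in Kn 6 -> `|dist d' f - dist d f| < e.
Proof.
move=> dd dd' nd /Kn_pair[i [j [neq ->]]].
by rewrite !dist_pair // distrC.
Qed.

(** Adding one to all distances keeps the triangulation and makes all triangle
    inequalities strict, so that all nearby dissimilarities are metrics with the same
    triangulation. *)
Lemma cell_interior d : metric_cone d -> tri R (Delta d) ->
  exists d1 e, [/\ fan_cell d d1, 0 < e &
    forall d', dissimilarity d' -> near e d1 d' -> fan_cell d d'].
Proof.
move=> md tT; have dd := metric_dissimilarity md.
pose one : 'M[R]_6 := mat (fun=> 1).
have mone : metric_cone one by apply: (@mat_metric _ 1) => e _; lra.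
have md1 : metric_cone (d + one) := metricD md mone.
have dd1 := metric_dissimilarity md1.
have D1 : Delta (d + one) = Delta d.
  rewrite !induced_dist // -[RHS](induced_shift _ 1); apply: eq_induced => e eK.
  by rewrite distD dist_mat.
have [|t t0 tP] := @induced_open R (dist (d + one)).
  by rewrite -induced_dist ?D1.
(* three distances occur in a triangle inequality *)
exists (d + one), (Num.min t 3^-1); split=> //.
  by rewrite lt_min t0 invr_gt0 ltr0n.
move=> d' dd' nd; split; last first.
  rewrite -D1 !induced_dist //; apply: tP => e eK; apply: ltW.
  by apply: lt_le_trans (near_dist dd1 dd' nd eK) _; rewrite ge_min lexx.
have nd3 i j : i != j -> d i j + 1 - 3^-1 < d' i j < d i j + 1 + 3^-1.
  move=> neq; have := nd i j; rewrite !mxE (negbTE neq) lt_min => /andP[_].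
  by rewrite ltr_norml => /andP[? ?]; apply/andP; split; lra.
have [_ d_ge0 dt] := md; have [d'0 d'C] := dd'.
have d'_ge0 i j : 0 <= d' i j.
  have [->|neq] := eqVneq i j; first by rewrite d'0.
  by have /andP[? _] := nd3 i j neq; have := d_ge0 i j; lra.
split=> // i j l.
have [->|nij] := eqVneq i j; first by rewrite d'0 add0r.
have [<-|njl] := eqVneq j l; first by rewrite d'0 addr0.
have [<-|nil] := eqVneq i l; first by rewrite d'0 addr_ge0.
have /andP[? ?] := nd3 i j nij; have /andP[? ?] := nd3 j l njl.
by have /andP[? ?] := nd3 i l nil; have := dt i j l; lra.
Qed.

(** Moving in this direction refines every induced subdivision to a triangulation. *)
Lemma generic_direction : exists2 g : 'M[R]_6, metric_cone g &
  forall d, dissimilarity d -> exists2 t0, 0 < t0 & forall t, 0 < t -> t <= t0 ->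
    Delta (d + t *: g) = avoid (losers (dist d)).
Proof.
have [c mc _] := metric_shift (@generic_heights R); 
exists (mat (fun e => generic_heights R e + c)) => // d dd.
have [t0 t0_gt0 t0P] := perturb_tri (dist d); exists t0 => // t t_gt0 le_t.
rewrite -(t0P t) // induced_dist; last first.
  by apply: dissimilarityD => //; apply/dissimilarityZ/mat_dissimilarity.
rewrite -[RHS](induced_shift _ (t * c)); apply: eq_induced => e eK.
by rewrite distD distZ dist_mat // /perturb mulrDr addrA.
Qed.

Lemma near_shift d (g : 'M[R]_6) e : 0 < e -> exists2 t0, 0 < t0 &
  forall t, 0 < t -> t <= t0 -> near e d (d + t *: g).
Proof.
move=> e0; pose M := 1 + \sum_i \sum_j `|g i j|.
have gM i j : `|g i j| <= M - 1.
  rewrite /M addrAC subrr add0r (bigD1 i) //= (bigD1 j) //= -addrA lerDl.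
  by rewrite addr_ge0 // sumr_ge0 // => l _; rewrite sumr_ge0.
have M0 : 0 < M by have := le_trans (normr_ge0 _) (gM ord0 ord0); lra.
exists (e / M); first by rewrite divr_gt0.
move=> t t_gt0 le_t i j; rewrite !mxE opprD addrA subrr sub0r normrN normrM gtr0_norm //.
have : t * M <= e by rewrite -ler_pdivlMr.
by apply: lt_le_trans; rewrite ltr_pM2l //; have := gM i j; lra.
Qed.

(** An open set of metrics with the same subdivision contains a perturbation in the
    generic direction, and this one induces a triangulation. *)
Lemma genericP d : generic d <-> metric_cone d /\ tri R (Delta d).
Proof.
split=> [[md [d1 [md1 D1]]]|[md tT]]; last first.
  split=> //; have [d1 [e [cd1 e0 eP]]] := cell_interior md tT.
  by exists d1 => //; apply/nbhs_near; exists e => // d' nd dd'; apply: eP.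
move=> /nbhs_near[e e0 eP]; split=> //.
have [g mg gP] := generic_direction.
have dd1 := metric_dissimilarity md1.
have [t1 t1_gt0 t1P] := gP d1 dd1; have [t2 t2_gt0 t2P] := near_shift d1 g e0.
pose t := Num.min t1 t2.
have t_gt0 : 0 < t by rewrite lt_min t1_gt0.
have [] : fan_cell d (d1 + t *: g).
  apply: eP; first by apply: t2P => //; rewrite ge_min lexx orbT.
  by apply: dissimilarityD => //; apply/dissimilarityZ/metric_dissimilarity.
move=> _ <-; rewrite t1P; [exact: losers_tri|exact: t_gt0|].
by rewrite ge_min lexx.
Qed.

Lemma generic_metric d : generic d -> metric_cone d. Proof. by case. Qed.

(** Perturbing all metrics of a cell in the generic direction leads to one and the same
    triangulation, since it only depends on the subdivision. *)
Lemma cell_closure d : metric_cone d -> exists2 d', generic d' &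
  fan_cell d `<=` closure (fan_cell d').
Proof.
move=> md; have [g mg gP] := generic_direction.
have dd := metric_dissimilarity md.
have [t t_gt0 tP] := gP d dd.
pose d' := d + t *: g; have md' : metric_cone d'.
  by apply: metricD => //; apply: metricZ => //; apply: ltW.
have Dd' : Delta d' = avoid (losers (dist d)) by apply: tP.
exists d'; first by apply/genericP; split=> //; rewrite Dd'; apply: losers_tri.
move=> d2 [md2 D2]; apply/closure_near => e e0.
have dd2 := metric_dissimilarity md2.
have [t1 t1_gt0 t1P] := gP d2 dd2; have [t2 t2_gt0 t2P] := near_shift d2 g e0.
pose u := Num.min t1 t2; have u_gt0 : 0 < u by rewrite lt_min t1_gt0.
exists (d2 + u *: g); last by apply: t2P; rewrite ?ge_min ?lexx ?orbT.
split; first by apply: metricD => //; apply: metricZ => //; apply: ltW.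
rewrite Dd' t1P; [|exact: u_gt0|by rewrite ge_min lexx].
by apply: eq_losers; rewrite -!induced_dist.
Qed.

(** A generic cell contains an open set, which the other cell must meet. *)
Lemma closure_generic d d' : generic d -> closure (fan_cell d) `<=` closure (fan_cell d') ->
  fan_cell d = fan_cell d'.
Proof.
move=> /genericP[md tT] sC; have [d1 [e [cd1 e0 eP]]] := cell_interior md tT.
have /sC/closure_near/(_ e e0)[d2 [md2 D2] nd] : closure (fan_cell d) d1.
  exact: subset_closure.
have [_ D2'] : fan_cell d d2 by apply: eP => //; apply: metric_dissimilarity.
by apply: eq_fan_cell; rewrite -D2' D2.
Qed.

Lemma maximal_conesP (C : set 'M[R]_6) :
  maximal_cones R 6 C <-> exists2 d, generic d & C = closure (fan_cell d).
Proof.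
split=> [[[d md <-] Cmax]|[d gd ->]].
  have [d' gd' sC] := cell_closure md; exists d' => //.
  apply/esym/Cmax; first by exists d' => //; apply: generic_metric.
  have := closureS sC.
  by rewrite -((closure_id (closure (fan_cell d'))).1 (@closed_closure _ _)).
split; first by exists d => //; apply: generic_metric.
by move=> _ [d' md' <-] /(closure_generic gd) ->.
Qed.

Lemma closure_bij : set_bij (generic_types R 6) (maximal_cones R 6) (@closure 'M[R]_6).
Proof.
split.
- by move=> _ [d gd <-]; apply/maximal_conesP; exists d.
- move=> _ _ /set_mem[d gd <-] /set_mem[d' gd' <-] eqC.
  by apply: closure_generic => //; rewrite eqC.
- by move=> C /maximal_conesP[d gd ->]; exists (fan_cell d) => //; exists d.
Qed.

(** Any generic metric whose cell has closure [C] will do. *)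
Definition cone_complex (C : set 'M[R]_6) : complex 6 :=
  Delta (xget 0 [set d | generic d /\ closure (fan_cell d) = C]).

Lemma cone_complexE d : generic d -> cone_complex (closure (fan_cell d)) = Delta d.
Proof.
move=> gd; rewrite /cone_complex.
case: xgetP => [d' _ [gd' eqC]|/(_ d)[]//].
have eq_cell : fan_cell d' = fan_cell d by apply: closure_generic => //; rewrite eqC.
by have [] : fan_cell d d' by rewrite -eq_cell; apply/fan_cell_refl/generic_metric.
Qed.

Lemma cone_complex_bij :
  set_bij (maximal_cones R 6) (regular_triangulations R 6) cone_complex.
Proof.
split.
- move=> C /maximal_conesP[d gd ->]; rewrite cone_complexE //.
  have /genericP[md tT] := gd; split; first by apply/triP.
  by exists d.
- move=> C C' /set_mem/maximal_conesP[d gd ->] /set_mem/maximal_conesP[d' gd' ->].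
  by rewrite !cone_complexE // => /eq_fan_cell ->.
- move=> T [/triP tT [d [md DT]]]; exists (closure (fan_cell d)).
    by apply/maximal_conesP; exists d => //; apply/genericP; rewrite DT.
  by rewrite cone_complexE //; apply/genericP; rewrite DT.
Qed.

Lemma relabel_matrixK s : cancel (@relabel_matrix 6 R s) (relabel_matrix s^-1%g).
Proof. by move=> d; apply/matrixP => i j; rewrite !mxE invgK !permK. Qed.

Lemma relabel_matrixVK s : cancel (@relabel_matrix 6 R s^-1%g) (relabel_matrix s).
Proof. by move=> d; apply/matrixP => i j; rewrite !mxE invgK !permKV. Qed.

Lemma relabel_metric s d : metric_cone d -> metric_cone (relabel_matrix s d).
Proof.
move=> [[d0 dC] d_ge0 dt]; split; first by split=> i => [|j]; rewrite !mxE // dC.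
  by move=> i j; rewrite mxE.
by move=> i j l; rewrite !mxE.
Qed.

Lemma relabel_Delta_sub s d : Delta (relabel_matrix s d) `<=` relabel_complex s (Delta d).
Proof.
move=> G [sG [x xP]]; apply/relabel_complexE; split; first by rewrite relabel_Kn.
exists (\row_i x ord0 (s i)) => i j neq; rewrite !mxE.
have := xP (s i) (s j); rewrite (inj_eq perm_inj) !mxE !permK => /(_ neq).
have <- : image_edge s [set i; j]%SET = [set s i; s j]%SET.
  by rewrite /image_edge imsetU1 imset_set1.
by rewrite -[in X in _ -> X](image_edgeK s [set i; j]%SET) mem_relabel.
Qed.

Lemma relabel_Delta s d : Delta (relabel_matrix s d) = relabel_complex s (Delta d).
Proof.
apply/seteqP; split; first exact: relabel_Delta_sub.
rewrite -{1}[d](relabel_matrixK s) => G /relabel_complexE/relabel_Delta_sub/relabel_complexE.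
by rewrite invgK relabel_graphVK.
Qed.

Lemma relabel_fan_cell s d : relabel_matrix s @` fan_cell d = fan_cell (relabel_matrix s d).
Proof.
apply/seteqP; split=> [_ [d' [md' D'] <-]|d' [md' D']].
  by split; [apply: relabel_metric|rewrite !relabel_Delta D'].
exists (relabel_matrix s^-1%g d'); last exact: relabel_matrixVK.
split; first exact: relabel_metric.
by rewrite relabel_Delta D' relabel_Delta relabel_complexK.
Qed.

Lemma relabel_closure s (P : set 'M[R]_6) :
  relabel_cone s (closure P) = closure (relabel_matrix s @` P).
Proof.
have near_s t e d d' : near e d d' -> near e (relabel_matrix t d) (relabel_matrix t d').
  by move=> nd i j; rewrite !mxE.
apply/seteqP; split=> [_ [d /closure_near cd <-]|d /closure_near cd].
  apply/closure_near => e /cd[d' Pd' nd].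
  by exists (relabel_matrix s d'); [exists d'|apply: near_s].
exists (relabel_matrix s^-1%g d); last exact: relabel_matrixVK.
apply/closure_near => e /cd[_ [d' Pd' <-] nd]; exists d' => //.
by rewrite -[d'](relabel_matrixK s); apply: near_s.
Qed.

Lemma relabel_generic s d : generic d -> generic (relabel_matrix s d).
Proof.
move=> /genericP[md tT]; apply/genericP; split; first exact: relabel_metric.
by rewrite relabel_Delta; apply: relabel_tri.
Qed.

Lemma cone_complex_relabel s C : maximal_cones R 6 C ->
  maximal_cones R 6 (relabel_cone s C) /\
  cone_complex (relabel_cone s C) = relabel_complex s (cone_complex C).
Proof.
move=> /maximal_conesP[d gd ->]; rewrite relabel_closure relabel_fan_cell.
split; first by apply/maximal_conesP; exists (relabel_matrix s d) => //; apply: relabel_generic.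
by rewrite !cone_complexE ?relabel_Delta //; apply: relabel_generic.
Qed.

Local Open Scope card_scope.

(** The bijection between cones and triangulations commutes with relabelling. *)
Lemma classes_card : symmetry_classes (@relabel_cone 6 R) (maximal_cones R 6) #=
  symmetry_classes (@relabel_complex 6) (regular_triangulations R 6).
Proof.
pose Phi (X : set (set 'M[R]_6)) : set (complex 6) := cone_complex @` X.
have [fun_f inj_f surj_f] := cone_complex_bij.
have PhiE C : maximal_cones R 6 C ->
    Phi (range ((@relabel_cone 6 R)^~ C)) = range ((@relabel_complex 6)^~ (cone_complex C)).
  move=> mC; apply/seteqP; split=> [_ [_ [s _ <-] <-]|_ [s _ <-]].
    by exists s => //; have [_ ->] := cone_complex_relabel s mC.
  by exists (relabel_cone s C); [exists s|have [_ ->] := cone_complex_relabel s mC].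
have -> : symmetry_classes (@relabel_complex 6) (regular_triangulations R 6) =
    Phi @` symmetry_classes (@relabel_cone 6 R) (maximal_cones R 6).
  apply/seteqP; split=> [_ [T /surj_f[C mC <-] <-]|_ [_ [C mC <-] <-]].
    by exists (range ((@relabel_cone 6 R)^~ C)); [exists C|apply: PhiE].
  by exists (cone_complex C); [apply: fun_f|rewrite PhiE].
rewrite card_eq_sym; apply: inj_card_eq => _ _ /set_mem[C mC <-] /set_mem[C' mC' <-] eqPhi.
have sub X D D' : maximal_cones R 6 D -> maximal_cones R 6 D' ->
    Phi (range ((@relabel_cone 6 R)^~ D)) = Phi (range ((@relabel_cone 6 R)^~ D')) ->
    range ((@relabel_cone 6 R)^~ D) X -> range ((@relabel_cone 6 R)^~ D') X.
  move=> mD mD' eqD [s _ <-].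
  have [mX _] := cone_complex_relabel s mD.
  have : Phi (range ((@relabel_cone 6 R)^~ D)) (cone_complex (relabel_cone s D)).
    by exists (relabel_cone s D) => //; exists s.
  rewrite eqD => -[_ [t _ <-] eq_t]; exists t => //.
  have [mY _] := cone_complex_relabel t mD'.
  by apply: inj_f; rewrite ?inE.
by apply/seteqP; split=> X; apply: sub.
Qed.

End Cones.

(** * The search for choices of pairs, and its data *)
Local Open Scope nat_scope.

(** The three ways to split four labels [a < b < c < d] into two pairs, named after the
    partner of [a] in increasing order. *)
Inductive pairing := P1 | P2 | P3.
Definition pairings := [:: P1; P2; P3].

(** The flag [Hex x y a b c d] stands for the pair of disjoint edges [a b], [c d] on the
    labels other than [x] and [y]. *)
Definition flag := hex vx.
Definition flag_side (p : flag) : side :=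
  let: Hex x y a b c d := p in [:: mk a b; mk c d].
(** The other two pairs of edges on the same four labels; each forms a four-cycle with
    the first one. *)
Definition anti_sides (p : flag) : seq side :=
  let: Hex x y a b c d := p in
  [:: [:: mk a c; mk b d]; [:: mk a d; mk b c]].

Definition flag_of (e : edge) (k : pairing) : flag :=
  match [seq v <- vs | negb (eqv v e.1 ||| eqv v e.2)] with
  | [:: a; b; c; d] =>
    match k with
    | P1 => Hex e.1 e.2 a b c d
    | P2 => Hex e.1 e.2 a c b d
    | P3 => Hex e.1 e.2 a d b c
    end
  | _ => Hex e.1 e.2 e.1 e.2 e.1 e.2
  end.

(** A choice of a pairing for each of the fifteen sets of four labels, in the order of
    the complementary edges. *)
Definition path := seq pairing.
Fixpoint flags_on (es : seq edge) (ks : path) : seq flag :=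
  match es, ks with
  | e :: es', k :: ks' => flag_of e k :: flags_on es' ks'
  | _, _ => [::]
  end.
Definition flags (ks : path) : seq flag := flags_on edges ks.
Definition antis (ks : path) : seq side := flatten (map anti_sides (flags ks)).

(** The label paired with [a] when [x] and [y] are left out is the entry at [x], [y],
    [a]. *)
Definition partners := hex (hex (hex vx)).
Definition partner (p : flag) : hex vx :=
  let: Hex x y a b c d := p in
  hexfun (fun v => if eqv v x then y else if eqv v y then x else
    if eqv v a then b else if eqv v b then a else if eqv v c then d else c).
(** The entries above the diagonal are given by rows. *)
Definition symmetric (X : Type) (d : X) (l : seq X) : hex (hex X) :=
  match l with
  | [:: a; b; c; e; f; g; h; i; j; k; l; m; n; o; p] =>
    Hex (Hex d a b c e f) (Hex a d g h i j) (Hex b g d k l m)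
        (Hex c h k d n o) (Hex e i l n d p) (Hex f j m o p d)
  | _ => let r := Hex d d d d d d in Hex r r r r r r
  end.
(** The values of a function of flags at the three pairings, tabulated once so that they
    need not be recomputed for every choice. *)
Definition triple (X : Type) := (X * X * X)%type.
Definition pick_of X (t : triple X) (k : pairing) : X :=
  let: (x1, x2, x3) := t in match k with P1 => x1 | P2 => x2 | P3 => x3 end.
Fixpoint pick_all X (ts : seq (triple X)) (ks : path) : seq X :=
  match ts, ks with
  | t :: ts', k :: ks' => pick_of t k :: pick_all ts' ks'
  | _, _ => [::]
  end.
Definition triples X (f : flag -> X) : seq (triple X) :=
  [seq (f (flag_of e P1), f (flag_of e P2), f (flag_of e P3)) | e <- edges].
Definition no_partner : hex vx := hexfun id.
Definition partners_in (pt : seq (triple (hex vx))) (ks : path) : partners :=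
  symmetric no_partner (pick_all pt ks).
Definition partners_of (ks : path) : partners := partners_in (triples partner) ks.
(** The flag moved by [s] is among the chosen ones. *)
Definition sees (m : partners) (s : hex vx) (p : flag) : bool :=
  let: Hex x y a b c d := p in
  eqv (get (get (get m (get s x)) (get s y)) (get s a)) (get s b).

(** The functionals used in refutations have coefficients -1, 0 and 1. *)
Inductive sgn := Neg | Zero | Pos.
Definition addsgn (u v : sgn) : sgn :=
  match u, v with
  | Neg, Neg | Neg, Zero | Zero, Neg => Neg
  | Pos, Pos | Pos, Zero | Zero, Pos => Pos
  | _, _ => Zero
  end.
Definition isneg (u : sgn) := if u is Neg then true else false.
Definition iszero (u : sgn) := if u is Zero then true else false.
Definition esgn (y : hex sgn) (e : edge) : sgn := addsgn (get y e.1) (get y e.2).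
(** The signs of a functional at the labels, and the edges at which it is negative. *)
Definition functional := (hex sgn * side)%type.
Definition functional_of (y : hex sgn) : functional :=
  (y, [seq e <- edges | isneg (esgn y e)]).

(** Differences of two coordinates. *)
Definition star_functionals : seq functional :=
  [seq functional_of (hexfun (fun v => if eqv v e.1 then Neg else
                                       if eqv v e.2 then Pos else Zero))
  | e <- [seq (a, b) | a <- vs, b <- vs] & ~~ eqv e.1 e.2].
Fixpoint words (A : Type) (l : seq A) (n : nat) : seq (seq A) :=
  if n is n'.+1 then flatten [seq map (cons a) (words l n') | a <- l] else [:: [::]].
Definition hex_of_seq (A : Type) (x0 : A) (s : seq A) : hex A :=
  hexfun (fun v => nth x0 s (ov v)).
(** The negatives of the coordinates, and the signs of the partitions of the labels into
    two parts with at least two elements. *)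
Definition cut_functionals : seq functional :=
  [seq functional_of (hexfun (fun v => if eqv v a then Neg else Zero)) | a <- vs] ++
  [seq functional_of (hex_of_seq Zero s) | s <- words [:: Neg; Pos] 6 &
     let n := count isneg s in (2 <= n) &&& (n <= 4)].

(** For each edge, the rest of those forbidden sides that contain it. *)
Definition index_table := hex (hex (seq side)).
Definition without (e : edge) (A : side) : side := [seq f <- A | ~~ eqe e f].
Definition index_sides (L : seq side) : index_table :=
  hexfun (fun a => hexfun (fun b =>
    [seq without (a, b) A | A <- L & has_edge A (a, b)])).
Definition allowed (t : index_table) (R : side) (e : edge) : bool :=
  ~~ any (fun B => sub B R) (get (get t e.1) e.2).

(** Only whether there are none, one or more is of interest. *)
Fixpoint first_two (p : edge -> bool) (s : side) : side :=
  if s is e :: s' then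
    if p e then e :: (fix first_one t := if t is f :: t' then
                        if p f then [:: f] else first_one t' else [::]) s'
    else first_two p s'
  else [::].

(** By the extension property some edge at which the functional is negative can be
    added. None being allowed is a contradiction, and a single one is forced. *)
Inductive verdict := Refuted | Forced of edge | Unknown.
Fixpoint scan (t : index_table) (R : side) (ys : seq functional) (v : verdict) : verdict :=
  if ys is (y, neg) :: ys' then
    if every (fun e => iszero (esgn y e)) R &&& ~~ nilp neg then
      match first_two (allowed t R) neg with
      | [::] => Refuted
      | [:: e] => scan t R ys' (if v is Unknown then Forced e else v)
      | _ => scan t R ys' v
      end
    else scan t R ys' v
  else v.
Fixpoint refute (n : nat) (t : index_table) (ys : seq functional) (R : side) : bool :=
  match scan t R ys Unknown with
  | Refuted => true
  | Forced e => if n is n'.+1 then refute n' t ys (e :: R) else false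
  | Unknown => false
  end.

(** Finite sets of choices, organised by their initial segments. *)
Inductive trie (X : Type) := Dead | Leaf of X | Node of trie X & trie X & trie X.
Arguments Dead {X}.
Definition child X (t : trie X) (k : pairing) : trie X :=
  if t is Node t1 t2 t3 then
    match k with P1 => t1 | P2 => t2 | P3 => t3 end
  else Dead.
Definition isdead X (t : trie X) : bool := if t is Dead then true else false.
Definition eqp (k l : pairing) : bool :=
  match k, l with P1, P1 | P2, P2 | P3, P3 => true | _, _ => false end.
Definition tails X (k : pairing) (l : seq (path * X)) : seq (path * X) :=
  pmap (fun c => if c.1 is k' :: ks then
                   if eqp k k' then Some (ks, c.2) else None else None) l.
Fixpoint trie_of X (n : nat) (l : seq (path * X)) : trie X :=
  if l is c :: _ then
    if n is n'.+1 then
      Node (trie_of n' (tails P1 l)) (trie_of n' (tails P2 l)) (trie_of n' (tails P3 l))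
    else Leaf c.2
  else Dead.

(** The five sets of four labels that avoid the first label, tested separately from the
    other ten. *)
Definition star_valid (ks : path) : bool :=
  let qs := flags ks in
  let t := index_sides (antis ks) in
  ~~ any (fun p => refute 0 t star_functionals (flag_side p)) qs.
Definition star_trie : trie unit :=
  trie_of 5 [seq (ks, tt) | ks <- words pairings 5 & star_valid ks].
(** Representatives of the stars that are not refuted, under permutations of the other
    five labels. *)
Definition start_paths : seq path :=
  [:: [:: P1; P1; P1; P1; P2]; [:: P1; P1; P2; P2; P3]; [:: P1; P1; P1; P1; P1]].

Definition set_trie X (ts : hex X) (v : vx) (t : X) : hex X :=
  hexfun (fun u => if eqv u v then t else get ts u).
(** Two tries advance with each edge, those of the stars at its endpoints. *)
Fixpoint search (test : path -> bool) (es : seq edge) (ts : hex (trie unit))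
    (acc : path) : bool :=
  if es is e :: es' then
    every (fun k =>
      let t1 := child (get ts e.1) k in
      let t2 := child (get ts e.2) k in
      isdead t1 ||| isdead t2 |||
      search test es' (set_trie (set_trie ts e.1 t1) e.2 t2) (k :: acc)) pairings
  else test (rev acc).

(** A nonregular triangulation, as a flip in [flip_circuit] of the subdivision induced
    by [near_heights]. In [choice_sides] the forbidden side of each undecided circuit is
    recorded; [certificate] lists oriented circuits that prove nonregularity. Circuits
    are given by position and orientation. *)
Record irregular := Irregular {
  near_heights : seq nat; flip_circuit : nat * bool;
  choice_sides : seq bool; certificate : seq (nat * bool) }.
Record group := Group {
  gpath : path; gregular : seq (seq nat); girregular : seq irregular }.
Delimit Scope dec_uint_scope with uint.
Fixpoint digits (u : Decimal.uint) : seq nat :=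
  match u with
  | Decimal.Nil => [::]
  | Decimal.D0 u => 0 :: digits u | Decimal.D1 u => 1 :: digits u
  | Decimal.D2 u => 2 :: digits u | Decimal.D3 u => 3 :: digits u
  | Decimal.D4 u => 4 :: digits u | Decimal.D5 u => 5 :: digits u
  | Decimal.D6 u => 6 :: digits u | Decimal.D7 u => 7 :: digits u
  | Decimal.D8 u => 8 :: digits u | Decimal.D9 u => 9 :: digits u
  end.
(** Choices and heights are single digits, so that they are written as numerals. *)
Definition numeral_digits (u : Number.uint) : seq nat :=
  if u is Number.UIntDecimal d then digits d else [::].
Definition path_of (u : Number.uint) : path :=
  [seq match d with 1 => P1 | 2 => P2 | _ => P3 end | d <- numeral_digits u].
Definition irregular_of (u : Number.uint) : nat * bool -> seq bool -> seq (nat * bool) ->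
    irregular := Irregular (numeral_digits u).
Definition group_of (u : Number.uint) (us : seq Number.uint) : seq irregular -> group :=
  Group (path_of u) (map numeral_digits us).

(** For each choice of pairs up to relabelling: heights of the regular triangulations,
    and the nonregular ones, one for each orbit of the permutations that preserve the
    choice. Choices without any triangulation occur, too. *)
Definition groups : seq group :=
  [:: group_of 111121111111111 [:: 630001100230224; 620000000010014; 730000100110146;
            510000100000025; 430000100220145]
        [:: irregular_of 620000000020115 (152, true)%N [:: false; false; true; true]
            [:: (17, true); (34, true); (137, false); (152, true)]%N];
      group_of 111121111111112 [:: 530000300000045; 530000400000057; 420002300000025] [::];
      group_of 111121111111122 [:: 640000430000067; 530001430000046; 541001320000037] [::];
      group_of 111121111111211 [:: 550000001120035; 540001102220047; 330002101230126] [::];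
      group_of 111121111111212 [:: 560000202120046; 340000102020036; 250001000040006;
            440000201110045; 450001200020036; 330001201110036] [::];
      group_of 111121111111222 [:: 380000100000034; 150000001010024; 460000100000023;
            140000000010014; 340000100000045]
        [:: irregular_of 250002100020006 (122, false)%N [:: false; false; true; true]
            [:: (7, true); (31, true); (122, false); (155, true)]%N];
      group_of 111121111111311 [:: 550024200340168; 550024100340047; 530033200130127] [::];
      group_of 111121111111312 [:: 540033300120157; 440014300020047; 320022200020126] [::];
      group_of 111121111111322 [:: 550042310000078; 330022320010135; 440032230020027] [::];
      group_of 111121111112122 [:: 441000440011068; 332002330011136] [::];
      group_of 111121111112222 [:: 041000110010024; 163000220120036; 152001210000035;
            132001210000024; 351001230020047; 232000210000046] [::];
      group_of 111121111112322 [:: 240032340020058; 231013330010036] [::];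
      group_of 111121111113112 [:: 320001400000045; 210001300000035] [::];
      group_of 111121111113122 [:: 340002410002056; 340003500002056; 340003410002049;
            330002510001059] [::];
      group_of 111121111113132 [:: 541205500011057; 420104500001036] [::];
      group_of 111121111113212 [:: 340002401120035; 340102301020027; 450002500120057;
            340003400020038] [::];
      group_of 111121111113222 [:: 030000101000023; 060100301230046; 082100311320059;
            072300512310069; 130001200000023; 240002500000045; 020000100000025;
            141101200020026; 020000100000056; 130101300000057; 140002200110048;
            120000300000058] [::];
      group_of 111121111121212 [:: 240004305040227; 161002001060208] [::];
      group_of 111121111121222 [:: 070002002040116; 363002204020136]
        [:: irregular_of 241000313100205 (31, true)%N [:: false; true]
            [:: (7, true); (31, true); (122, false); (155, true)]%N];
      group_of 111121111123212 [:: 362203404040227; 250004305040028] [::];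
      group_of 111121111123222 [:: 042002302000023; 061101303030037; 072004414110027;
            072103514230048; 041002202010015; 063103402020026] [::];
      group_of 111121111123232 [:: 052204403030226; 030103203020015] [::];
      group_of 111121111131212 [:: 350023401030226; 250013200040107] [::];
      group_of 111121111131222 [:: 050020000020114; 140021100020114]
        [:: irregular_of 050020000020114 (155, true)%N [:: false; true]
            [:: (7, true); (31, true); (122, false); (155, true)]%N];
      group_of 111121111131312 [:: 430033400010125; 230013200030105] [::];
      group_of 111121111132222 [:: 042011320000034; 062012321110026] [::];
      group_of 111121111132322 [:: 051024330020036; 042032210010015] [::];
      group_of 111121111133212 [:: 260134702250148; 270045703360038; 350023501030037;
            240013501130037] [::];
      group_of 111121111133222 [:: 050003402000023; 050112412120035; 072233522200037;
            082224613420047; 060004500000023; 050022500010046; 080036702200029;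
            051011310000034; 071002522310048; 040011300000035] [::];
      group_of 111121111133232 [:: 050204400010014; 050215602000028; 030103301010015] [::];
      group_of 111121111133312 [:: 330043600010046; 330054700020048; 430033500000035;
            320023400010025] [::];
      group_of 111121111133322 [:: 050033400000024; 030032310100025; 050024500210026;
            040023310010016] [::];
      group_of 111121111133332 [:: 030017700010024; 030036600010015; 030014400010024;
            010023400000025; 120003500000135; 020004400010015] [::];
      group_of 111121111223232 [:: 040104304020014; 041204303020004] [::];
      group_of 111121111233232 [:: 040114303020003; 030106504020004] [::];
      group_of 111121111233332 [:: 062446503020036; 040137605020005] [::];
      group_of 111121111332322 [:: 041032220010024] [::];
      group_of 111121111333222 [:: 050013430000023; 071143731330056; 083254742240048] [::];
      group_of 111121111333322 [:: 030023420000023; 051055610010025; 040063630120048] [::];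
      group_of 111121111333332 [:: 040146620010025; 041245520010015] [::];
      group_of 111121112111111 [:: 300000000010013; 602000200010036; 410001100150016;
            200000000010014; 502001300010036; 511003200030026] [::];
      group_of 111121112111112 [:: 421002300020025] [::];
      group_of 111121112111211 [:: 310003003340046; 230003001340025; 110002002240036] [::];
      group_of 111121112111212 [:: 430002303040027; 240003000050006] [::];
      group_of 111121112111213 [:: 321003002040016] [::];
      group_of 111121112112122 [:: 332001230021036] [::];
      group_of 111121112112123 [:: 334002230021036] [::];
      group_of 111121112112133 [:: 204202210011068] [::];
      group_of 111121112112211 [:: 122000000230035] [::];
      group_of 111121112112212 [:: 233000201020036; 233000100020036] [::];
      group_of 111121112112222 [:: 052000321440067; 032000100020036; 233000110010035] [::];
      group_of 111121112112223 [:: 023001110120046] [::];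
      group_of 111121112112233 [:: 033103101230057] [::];
      group_of 111121112112311 [:: 301031230020047] [::];
      group_of 111121112112312 [:: 221021220130036] [::];
      group_of 111121112112313 [:: 112003110030026; 313014310030037; 202012110030048] [::];
      group_of 111121112112322 [:: 132013320020047] [::];
      group_of 111121112112323 [:: 233024230030037; 133013210020047] [::];
      group_of 111121112112333 [:: 006217520230079; 003003200220045; 023004200230068] [::];
      group_of 111121112122222 [:: 044002322010024; 043001221020025; 042001000030004] [::];
      group_of 111121112123232 [:: 032103302020014] [::];
      group_of 111121112123233 [:: 022103202020014] [::];
      group_of 111121112222222 [:: 077204513010024] [::];
      group_of 111121112222223 [:: 055104314020014] [::];
      group_of 111121112222233 [:: 035204204230035] [::];
      group_of 111121112222333 [:: 046336314240036] [::];
      group_of 111121112223222 [:: 065203404120035] [::];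
      group_of 111121112223232 [:: 054204403020014] [::];
      group_of 111121112223233 [:: 033204303020014] [::];
      group_of 111121112233222 [:: 073325725350047] [::];
      group_of 111121113123212 [::]
        [:: irregular_of 231104404040016 (23, false)%N [:: ]
            [:: (1, true); (10, false); (23, false); (31, true)]%N];
      group_of 111121113223222 [:: 064502522200046] [::];
      group_of 111121113223232 [:: 043504402110014; 042403403110025] [::];
      group_of 111121113223233 [:: 024404303320034] [::];
      group_of 111121113233222 [:: 063504642210036] [::];
      group_of 111121113233232 [:: 032414503100025; 042413402110025] [::];
      group_of 111121113233332 [:: 032405501110014; 042425602110025] [::];
      group_of 111121113233333 [:: 023414401110024] [::];
      group_of 111121113333322 [:: 022232640320056] [::];
      group_of 111121113333332 [:: 022424540000025; 043424530110024] [::];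
      group_of 111121113333333 [:: 035525640100034] [::];
      group_of 111121121111111 [::]
        [:: irregular_of 501001000122025 (17, true)%N [:: false; false]
            [:: (17, true); (19, false); (32, false); (34, true)]%N;
            irregular_of 602001100011026 (17, true)%N [:: false; true]
            [:: (17, true); (19, false); (32, false); (34, true)]%N];
      group_of 111121123223233 [:: 024503302110014] [::];
      group_of 111121123233333 [:: 013505501010015] [::];
      group_of 111121123333333 [:: 014515650000025] [::];
      group_of 111121133133331 [:: 410355400320007; 200144500400025; 400346400330008;
            300223300210015; 300114400210015] [::];
      group_of 111121133133332 [:: 020154500300026; 010144400310015; 030155500540017;
            020225500210015; 020234400120015; 120133500400035; 130243500420036;
            010123400200026; 020033500300035; 000012300200025; 030123300320017] [::];
      group_of 111121133233331 [::]
        [:: irregular_of 200144500400025 (11, false)%N [:: false]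
            [:: (0, true); (11, false); (26, true); (31, true)]%N];
      group_of 111121133233332 [:: 040467604220007; 031456502220005; 050467605450038;
            032335502210014; 042345502220014] [::];
      group_of 111121133233333 [:: 023436402430015; 011446503220006; 014536402430026;
            023425401220014] [::];
      group_of 111121222111113 [:: 503304100142004] [::];
      group_of 111121222113111 [:: 504503100351014] [::];
      group_of 111121222113113 [:: 503504100151005] [::];
      group_of 111121222113133 [:: 403404200131003] [::];
      group_of 111121222123113 [:: 505602001040005] [::];
      group_of 111121222123133 [:: 304403100031004] [::];
      group_of 111121222223133 [:: 303504204032015] [::];
      group_of 111121222223333 [:: 004606303142004; 003402100020003; 004504100240014] [::];
      group_of 111121222233333 [:: 003406500020003] [::];
      group_of 111121222333333 [:: 004436640013046] [::];
      group_of 111121223113111 [:: 502503100241004] [::];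
      group_of 111121223113131 [:: 403504100442014] [::];
      group_of 111121223113133 [:: 303403200221013] [::];
      group_of 111121223223133 [:: 107800100220035] [::];
      group_of 111121223223233 [:: 005702203010025] [::];
      group_of 111121223223333 [:: 007804300220002; 006714300220003; 005605200440013] [::];
      group_of 111121223233333 [:: 004505500110013] [::];
      group_of 111121223333333 [:: 005625650000024] [::];
      group_of 111121233133331 [:: 602747600522028; 302636400631016; 503546400533026] [::];
      group_of 111121233133332 [::]
        [:: irregular_of 010155500310016 (20, false)%N [:: false; false]
            [:: (12, true); (20, false); (26, true); (34, true)]%N];
      group_of 111121233233333 [:: 007746500520002; 003726400530005; 005634300320013] [::];
      group_of 111121233333331 [::]
        [:: irregular_of 402736400530006 (8, false)%N [:: ]
            [:: (0, true); (8, false); (26, true); (28, true); (34, true); (36, true)]%N];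
      group_of 111121322131313 [:: 403034200031004] [::];
      group_of 111121322132313 [:: 104024310040005; 205025400050006] [::];
      group_of 111121322132333 [:: 003023200020003] [::];
      group_of 111121322133313 [:: 304224300140004] [::];
      group_of 111121322333313 [::] [::];
      group_of 111121332111311 [:: 400014000350014; 401023100230003; 200003100350014] [::];
      group_of 111121332111313 [:: 403024100240003] [::];
      group_of 111121332131311 [:: 400034300250004; 400033200230004; 401033300230014] [::];
      group_of 111121332132311 [:: 302042320340024; 202032210330024] [::];
      group_of 111121332132313 [:: 001041110040016; 203034320230004; 204044100240003;
            204043200240004] [::];
      group_of 111121332133311 [:: 201053400330025; 300033400250026; 401133400340025] [::];
      group_of 111121332133313 [:: 000024300250004; 003043400250026; 203133300230014;
            103123300240025] [::];
      group_of 111121332133333 [:: 000134300040005; 001045400020005; 003234300120014;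
            103134300120014] [::];
      group_of 111121332233333 [:: 002435301360004; 003334402230014; 004344302120013] [::];
      group_of 111121332332333 [:: 004154310240003; 004044310230003; 003134320220003;
            004134310220012] [::];
      group_of 111121332333333 [:: 003164300140004; 002154300030004] [::];
      group_of 111121333133331 [:: 201445400560015; 100344400440016; 400255400320006;
            402434200330004] [::];
      group_of 111121333133333 [:: 102434400450014; 001256500320006; 002415300450005;
            003434200330025; 204335300530034] [::];
      group_of 111121333233331 [::]
        [:: irregular_of 000534400560024 (26, true)%N [:: false]
            [:: (0, true); (11, false); (26, true); (31, true)]%N;
            irregular_of 100534200430013 (26, true)%N [:: true]
            [:: (0, true); (11, false); (26, true); (31, true)]%N];
      group_of 111121333333333 [:: 004564430550024; 003455400440003; 003789400570006] [::];
      group_of 111122213113112 [::] [::];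
      group_of 111122233233332 [:: 000512300200021; 000714500300033; 020825501620034;
            000422400200032; 000523500400044; 010525500310013] [::];
      group_of 111122333113311 [:: 100221100330034] [::];
      group_of 111122333113331 [:: 100333200430055] [::];
      group_of 111122333133331 [:: 400545600550024; 300655400320014] [::];
      group_of 112231111332222 [:: 040000340000002; 050000350003004; 040000460002003;
            031000440100002; 040020460101004; 031000560200002] [::];
      group_of 112231223223222 [:: 022200322203002] [::];
      group_of 111111111111111 [:: 610001000000123; 710000100100335; 400000000000113;
            610001000000235; 520000000100235; 410001000000003; 520002000100134;
            640003100320336; 420002000100223; 410003000000234]
        [:: irregular_of 400000000001124 (152, true)%N [:: false; false; false; true; true; true; false]
            [:: (19, true); (32, true); (137, false); (152, true)]%N];
      group_of 111111122122333 [:: 003002000000001; 003004010010002; 004103010101003;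
            006015110110015; 008138000202007; 004014010100004]
        [:: irregular_of 228004000000137 (107, false)%N [:: false; true; true; false; false; false]
            [:: (107, false); (125, true); (140, true); (162, false); (171, false); (186, false)]%N]]%uint.

Definition group0 : group := Group [::] [::] [::].
Definition nth_group (i : nat) : group := nth group0 groups i.
Definition group_table : seq (path * nat) :=
  zip (map gpath groups) (iota 0 (size groups)).
Notation group_trie := (trie_of 15 group_table).
(** Descends in a trie of choices along what [m] has after relabelling by [s]. *)
Fixpoint locate X (m : partners) (s : hex vx) (es : seq (triple flag))
    (t : trie X) : option X :=
  match t with
  | Leaf x => Some x
  | Node t1 t2 t3 =>
    if es is (p1, p2, p3) :: es' then
      if sees m s p1 then locate m s es' t1 else
      if sees m s p2 then locate m s es' t2 else
      if sees m s p3 then locate m s es' t3 else None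
    else None
  | Dead => None
  end.
(** A star at the first label, completed to a full choice in an arbitrary way. *)
Definition padded (ks : path) : path := ks ++ nseq 10 P1.
Definition star_covered (ks : path) : bool :=
  let m := partners_of (padded ks) in
  any (fun s => eqv (get s V0) V0 &&&
    any (fun k0 => every (sees m s) (flags k0)) start_paths) perms.
Definition stars_covered : bool :=
  every star_covered [seq ks <- words pairings 5 | star_valid ks].

Definition located (pt : seq (triple (hex vx))) (fs : seq (triple flag)) (gt : trie nat)
    (ss : seq (hex vx)) (ks : path) : bool :=
  let m := partners_in pt ks in
  any (fun s => isSome (locate m s fs gt)) ss.
Definition search_from (st : trie unit) (test : path -> bool) (k0 : path) : bool :=
  search test edges (set_trie (hexfun (fun=> st)) V0 (trie_of 5 [:: (k0, tt)])) [::].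

(** * The triangulations with a given choice of pairs *)

Definition meets (L : seq side) (A : side) : bool := any (fun B => sub B A) L.
Definition table_meets (t : index_table) (A : side) : bool :=
  any (fun e => any (fun B => sub B A) (get (get t e.1) e.2)) A.
Definition undecided (cs : seq circuit) (t : index_table) : seq circuit :=
  [seq Z <- cs | ~~ (table_meets t Z.1 ||| table_meets t Z.2)].

Definition loser (m : table) (Z : circuit) : side :=
  if weight m Z.1 < weight m Z.2 then Z.1 else Z.2.
Definition decides (m : table) (us : seq circuit) : bool :=
  every (fun Z => ~~ eqn (weight m Z.1) (weight m Z.2)) us.
Definition favours (m : table) (p : flag) : bool :=
  every (fun A => weight m A < weight m (flag_side p)) (anti_sides p).

Definition regular_ok (qs : seq flag) (us : seq circuit) (hs : seq nat) : bool :=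
  let m := table_of hs in every (favours m) qs &&& decides m us.
Definition regular_sides (us : seq circuit) (hs : seq nat) : seq side :=
  let m := table_of hs in map (loser m) us.

Definition choose_side (Z : circuit) (b : bool) : side := if b then Z.2 else Z.1.
Fixpoint choose_sides (us : seq circuit) (bs : seq bool) : seq side :=
  match us, bs with
  | Z :: us', b :: bs' => choose_side Z b :: choose_sides us' bs'
  | _, _ => [::]
  end.
Definition oriented (cs : seq circuit) (ib : nat * bool) : circuit :=
  let Z := nth ([::], [::]) cs ib.1 in if ib.2 then swap Z else Z.
Definition all_losers (m : table) (cs : seq circuit) : seq side :=
  [seq loser m Z | Z <- cs & ~~ eqn (weight m Z.1) (weight m Z.2)].
Definition edge_count (e : edge) (A : side) : nat := count (eqe e) A.

Definition irregular_sides (us : seq circuit) (r : irregular) : seq side :=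
  choose_sides us (choice_sides r).
(** Each second side is a cell, so that heights inducing the triangulation would make
    each first side strictly lower, but in total the two sides are equal. *)
Definition certified (L : seq side) (zs : seq circuit) : bool :=
  ~~ nilp zs &&& every (fun Z => ~~ meets L Z.2) zs &&&
  every (fun e => eqn (edge_count e (flatten (map fst zs)))
                      (edge_count e (flatten (map snd zs)))) edges.
Definition irregular_ok (cs : seq circuit) (an : seq side) (us : seq circuit)
    (r : irregular) : bool :=
  let L := an ++ irregular_sides us r in
  eqn (size (choice_sides r)) (size us) &&&
  flip_ok (all_losers (table_of (near_heights r)) cs) (oriented cs (flip_circuit r)) L &&&
  every (fun ib => ib.1 < size cs) (flip_circuit r :: certificate r) &&&
  certified L (map (oriented cs) (certificate r)).

Definition matched (reps : seq (seq side)) (ss : seq (hex vx)) (Ls : seq side) : bool :=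
  any (fun r => any (fun s => every (fun A => meets r (move_side s A)) Ls) ss) reps.
Definition refuted (fsides : seq side) (L : seq side) : bool :=
  let t := index_sides L in any (refute 3 t cut_functionals) fsides.
Fixpoint exhausted (test : seq side -> bool) (us : seq circuit) (Ls : seq side) : bool :=
  if us is Z :: us' then
    exhausted test us' (Z.1 :: Ls) &&& exhausted test us' (Z.2 :: Ls)
  else test Ls.

Definition group_reps (us : seq circuit) (g : group) : seq (seq side) :=
  map (regular_sides us) (gregular g) ++ map (irregular_sides us) (girregular g).
Definition group_ok (cs : seq circuit) (ss : seq (hex vx)) (g : group) : bool :=
  let fs := flags (gpath g) in
  let an := antis (gpath g) in
  let us := undecided cs (index_sides an) in
  let m := partners_of (gpath g) in
  let stab := [seq s <- ss | every (sees m s) fs] in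
  let reps := group_reps us g in
  every (regular_ok fs us) (gregular g) &&&
  every (irregular_ok cs an us) (girregular g) &&&
  exhausted (fun Ls => matched reps stab Ls |||
                       refuted (map flag_side fs) (an ++ Ls)) us [::].
Definition groups_ok : bool := let cs := half_circs in let ss := perms in
  every (group_ok cs ss) groups.

(** * Equivalence of representatives and sizes of orbits *)

(** The graphs avoiding [L'] avoid [L] moved by [s]; for two triangulations this already
    is equality. *)
Definition maps_to (L L' : seq side) (s : hex vx) : bool :=
  every (fun A => meets L' (move_side s A)) L.
Definition regular_reps (cs : seq circuit) (g : group) : seq (seq side) :=
  let an := antis (gpath g) in
  map (cat an \o regular_sides (undecided cs (index_sides an))) (gregular g).
Definition irregular_reps (cs : seq circuit) (g : group) : seq (seq side) :=
  let an := antis (gpath g) in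
  map (cat an \o irregular_sides (undecided cs (index_sides an))) (girregular g).
Definition apart (ss : seq (hex vx)) (L L' : seq side) : bool :=
  ~~ any (maps_to L L') ss.
Fixpoint all_apart (ss : seq (hex vx)) (Ls : seq (seq side)) : bool :=
  if Ls is L :: Ls' then every (apart ss L) Ls' &&& all_apart ss Ls' else true.
Definition group_lists (cs : seq circuit) (i : nat) : seq (seq side) :=
  regular_reps cs (nth_group i) ++ irregular_reps cs (nth_group i).
(** Thus no relabelling of the choice is listed in another position. *)
Definition located_only (fs : seq (triple flag)) (gt : trie nat) (m : partners) (i : nat) : bool :=
  every (fun s => if locate m s fs gt is Some j then eqn i j else true) perms.
Definition located_perms (fs : seq (triple flag)) (gt : trie nat) (m : partners) :=
  [seq s <- perms | isSome (locate m s fs gt)].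
Definition groups_located (fs : seq (triple flag)) (gt : trie nat) : bool :=
  every (fun i => located_only fs gt (partners_of (gpath (nth_group i))) i) (iota 0 (size groups)).
Definition groups_apart (cs : seq circuit) (fs : seq (triple flag)) (gt : trie nat) : bool :=
  every (fun i => all_apart (located_perms fs gt (partners_of (gpath (nth_group i))))
                            (group_lists cs i)) (iota 0 (size groups)).
Definition seeing (m : partners) (fs : seq flag) : seq (hex vx) :=
  [seq s <- perms | every (sees m s) fs].
Definition group_stab (g : group) := seeing (partners_of (gpath g)) (flags (gpath g)).
(** The number of elements of the orbit, if [ss] contains the stabiliser. *)
Definition orbit_size (ss : seq (hex vx)) (L : seq side) : N :=
  N.div 720 (N.of_nat (count (maps_to L L) ss)).
Definition add_orbits (ss : seq (hex vx)) (Ls : seq (seq side)) (n : N) : N :=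
  foldr (fun L => N.add (orbit_size ss L)) n Ls.
Definition orbit_sizes (reps : group -> seq (seq side)) (s : seq nat) : N :=
  foldr (fun i => add_orbits (group_stab (nth_group i)) (reps (nth_group i))) 0%num s.
Definition rep_lists (reps : group -> seq (seq side)) : seq (seq side) :=
  flatten [seq reps (nth_group i) | i <- iota 0 (size groups)].

(** * Pairs in a triangulation, and refutations *)
Local Open Scope classical_set_scope.
Local Open Scope ring_scope.

Definition flag_perm (q : flag) (k : pairing) : flag := flag_of (mk (get q V0) (get q V1)) k.

(** With the choice [k], the table of partners decides correctly about [q]: either [q]
    is the chosen pair, or it excludes the chosen one. *)
Definition flag_ok (q : flag) : bool :=
  every (fun k => let p := flag_perm q k in
    if eqv (get (partner p) (get q V2)) (get q V3)
    then sub (flag_side q) (flag_side p)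
    else any (fun A => sub A (flag_side p)) (anti_sides q)) pairings.
Lemma flags_ok : every flag_ok perms.
Proof. vm_cast_no_check (erefl true). Qed.

Definition flag_of_ok (e : edge) : bool :=
  every (fun k => any (fun s => every (fun v => eqv (get s v) (get (flag_of e k) v)) vs) perms) pairings.
Lemma flags_of_ok : every flag_of_ok edges.
Proof. vm_cast_no_check (erefl true). Qed.

Definition base_flag : flag := Hex V4 V5 V0 V1 V2 V3.
(** A circuit that could exclude a pair from a triangulation contains one of the other
    two pairs. *)
Definition base_ok (Z : circuit) : bool :=
  if sub Z.2 (flag_side base_flag) then any (fun A => sub A Z.1) (anti_sides base_flag) else true.
Lemma bases_ok : every (fun Z => base_ok Z &&& base_ok (swap Z)) half_circs.
Proof. vm_cast_no_check (erefl true). Qed.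

(** Sides of four-cycles and pairs of edges agree only up to order. *)
Definition eq2 (A B : side) : bool :=
  match A, B with
  | [:: a; b], [:: c; d] => (eqe a c &&& eqe b d) ||| (eqe a d &&& eqe b c)
  | _, _ => false
  end.
Definition conflict_ok (fours : seq circuit) (q : flag) : bool :=
  every (fun A => any (fun Z => (eq2 Z.1 (flag_side q) &&& eq2 Z.2 A) |||
                                (eq2 Z.1 A &&& eq2 Z.2 (flag_side q))) fours)
    (anti_sides q).
Lemma conflicts_ok : every (conflict_ok (instances four_cycle)) perms.
Proof. vm_cast_no_check (erefl true). Qed.

Lemma eq2_perm A B : eq2 A B -> perm_eq A B.
Proof.
case: A => [|a [|b []]] //; case: B => [|c [|d []]] //=; rewrite !eqeE.
by case: ifP => [/andP[/eqP -> /eqP ->]|_ /andP[/eqP -> /eqP ->]] //; rewrite -[[:: d; c]]/([:: d] ++ [:: c]) perm_catC.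
Qed.

Lemma conflict_circuit q A : q \in perms -> A \in anti_sides q ->
  exists2 Z, Z \in circs & perm_eq Z.1 (flag_side q) /\ perm_eq Z.2 A.
Proof.
move=> qP Aanti; have := conflicts_ok; rewrite everyE => /allP/(_ q qP).
rewrite /conflict_ok everyE => /allP/(_ A Aanti); rewrite anyE => /hasP[Z Zi].
have Zc : Z \in circs by rewrite circsE /half_circs mem_cat Zi.
case: ifP => [/andP[/eq2_perm p1 /eq2_perm p2] _|_ /andP[/eq2_perm p1 /eq2_perm p2]].
  by exists Z.
by exists (swap Z); rewrite // swap_circs.
Qed.

Lemma every_pairings (p : pairing -> bool) : every p pairings -> forall k, p k.
Proof. by rewrite /=; do 3!case: ifP => // ?; move=> _ []. Qed.

Lemma permsE a b c d e f : (Hex a b c d e f \in perms) = uniq [:: a; b; c; d; e; f].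
Proof.
apply/permsP/idP => [inj_t|u].
  by rewrite -[[:: a; _; _; _; _; _]]/(map (get (Hex a b c d e f)) vs) map_inj_uniq.
move=> x y; rewrite !get_nth => /eqP.
by rewrite nth_uniq ?ltn_ord // => /eqP/ord_inj/(can_inj ovK).
Qed.

Lemma eq_gr A B : A =i B -> gr A = gr B.
Proof. by move=> eqAB; apply/finset.setP => e; rewrite !inE; apply: eq_mem_map. Qed.

Lemma gr_cons e A : gr (e :: A) = (E e |: gr A)%SET.
Proof. by apply/finset.setP => f; rewrite !inE. Qed.

Lemma flag_ofP e k : wf e -> flag_of e k \in perms.
Proof.
rewrite -edges_wf => eE; have := flags_of_ok; rewrite everyE => /allP/(_ e eE).
move=> /every_pairings/(_ k); rewrite anyE => /hasP[s sP]; rewrite everyE => /allP eqs.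
by have -> : flag_of e k = s by apply: hex_ext => v; have := eqs v (vsE v); rewrite eqvE => /eqP.
Qed.

Section Semantics.
Variable R : realType.
Implicit Types (T : complex 6) (A : side) (L : seq side).

Lemma relabel_complex_gr (s : 'S_6) T A :
  relabel_complex s^-1%g T (gr A) <-> T (gr (move_side (hexS s) A)).
Proof. by rewrite relabel_complexE invgK relabel_gr. Qed.

Lemma tri_sub_gr T A B : tri R T -> sub A B -> T (gr B) -> T (gr A).
Proof. by move=> tT sAB TB; apply: (tri_down tT TB); apply: sub_gr sAB _. Qed.

(** Two pairs on the same labels are the sides of a four-cycle. *)
Lemma anti_conflict T q A : tri R T -> q \in perms -> A \in anti_sides q ->
  T (gr (flag_side q)) -> T (gr A) -> False.
Proof.
move=> tT qP /(conflict_circuit qP)[Z Zc [/perm_mem p1 /perm_mem p2]].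
by rewrite -(eq_gr p1) -(eq_gr p2); apply: tri_circ tT Zc.
Qed.

Lemma move_flag_side s p : move_side s (flag_side p) = flag_side (hexfun (fun v => get s (get p v))).
Proof.
case: p => x y a b c d /=; rewrite /move_side /= /move_edge.
have mk_mk u v : mk (get s (mk u v).1) (get s (mk u v).2) = mk (get s u) (get s v).
  by rewrite [mk u v]/mk; case: ifP => //= _; rewrite mkC.
by rewrite !mk_mk.
Qed.

Lemma comp_perms s p : s \in perms -> p \in perms ->
  hexfun (fun v => get s (get p v)) \in perms.
Proof.
move=> /permsP inj_s /permsP inj_p; apply/permsP => u v.
by rewrite !get_hexfun => /inj_s/inj_p.
Qed.

(** If a pair is not a cell, then by [tri_maximal] a circuit with second side inside the
    pair has its first side in [T], and such a circuit is a four-cycle. It suffices to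
    look at one set of labels, after relabelling. *)
Lemma quad_pair T q : tri R T -> q \in perms ->
  T (gr (flag_side q)) \/ exists2 A, A \in anti_sides q & T (gr A).
Proof.
case: q => x y a b c d tT qP.
have /hexS_surj[s def_s] : Hex a b c d x y \in perms.
  by move: qP; rewrite !permsE -[[:: x; _; _; _; _; _]]/([:: x; y] ++ [:: a; b; c; d]) uniq_catC.
pose T' := relabel_complex s^-1%g T.
have tT' : tri R T' by apply: relabel_tri.
have wfb : all wf (flag_side base_flag) by [].
have [Tb|[Z [Zc T1 s2]]] := tri_maximal tT' (gr_Kn wfb).
  left; move: Tb => /relabel_complex_gr; rewrite def_s.
  by [].
have : base_ok Z.
  have := bases_ok; rewrite everyE => /allP okb.
  by move: Zc; rewrite circsE => /orP[/okb|/okb]; rewrite ?swapK; case: ifP.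
rewrite /base_ok; rewrite gr_sub ?circs_wf2 // in s2; rewrite s2 anyE => /hasP[A Aanti sA].
right; exists (move_side (Hex a b c d x y) A); last first.
  rewrite -def_s; apply/relabel_complex_gr.
  exact: tri_sub_gr tT' sA T1.
move: Aanti; rewrite /= !inE => /orP[] /eqP -> /=; rewrite eqxx ?orbT //.
Qed.

Lemma pairing_exists T e : tri R T -> wf e -> exists k, T (gr (flag_side (flag_of e k))).
Proof.
move=> tT we; have [T1|[A Aanti TA]] := quad_pair tT (flag_ofP P1 we); first by exists P1.
have eq_anti : anti_sides (flag_of e P1) =
    [:: flag_side (flag_of e P2); flag_side (flag_of e P3)].
  by case: (e) we => [[] []].
by move: Aanti; rewrite eq_anti !inE => /orP[] /eqP eqA; [exists P2|exists P3]; rewrite -eqA.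
Qed.

Lemma partners_entry ks x y : size ks = 15 -> x != y ->
  get (get (partners_of ks) x) y =
  partner (flag_of (mk x y) (nth P1 ks (index (mk x y) edges))).
Proof.
case: ks => [|k1 [|k2 [|k3 [|k4 [|k5 [|k6 [|k7 [|k8 [|k9 [|k10 [|k11 [|k12 [|k13 [|k14
  [|k15 [|k16 ks]]]]]]]]]]]]]]]] // _.
case: x; case: y => neq; try (by case/eqP: neq); vm_compute;
  match goal with |- match ?k with _ => _ end = _ => by case: k end.
Qed.

Definition chosen (ks : path) (e : edge) : flag := flag_of e (nth P1 ks (index e edges)).

(** On each set of four labels exactly one pair belongs to [T], hence the table of
    partners decides. *)
Lemma sees_pair T ks s p : size ks = 15 -> s \in perms -> p \in perms -> tri R T ->
  T (gr (flag_side (chosen ks (mk (get s (get p V0)) (get s (get p V1)))))) ->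
  sees (partners_of ks) s p <-> T (gr (move_side s (flag_side p))).
Proof.
move=> sz sP pP tT; set q := hexfun (fun v => get s (get p v)).
have qP : q \in perms by apply: comp_perms.
rewrite move_flag_side -/q.
have seesE : sees (partners_of ks) s p =
    eqv (get (get (get (partners_of ks) (get q V0)) (get q V1)) (get q V2)) (get q V3).
  by rewrite !get_hexfun; case: (p).
have neq : get q V0 != get q V1 by rewrite (inj_eq (permsP q qP)).
rewrite seesE partners_entry // -!(get_hexfun (fun v => get s (get p v))) -/q /chosen.
clearbody q; clear seesE; set e := mk _ _; set k := nth _ _ _.
have := flags_ok; rewrite everyE => /allP/(_ q qP)/every_pairings/(_ k).
rewrite /flag_perm -/e; case: ifP => _ h Tk; split=> //.
  by move=> _; apply: tri_sub_gr h Tk.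
move: h; rewrite anyE => /hasP[A Aanti sA] Tq.
by case: (anti_conflict tT qP Aanti Tq); apply: tri_sub_gr sA Tk.
Qed.

Definition real_of (u : sgn) : R := match u with Neg => -1 | Zero => 0 | Pos => 1 end.
Definition vec_of (y : hex sgn) : 'rV[R]_6 := \row_i real_of (get y (vo i)).

Lemma ev_vec y e : wf e -> ev (vec_of y) (E e) = real_of (get y e.1) + real_of (get y e.2).
Proof.
move=> we; rewrite ev_pair ?mxE ?ovK //; case: e we => a b; rewrite /wf ltvE /= => lt_ab.
by rewrite -(inj_eq val_inj) neq_ltn lt_ab.
Qed.

(** The property [tri_extend] for functionals given by signs. *)
Lemma extend_side T A y : tri R T -> T (gr A) -> all wf A ->
  every (fun e => iszero (esgn y e)) A -> ~~ nilp (functional_of y).2 ->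
  exists2 e, e \in (functional_of y).2 & T (gr (e :: A)).
Proof.
move=> tT TA wA; rewrite everyE => /allP yA.
have negP e : e \in (functional_of y).2 <-> wf e /\ ev (vec_of y) (E e) < 0.
  rewrite mem_filter edges_wf; split=> [/andP[yn we]|[we]]; [split=> //|]; rewrite ev_vec //.
    by move: yn; rewrite /esgn; case: (get y e.1); case: (get y e.2) => //= _; lra.
  rewrite we andbT /esgn; case: (get y e.1); case: (get y e.2) => //=; lra.
case eq_neg: (functional_of y).2 => [//|f neg] _.
have /negP[wf_f lt_f] : f \in (functional_of y).2 by rewrite eq_neg mem_head.
have [e eA|_ [/KnP[e we ->] lt_e Te]] := tri_extend tT TA _ (E_Kn wf_f) lt_f.
  move: eA; rewrite inE => /mapP[g gA ->]; have wg : wf g by have /allP := wA; apply.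
  rewrite ev_vec //; have := yA g gA; rewrite /esgn.
  by case: (get y g.1); case: (get y g.2) => //= _; lra.
exists e; last by rewrite gr_cons.
by rewrite -eq_neg; apply/negP.
Qed.

Definition functionals_ok (ys : seq functional) :=
  List.Forall (fun f => f = functional_of f.1) ys.

Lemma first_two_filter p s : first_two p s = take 2 [seq e <- s | p e].
Proof.
elim: s => //= e s ->; case: ifP => // _; congr (_ :: _).
by elim: s => //= f s IHs; case: ifP => //= _; case: (seq.filter _ _).
Qed.

Lemma index_sidesE L e : wf e ->
  get (get (index_sides L) e.1) e.2 = [seq without e A | A <- L & has_edge A e].
Proof. by case: e => a b _; rewrite !get_hexfun. Qed.

Lemma allowed_sound T L A e : tri R T -> (forall B, B \in L -> ~ T (gr B)) -> wf e ->
  T (gr (e :: A)) -> allowed (index_sides L) A e.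
Proof.
move=> tT avL we TeA; rewrite /allowed index_sidesE // anyE; apply/hasPn => B.
move=> /mapP[B0]; rewrite mem_filter => /andP[_ B0L] ->.
apply/negP => /subP sB; apply: (avL B0 B0L); apply: tri_sub_gr TeA => //.
apply/subP => f fB; rewrite inE; case: eqVneq => //= neq; apply: sB.
by rewrite mem_filter fB eqeE eq_sym neq.
Qed.

Lemma scan_sound T L A ys v : tri R T -> (forall B, B \in L -> ~ T (gr B)) ->
  T (gr A) -> all wf A -> functionals_ok ys ->
  (if v is Forced e then wf e /\ T (gr (e :: A)) else v = Unknown) ->
  match scan (index_sides L) A ys v with
  | Refuted => False | Forced e => wf e /\ T (gr (e :: A)) | Unknown => True end.
Proof.
move=> tT avL TA wA; elim: ys v => [|[y neg] ys IHys] v ys_ok vP /=.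
  by case: v vP => // [[]].
inversion_clear ys_ok as [|? ? eq_neg ys_ok']; rewrite /= in eq_neg.
case: ifP => [|_]; last exact: IHys.
case: ifP => // yA ne; rewrite first_two_filter.
have [e e_neg Te] : exists2 e, e \in neg & T (gr (e :: A)).
  have -> : neg = (functional_of y).2 by rewrite -eq_neg.
  by apply: extend_side => //; rewrite -eq_neg.
have we : wf e.
  move: e_neg; have -> : neg = (functional_of y).2 by rewrite -eq_neg.
  by rewrite mem_filter edges_wf => /andP[].
have : e \in [seq f <- neg | allowed (index_sides L) A f].
  by rewrite mem_filter e_neg (allowed_sound tT avL we Te).
case: [seq f <- neg | _] => [//|f [|g s]]; rewrite /= ?take0; last by move=> _; apply: IHys.
rewrite inE => /eqP eq_ef; rewrite -eq_ef; apply: IHys => //.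
by case: v vP => // [[]].
Qed.

(** Each forced edge really belongs to a cell together with the edges already found. *)
Lemma refute_sound T L n A ys : tri R T -> (forall B, B \in L -> ~ T (gr B)) ->
  functionals_ok ys -> T (gr A) -> all wf A -> refute n (index_sides L) ys A -> False.
Proof.
move=> tT avL ys_ok; elim: n A => [|n IHn] A TA wA /=;
  have := scan_sound (v := Unknown) tT avL TA wA ys_ok erefl;
  case: (scan _ _ _ _) => // e [we Te]; apply: IHn => //=.
by rewrite we.
Qed.

End Semantics.

(** * Every triangulation has a listed choice of pairs *)
Local Open Scope classical_set_scope.
Local Open Scope nat_scope.

(** Encoding as an option, for decidable equality. *)
Definition option_of_pairing (k : pairing) : option bool :=
  match k with P1 => None | P2 => Some true | P3 => Some false end.
Definition pairing_of_option (o : option bool) : pairing :=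
  match o with None => P1 | Some true => P2 | Some false => P3 end.
Lemma option_of_pairingK : cancel option_of_pairing pairing_of_option.
Proof. by case. Qed.
HB.instance Definition _ := Equality.copy pairing (can_type option_of_pairingK).

Lemma eqpE k l : eqp k l = (k == l). Proof. by case: k; case: l. Qed.

Lemma pairingsE k : k \in pairings. Proof. by case: k. Qed.

Lemma wordsP (X : eqType) (l : seq X) n s :
  (s \in words l n) = (size s == n) && all (mem l) s.
Proof.
elim: n s => [|n IHn] s /=; first by case: s.
case: s => [|x s] /=.
  by apply/negP => /flattenP[_ /mapP[a _ ->] /mapP[]].
apply/flattenP/idP => [[_ /mapP[a al ->] /mapP[t tw [-> ->]]]|/and3P[sz xl al]].
  by move: tw; rewrite IHn => /andP[/eqP -> ->]; rewrite eqxx al.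
exists (map (cons x) (words l n)); first by apply/mapP; exists x.
by apply/mapP; exists s; rewrite // IHn -eqSS sz.
Qed.

Section Tries.
Variable X : eqType.
Implicit Types (l : seq (path * X)) (c : path * X).

Lemma mem_tails k l ks x : ((ks, x) \in tails k l) = ((k :: ks, x) \in l).
Proof.
rewrite /tails mem_pmap; apply/mapP/idP => [[[[|k' ks'] y] //= cl]|ksl].
  by rewrite eqpE; case: eqVneq cl => // -> cl [-> ->].
by exists (k :: ks, x) => //=; rewrite eqpE eqxx.
Qed.

Lemma child_trie n l k : child (trie_of n.+1 l) k = trie_of n (tails k l).
Proof. by case: l => [|c l]; [case: n|case: k]. Qed.

Lemma trie_node n l : l = [::] \/ trie_of n.+1 l =
  Node (trie_of n (tails P1 l)) (trie_of n (tails P2 l)) (trie_of n (tails P3 l)).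
Proof. by case: l; [left|right]. Qed.

(** Every initial segment of [ks] is in the trie. *)
Fixpoint alive (Y : Type) (t : trie Y) (ks : path) : bool :=
  ~~ isdead t && (if ks is k :: ks' then alive (child t k) ks' else true).

Lemma trie_alive n l ks x : (ks, x) \in l -> size ks = n -> alive (trie_of n l) ks.
Proof.
elim: n ks l => [|n IHn] [|k ks] l // ksl; first by case: l ksl.
move=> [sz]; rewrite /alive -/(@alive _) child_trie (IHn ks) ?mem_tails // andbT.
by case: l ksl.
Qed.

Lemma locate_sound m s es n l x : all (fun c => size c.1 == n) l ->
  locate m s es (trie_of n l) = Some x ->
  exists2 ks, (ks, x) \in l & all (sees m s) (pick_all es ks).
Proof.
elim: n es l => [|n IHn] es l szl.
  case: l szl => [|[ks y] l]; first by case: es.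
  move=> /= /andP[/eqP/size0nil -> _]; have -> : locate m s es (Leaf y) = Some y by case: es.
  by move=> [<-]; exists [::]; rewrite ?mem_head //; case: es.
case: (trie_node n l) => ->; first by case: es.
have sz_tails k : all (fun c => size c.1 == n) (tails k l).
  apply/allP => -[ks y]; rewrite mem_tails => /(allP szl).
  by [].
case: es => [|[[p1 p2] p3] es] //=.
case: ifP => [s1|_]; [|case: ifP => [s2|_]; [|case: ifP => [s3|//]]];
  move=> /IHn[] // ks; rewrite mem_tails => ksl al.
- by exists (P1 :: ks); rewrite //= s1.
- by exists (P2 :: ks); rewrite //= s2.
- by exists (P3 :: ks); rewrite //= s3.
Qed.

(** At most one branch is open at each node, so that the greedy descent finds the listed
    choice. *)
Lemma locate_complete m s es n l ks x : all (fun c => size c.1 == n) l ->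
  (forall t k k', t \in es -> sees m s (pick_of t k) -> sees m s (pick_of t k') -> k = k') ->
  (ks, x) \in l -> size es = n -> all (sees m s) (pick_all es ks) ->
  exists2 y, locate m s es (trie_of n l) = Some y & (ks, y) \in l.
Proof.
elim: n es l ks => [|n IHn] es l ks szl excl ksl sz_es al.
  have /eqP/size0nil/= eq0 := allP szl _ ksl; subst ks.
  case: l szl ksl => // -[ks y] l /= /andP[/eqP/size0nil -> _] _; exists y; first by case: es {sz_es excl al}.
  exact: mem_head.
have szks := allP szl _ ksl; rewrite /= in szks.
have sz_tails k : all (fun c => size c.1 == n) (tails k l).
  by apply/allP => -[ks' y]; rewrite mem_tails => /(allP szl).
case: es sz_es excl al => [|[[p1 p2] p3] es] // [sz_es] excl.
case: ks ksl szks => [|k ks] // ksl szks /andP[sk al].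
have [y eq_y ksy] := IHn es (tails k l) ks (sz_tails k)
  (fun t k1 k2 tes => excl t k1 k2 (mem_behead (s := _ :: es) tes)) (etrans (mem_tails _ _ _ _) ksl) sz_es al.
have only k' : sees m s (pick_of (p1, p2, p3) k') -> k' = k.
  by move=> sk'; apply: (excl (p1, p2, p3)); rewrite ?mem_head.
exists y; last by rewrite -mem_tails.
case: (trie_node n l) => [eq_l|->]; first by rewrite eq_l in ksl.
case: k {ksy ksl szks} sk only eq_y => /= sk only eq_y; first by rewrite sk.
  by case: ifP => [/(only P1)//|_]; rewrite sk.
by case: ifP => [/(only P1)//|_]; case: ifP => [/(only P2)//|_]; rewrite sk.
Qed.

End Tries.

(** The choices at the edges containing [v], in the order in which the search meets
    them. *)
Definition star_path (f : edge -> pairing) (v : vx) (es : seq edge) : path :=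
  [seq f e | e <- es & (e.1 == v) || (e.2 == v)].

(** The branch of the search that follows a given choice is never cut if all its stars
    are in the tries. *)
Lemma search_sound f test es ts acc : all wf es ->
  (forall v, alive (get ts v) (star_path f v es)) ->
  search test es ts acc -> test (rev acc ++ map f es).
Proof.
elim: es ts acc => [|e es IHes] ts acc; first by rewrite cats0.
move=> /andP[we wes] ts_alive.
have neq : e.1 != e.2 by move: we; case: (e) => a b; rewrite /wf /=; case: a; case: b.
move=> found; have := @every_pairings _ found (f e); rewrite /=.
have alive1 : alive (child (get ts e.1) (f e)) (star_path f e.1 es).
  by have := ts_alive e.1; rewrite /star_path /= eqxx /= => /andP[].
have alive2 : alive (child (get ts e.2) (f e)) (star_path f e.2 es).
  by have := ts_alive e.2; rewrite /star_path /= eqxx orbT /= => /andP[].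
have dead Y (t : trie Y) ks : alive t ks -> isdead t = false by case: ks => [|? ?]; case: t.
rewrite (dead _ _ _ alive1) (dead _ _ _ alive2) => /IHes -/(_ wes).
rewrite rev_cons cat_rcons; apply=> v; rewrite /set_trie !get_hexfun !eqvE.
case: eqVneq => [-> //|n2]; case: eqVneq => [-> //|n1].
by have := ts_alive v; rewrite /star_path /= [e.1 == v]eq_sym [e.2 == v]eq_sym (negbTE n1) (negbTE n2).
Qed.

Lemma pick_triples X (f : flag -> X) es ks :
  pick_all [seq (f (flag_of e P1), f (flag_of e P2), f (flag_of e P3)) | e <- es] ks =
  map f (flags_on es ks).
Proof. by elim: es ks => [|e es IHes] [|k ks] //=; rewrite IHes; case: k. Qed.

Lemma flags_onE es f : flags_on es (map f es) = [seq flag_of e (f e) | e <- es].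
Proof. by elim: es => //= e es ->. Qed.

Lemma paths_size : every (fun g => size (gpath g) == 15) groups.
Proof. vm_cast_no_check (erefl true). Qed.

Lemma search_okP :
  every (search_from star_trie (located (triples partner) (triples id) group_trie perms))
    start_paths.
Proof. vm_cast_no_check (erefl true). Qed.

Lemma stars_coveredP : stars_covered.
Proof. vm_cast_no_check (erefl true). Qed.

Lemma group_tableP ks i :
  reflect (i < size groups /\ ks = gpath (nth_group i)) ((ks, i) \in group_table).
Proof.
have sz : size group_table = size groups by rewrite size_zip size_map size_iota minnn.
have nthE j : j < size groups -> nth ([::], 0) group_table j = (gpath (nth_group j), j).
  by move=> lt_j; rewrite nth_zip ?size_map ?size_iota // (nth_map group0) // nth_iota.
apply: (iffP (nthP ([::], 0))) => [[j]|[lt_i ->]].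
  by rewrite sz => lt_j; rewrite nthE // => -[<- <-].
by exists i; rewrite ?sz ?nthE.
Qed.

Lemma group_path_size i : i < size groups -> size (gpath (nth_group i)) = 15.
Proof.
by move=> lt_i; have := paths_size; rewrite everyE => /(all_nthP group0)/(_ i lt_i)/eqP.
Qed.

Lemma group_table_size : all (fun c => size c.1 == 15) group_table.
Proof.
by apply/allP => -[ks i] /group_tableP[lt_i ->]; rewrite /= group_path_size.
Qed.

(** The first label is sent to [v] and the others are kept in order, so that pairings
    keep their names. *)
Definition star_perm (v : vx) : hex vx :=
  match [seq u <- vs | ~~ eqv u v] with
  | [:: a; b; c; d; e] => Hex v a b c d e
  | _ => Hex v v v v v v
  end.

Section Search.
Variable R : realType.
Implicit Types (T : complex 6).

Definition chosen_by T (f : edge -> pairing) : Prop :=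
  forall e, wf e -> T (gr (flag_side (flag_of e (f e)))).

Lemma pairing_uniq T e k k' : tri R T -> wf e -> T (gr (flag_side (flag_of e k))) ->
  T (gr (flag_side (flag_of e k'))) -> k = k'.
Proof.
move=> tT we Tk Tk'; case: (eqVneq k k') => // neq.
have Aanti : flag_side (flag_of e k') \in anti_sides (flag_of e k).
  by case: (e) we => [[] []] //; case: k k' neq {Tk Tk'} => [] [] //.
by case: (anti_conflict tT (flag_ofP k we) Aanti Tk Tk').
Qed.

Lemma chosen_exists T : tri R T -> exists f, chosen_by T f.
Proof.
move=> tT; have /choice[f fP] : forall e, exists k, wf e -> T (gr (flag_side (flag_of e k))).
  move=> e; case we: (wf e); last by exists P1.
  by have [k Tk] := pairing_exists tT we; exists k.
by exists f.
Qed.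

Lemma flag_side_wf q : q \in perms -> all wf (flag_side q).
Proof.
move=> /permsP inj_q; suff -> : flag_side q =
  [:: mk (get q V2) (get q V3); mk (get q V4) (get q V5)] by rewrite /= !mk_wf // (inj_eq inj_q).
by case: (q).
Qed.

Definition chosen_on T f (es : seq edge) := forall e, e \in es -> T (gr (flag_side (flag_of e (f e)))).

Lemma not_anti T f es A : tri R T -> chosen_on T f es -> all wf es ->
  A \in flatten (map anti_sides [seq flag_of e (f e) | e <- es]) -> ~ T (gr A).
Proof.
move=> tT Tf wes /flattenP[_ /mapP[_ /mapP[e ees ->] ->]] Aanti.
exact: (anti_conflict tT (flag_ofP _ (allP wes _ ees)) Aanti (Tf e ees)).
Qed.

Definition center_edges : seq edge := [seq (V0, u) | u <- [:: V1; V2; V3; V4; V5]].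

Lemma center_flags f : flags (map f center_edges) = [seq flag_of e (f e) | e <- center_edges].
Proof. by []. Qed.

Lemma star_functionals_ok : functionals_ok star_functionals.
Proof. by rewrite /star_functionals; elim: (seq.filter _ _) => [|e s IHs] /=; constructor. Qed.

(** A star occurring in a triangulation is not refuted. *)
Lemma star_valid_of T f : tri R T -> chosen_on T f center_edges ->
  star_valid (map f center_edges).
Proof.
move=> tT Tf; rewrite /star_valid anyE; apply/hasPn => q; rewrite center_flags => /mapP[e ee ->].
have we : wf e by move: e ee; apply/allP.
apply/negP; apply: (refute_sound tT _ star_functionals_ok (Tf e ee)).
  by move=> A; rewrite /antis center_flags; apply: not_anti tT Tf _.
exact/flag_side_wf/flag_ofP.
Qed.

Lemma star_perm_perms v : star_perm v \in perms.
Proof. by case: v; rewrite permsE. Qed.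

Lemma star_perm_side v e k : e \in center_edges ->
  move_side (star_perm v) (flag_side (flag_of e k)) =
  flag_side (flag_of (move_edge (star_perm v) e) k).
Proof.
by rewrite /center_edges !inE; do 4?case/orP; move=> /eqP ->; case: v; case: k.
Qed.

Lemma star_pathE f v : star_path f v edges = map (f \o move_edge (star_perm v)) center_edges.
Proof. by case: v. Qed.

Lemma star_valid_at T f v : tri R T -> chosen_by T f -> star_valid (star_path f v edges).
Proof.
move=> tT Tf; have [s def_s] := hexS_surj (star_perm_perms v).
rewrite star_pathE; apply: (star_valid_of (relabel_tri s^-1%g tT)) => e ee.
apply/relabel_complex_gr; rewrite def_s /= star_perm_side //; apply/Tf/move_edge_wf.
  exact: star_perm_perms.
by move: e ee; apply/allP.
Qed.

Lemma size_star_path f v : size (star_path f v edges) = 5.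
Proof. by rewrite star_pathE size_map. Qed.

Lemma star_word f v : star_path f v edges \in words pairings 5.
Proof. by rewrite wordsP size_star_path; apply/allP => k _; apply: pairingsE. Qed.

Lemma star_alive T f v : tri R T -> chosen_by T f -> alive star_trie (star_path f v edges).
Proof.
move=> tT Tf; apply: (@trie_alive _ _ _ _ tt); last exact: size_star_path.
apply: (map_f (fun ks => (ks, tt))); rewrite mem_filter star_word.
by rewrite (star_valid_at v tT Tf).
Qed.

Lemma start_found T : tri R T -> exists s k0 f, [/\ k0 \in start_paths,
  chosen_by (relabel_complex s T) f & star_path f V0 edges = k0].
Proof.
move=> tT; have [f Tf] := chosen_exists tT.
have := stars_coveredP; rewrite /stars_covered everyE => /allP/(_ (star_path f V0 edges)).
rewrite mem_filter star_word (star_valid_at V0 tT Tf) => /(_ isT).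
rewrite /star_covered anyE => /hasP[t tP]; case: ifP => //; rewrite eqvE => /eqP t0.
rewrite anyE => /hasP[k0 k0s]; rewrite everyE => /allP t_sees.
have [s def_s] := hexS_surj tP; exists s^-1%g, k0.
have tT' := relabel_tri s^-1%g tT; have [f' Tf'] := chosen_exists tT'.
exists f'; split=> //; have szk0 : size k0 = 5.
  by have /allP/(_ k0 k0s)/eqP : all (fun k => size k == 5) start_paths by [].
have eq_k0 : k0 = [seq nth P1 k0 (index e center_edges) | e <- center_edges].
  by case: k0 szk0 {k0s t_sees} => [|? [|? [|? [|? [|? []]]]]].
rewrite star_pathE [RHS]eq_k0; apply/eq_in_map => e ee.
have we : wf e by move: e ee; apply/allP.
have -> : (f' \o move_edge (star_perm V0)) e = f' e.
  by move: (ee); rewrite /center_edges !inE; do 4?case/orP; move=> /eqP ->.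
apply: (pairing_uniq tT' we (Tf' e we)).
apply/relabel_complex_gr; rewrite def_s.
set q := flag_of e _.
have qP : q \in perms by apply: flag_ofP.
have center_chosen e' : e' \in center_edges ->
    chosen (padded (star_path f V0 edges)) e' = flag_of e' (f e').
  by rewrite /center_edges !inE; do 4?case/orP; move=> /eqP ->.
apply/(sees_pair (ks := padded (star_path f V0 edges)) _ tP qP tT).
- by rewrite size_cat size_star_path.
- have qE : get q V0 = V0 /\ get q V1 = e.2.
    rewrite /q; move: (ee); rewrite /center_edges !inE; do 4?case/orP;
      move=> /eqP ->; by case: (nth _ _ _).
  rewrite qE.1 qE.2 t0.
  have e2 : V0 != e.2 by move: e ee {we q qP qE}; apply/allP.
  have : V0 != get t e.2 by rewrite -t0 (inj_eq (permsP t tP)).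
  case def_u: (get t e.2) => // [] _; rewrite center_chosen //; apply: Tf; exact: isT.
- apply: t_sees; rewrite {1}eq_k0 center_flags.
  by apply: (map_f (fun e => flag_of e (nth P1 k0 (index e center_edges)))).
Qed.

Lemma search_from_start k0 : k0 \in start_paths ->
  search_from star_trie (located (triples partner) (triples id) group_trie perms) k0.
Proof.
by have := search_okP; rewrite everyE => /allP; apply.
Qed.

Lemma search_from_sound f test st : (forall v, alive st (star_path f v edges)) ->
  search_from st test (star_path f V0 edges) -> test (map f edges).
Proof.
move=> st_alive; have wE : all wf edges by apply/allP => e; rewrite edges_wf.
apply: (search_sound (acc := [::]) wE) => v.
rewrite /set_trie !get_hexfun eqvE; case: eqVneq => [->|_]; last exact: st_alive.
by apply: (@trie_alive _ _ _ _ tt); [apply: mem_head|apply: size_star_path].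
Qed.

Lemma path_located T f : tri R T -> chosen_by T f -> star_path f V0 edges \in start_paths ->
  located (triples partner) (triples id) group_trie perms (map f edges).
Proof.
move=> tT Tf /search_from_start; apply: search_from_sound => v.
exact: star_alive tT Tf.
Qed.

Lemma located_sound l ks : all (fun c => size c.1 == 15) l ->
  located (triples partner) (triples id) (trie_of 15 l) perms ks ->
  exists t ks' i, [/\ t \in perms, (ks', i) \in l &
    all (sees (partners_of ks) t) (flags ks')].
Proof.
move=> szl; rewrite /located anyE => /hasP[t tP].
case eq_i: (locate _ _ _ _) => [i|] // _.
have [ks' ksi seen] := locate_sound szl eq_i.
exists t, ks', i; split=> //.
Qed.

Lemma located_group ks : located (triples partner) (triples id) group_trie perms ks ->
  exists t i, [/\ t \in perms, (i < size groups)%N &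
    all (sees (partners_of ks) t) (flags (gpath (nth_group i)))].
Proof.
move=> /(located_sound group_table_size)[t [ks' [i [tP /group_tableP[lt_i eq_ks] seen]]]].
exists t, i; split=> //; rewrite -eq_ks; exact: seen.
Qed.

Lemma all_flags (P : pred flag) es ks : all wf es ->
  (forall e k, wf e -> P (flag_of e k)) -> all P (flags_on es ks).
Proof.
move=> wes Pe; elim: es wes ks => [|e es IHes] wes [|k ks] //.
by case/andP: wes => we /IHes wes; apply/andP; split; [apply: Pe|apply: wes].
Qed.

Lemma edges_all_wf : all wf edges.
Proof. by apply/allP => e; rewrite edges_wf. Qed.

Lemma flags_perms ks q : q \in flags ks -> q \in perms.
Proof. exact/allP/(all_flags _ edges_all_wf)/flag_ofP. Qed.

Lemma chosen_map f e : wf e -> chosen (map f edges) e = flag_of e (f e).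
Proof.
rewrite -edges_wf /chosen => ee.
by rewrite (nth_map (V0, V0)) ?index_mem // nth_index.
Qed.

Lemma chosen_sees T f t q : tri R T -> chosen_by T f -> t \in perms -> q \in perms ->
  sees (partners_of (map f edges)) t q -> T (gr (move_side t (flag_side q))).
Proof.
move=> tT Tf tP qP; apply: (proj1 (sees_pair _ tP qP tT _)); first by rewrite size_map.
rewrite chosen_map; first apply: Tf; by rewrite mk_wf // !(inj_eq (permsP _ _)).
Qed.

(** The search, applied to the choices made by [T] after relabelling as in
    [start_found], ends in a listed choice. *)
Lemma group_found T : tri R T -> exists s i, i < size groups /\
  forall q, q \in flags (gpath (nth_group i)) -> relabel_complex s T (gr (flag_side q)).
Proof.
move=> tT; have [s [k0 [f [k0s Tf fk0]]]] := start_found tT.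
have tT' := relabel_tri s tT.
have := path_located tT' Tf; rewrite fk0 => /(_ k0s)/located_group[t [i [tP lt_i seen]]].
have [s' def_s'] := hexS_surj tP.
exists (s * s'^-1)%g, i; split=> // q qf; rewrite relabel_complexM.
apply/relabel_complex_gr; rewrite def_s'.
by apply: (chosen_sees tT' Tf tP (flags_perms qf)); apply: (allP seen).
Qed.
End Search.

(** * The listed triangulations of a group *)
Local Open Scope classical_set_scope.
Local Open Scope ring_scope.

(** Encoding as a tuple, for decidable equality. *)
Definition tuple_of_irregular r :=
  (near_heights r, flip_circuit r, choice_sides r, certificate r).
Definition irregular_of_tuple t := let: (hs, ib, bs, zs) := t in Irregular hs ib bs zs.
Lemma tuple_of_irregularK : cancel tuple_of_irregular irregular_of_tuple.
Proof. by case. Qed.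
HB.instance Definition _ := Equality.copy irregular (can_type tuple_of_irregularK).

Lemma groups_okP : groups_ok.
Proof. vm_cast_no_check (erefl true). Qed.

Lemma cut_functionals_ok : functionals_ok cut_functionals.
Proof.
rewrite /functionals_ok /cut_functionals; elim: vs => [|a s IHs]; last by constructor.
by elim: (seq.filter _ _) => [|t s IHs]; constructor.
Qed.

Lemma meetsP L A : reflect (exists2 B, B \in L & sub B A) (meets L A).
Proof. by rewrite /meets anyE; apply: hasP. Qed.

(** The table stores sides without the edge they are filed under. *)
Lemma table_meets_sound L A : all wf A -> table_meets (index_sides L) A -> meets L A.
Proof.
move=> wA; rewrite /table_meets anyE => /hasP[e eA]; rewrite index_sidesE ?(allP wA) // anyE.
case/hasP=> B' /mapP[B]; rewrite mem_filter => /andP[_ BL] -> sB; apply/meetsP; exists B => //.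
apply/subP => f fB; have [->//|neq] := eqVneq f e.
by move/subP: sB; apply; rewrite mem_filter fB eqeE eq_sym neq.
Qed.

Lemma anti_wf q A : q \in perms -> A \in anti_sides q -> all wf A.
Proof.
move=> qP /(conflict_circuit qP)[Z Zc [_ /perm_all <-]].
exact: circs_wf2.
Qed.

Lemma half_circs_sub : {subset half_circs <= circs}.
Proof. by move=> Z Zc; rewrite circsE Zc. Qed.

(** Properties invariant under reversing circuits need only be shown for one
    orientation. *)
Lemma circuit_split (P : circuit -> Prop) Z : (forall Y, P (swap Y) -> P Y) ->
  (forall Y, Y \in half_circs -> P Y) -> Z \in circs -> P Z.
Proof. by move=> sP cP; rewrite circsE => /orP[/cP //|/cP]; apply: sP. Qed.

Lemma chosen_flags ks e : size ks = 15 -> wf e -> chosen ks e \in flags ks.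
Proof.
move=> sz we; have {2}-> : ks = [seq nth P1 ks (index f edges) | f <- edges].
  apply: (@eq_from_nth _ P1) => [|j]; rewrite ?size_map ?sz // => lt_j.
  by rewrite (nth_map (V0, V0)) // index_uniq.
rewrite /flags flags_onE; apply: (map_f (fun f => flag_of f _)).
by rewrite edges_wf.
Qed.

Section Reps.
Variables (R : realType) (i : nat).
Hypothesis lt_i : (i < size groups)%N.
Let g := nth_group i.
Let fs := flags (gpath g).
Let an := antis (gpath g).
Let us := undecided half_circs (index_sides an).

Lemma group_okP : group_ok half_circs perms g.
Proof.
have := groups_okP; rewrite /groups_ok everyE => /(all_nthP group0)/(_ i lt_i).
by [].
Qed.

Lemma antisP A : reflect (exists2 q, q \in fs & A \in anti_sides q) (A \in an).
Proof.
apply: (iffP flattenP) => [[_ /mapP[q qf ->] Aq]|[q qf Aq]]; first by exists q.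
by exists (anti_sides q); rewrite // map_f.
Qed.

Lemma antis_wf A : A \in an -> all wf A.
Proof. by move=> /antisP[q /flags_perms qP]; apply: anti_wf. Qed.

Lemma us_half_circs Z : Z \in us -> Z \in half_circs.
Proof. by rewrite mem_filter => /andP[]. Qed.

Lemma decided Z : Z \in half_circs -> Z \in us \/ meets an Z.1 \/ meets an Z.2.
Proof.
move=> Zc; rewrite mem_filter Zc andbT; case: ifP => [h|_].
  right; left; apply: table_meets_sound h; exact/circs_wf1/half_circs_sub.
case: (boolP (table_meets _ Z.2)) => h; last by left.
by right; right; apply: table_meets_sound h; apply/circs_wf2/half_circs_sub.
Qed.

Lemma rep_transversal (r : seq side) : (forall Z, Z \in us -> Z.1 \in r \/ Z.2 \in r) ->
  transversal (an ++ r).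
Proof.
move=> rP Z; apply: (@circuit_split (fun Z => exists2 A, A \in an ++ r & sub A Z.1 \/ sub A Z.2)).
  by move=> Y [A AL [sA|sA]]; exists A => //; [right|left].
move=> Y /decided[/rP[Yr|Yr]|[/meetsP[A AL sA]|/meetsP[A AL sA]]].
- by exists Y.1; [rewrite mem_cat Yr orbT|left; apply/subP].
- by exists Y.2; [rewrite mem_cat Yr orbT|right; apply/subP].
- by exists A; [rewrite mem_cat AL|left].
- by exists A; [rewrite mem_cat AL|right].
Qed.

Lemma wt_perm (h : {set 'I_6} -> R) A B : perm_eq A B -> wt h A = wt h B.
Proof. by move=> eqAB; apply: perm_big. Qed.

Lemma loserP m Z : weight m Z.1 <> weight m Z.2 -> Z \in circs ->
  exists2 Y, Y \in circs & sub Y.1 (loser m Z) /\ wt (heights R m) Y.1 < wt (heights R m) Y.2.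
Proof.
move=> neq Zc; rewrite /loser; case: ltnP => [lt12|le21].
  exists Z => //; split; first exact/subP.
  by rewrite !wt_heights ?circs_wf1 ?circs_wf2 // ltr_nat.
exists (swap Z); first exact: swap_circs.
split; first exact/subP.
rewrite !wt_heights ?circs_wf1 ?circs_wf2 ?swap_circs // ltr_nat ltn_neqAle le21 andbT.
by apply/eqP => /esym.
Qed.

(** All forbidden sides are strictly lower than the opposite sides: the excluded pairs
    by [favours], the others by the choice of the loser. *)
Lemma regular_rep_tri hs : regular_ok fs us hs ->
  let L := an ++ regular_sides us hs in
  tri R (avoid L) /\ induced (heights R (table_of hs)) = avoid L.
Proof.
rewrite /regular_ok /decides; set m := table_of hs; rewrite !everyE => /andP[/allP favP /allP decP].
set L := an ++ _.
have trL : transversal L.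
  apply: rep_transversal => Z Zu; have : loser m Z \in regular_sides us hs by apply: map_f.
  by rewrite /loser; case: ifP; [left|right].
have loseL : losing (heights R m) L.
  move=> A; rewrite mem_cat => /orP[/antisP[q qf Aq]|/mapP[Z Zu ->]].
    have [Z Zc [p1 p2]] := conflict_circuit (flags_perms qf) Aq.
    exists (swap Z); first exact: swap_circs.
    split; first by apply/subP => e; rewrite /= (perm_mem p2).
    have := favP q qf; rewrite /favours everyE => /allP/(_ A Aq) lt_A.
    rewrite /= (wt_perm _ p1) (wt_perm _ p2) !wt_heights ?ltr_nat //.
      exact: flag_side_wf (flags_perms qf).
    by apply: antis_wf; apply/antisP; exists q.
  apply: loserP; last exact/half_circs_sub/us_half_circs.
  by have := decP Z Zu; rewrite eqnE => /eqP.
by split; [apply: losing_tri loseL trL|apply: losing_induced loseL trL].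
Qed.

Lemma choose_sidesP bs : size bs = size us -> forall Z, Z \in us ->
  Z.1 \in choose_sides us bs \/ Z.2 \in choose_sides us bs.
Proof.
elim: us bs => // Y vs' IHv [|b bs] //= [sz] Z; rewrite inE => /predU1P[->|Zv].
  by rewrite !inE /choose_side; case: b; rewrite eqxx; [right|left].
by rewrite !inE; case: (IHv bs sz Z Zv) => ->; rewrite orbT; [left|right].
Qed.

Lemma choose_sides_wf bs A : A \in choose_sides us bs -> all wf A.
Proof.
have uc : {subset us <= circs} by move=> Z /us_half_circs/half_circs_sub.
elim: us bs uc => [|Y vs' IHv] [|b bs] //= uc; rewrite inE => /predU1P[->|]; last first.
  by apply: IHv => Z Zv; apply: uc; rewrite inE Zv orbT.
by rewrite /choose_side; case: b; [apply: circs_wf2|apply: circs_wf1]; apply: uc; rewrite mem_head.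
Qed.

Lemma oriented_circs ib : (ib.1 < size half_circs)%N -> oriented half_circs ib \in circs.
Proof.
move=> lt; rewrite /oriented; have Zc := half_circs_sub (mem_nth ([::], [::]) lt).
by case: ifP => _ //; apply: swap_circs.
Qed.

(** Summing the strict inequalities over the circuits compares a number with itself. *)
Lemma certified_irregular L zs : {subset zs <= circs} -> (forall A, A \in L -> all wf A) ->
  certified L zs -> forall h : {set 'I_6} -> R, induced h <> avoid L.
Proof.
move=> zc wfL; rewrite /certified !everyE; case: ifP => // ne.
move: ne; case: ifP => // ne /allP avZ /allP eq_cnt h eq_h.
have lt_wt Z : Z \in zs -> wt h Z.1 < wt h Z.2.
  move=> Zzs; have Zc := zc Z Zzs; have KZ := gr_Kn (circs_wf2 Zc).
  have : avoid L (gr Z.2).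
    split=> // A AL; rewrite gr_sub ?circs_wf2 ?wfL //.
    by apply: contra (avZ Z Zzs) => sA; apply/meetsP; exists A.
  rewrite -eq_h => /(inducedP h KZ)/(_ Z Zc (fintype.subxx _))[//|[_]].
  rewrite gr_sub ?circs_wf1 ?circs_wf2 // => /subP s12.
  have [e e1] := circs_neq0 Zc.
  by have := circs_disj Zc e1; rewrite s12.
have wt_flatten p : wt h (flatten (map p zs)) = \sum_(Z <- zs) wt h (p Z).
  by rewrite /wt big_flatten big_map.
have perm12 : perm_eq (flatten (map fst zs)) (flatten (map snd zs)).
  apply/allP => e e12; have we : wf e.
    move: e12; rewrite mem_cat => /orP[] /flattenP[_ /mapP[Z /zc Zc ->]].
      exact/allP/circs_wf1.
    exact/allP/circs_wf2.
  have := eq_cnt e; rewrite edges_wf => /(_ we).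
  have cntE A : edge_count e A = count_mem e A.
    by apply: eq_count => f; rewrite eqeE eq_sym.
  by rewrite !cntE.
have := wt_perm h perm12; rewrite !wt_flatten.
suff : \sum_(Z <- zs) wt h Z.1 < \sum_(Z <- zs) wt h Z.2 by move=> /[swap] ->; rewrite ltxx.
case: zs ne zc avZ eq_cnt lt_wt {wt_flatten perm12} => // Z zs _ _ _ _ lt_wt.
rewrite !big_cons ltr_leD ?lt_wt ?mem_head // big_seq [leRHS]big_seq.
by apply: ler_sum => Y Yzs; apply/ltW/lt_wt; rewrite inE Yzs orbT.
Qed.

(** Coverage is inherited, by a flip, from the complex that the nearby heights define.
    *)
Lemma irregular_rep_tri r : irregular_ok half_circs an us r ->
  let L := an ++ irregular_sides us r in
  tri R (avoid L) /\ forall h : {set 'I_6} -> R, induced h <> avoid L.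
Proof.
rewrite /irregular_ok; set L := an ++ _; case: ifP => //; case: ifP => //; case: ifP => //.
rewrite eqnE => /eqP sz okF okZ cert /=.
move: okZ; rewrite everyE /= => /andP[/oriented_circs Fc /allP Zs].
have wfL A : A \in L -> all wf A.
  by rewrite mem_cat => /orP[/antis_wf //|]; apply: choose_sides_wf.
have trL : transversal L by apply: rep_transversal; apply: choose_sidesP.
split; last first.
  apply: certified_irregular wfL cert => _ /mapP[ib /Zs lt_ib ->].
  exact: oriented_circs.
apply: (avoid_tri trL); apply: (flip_covering wfL Fc okF).
apply: (losing_covering (h := heights R (table_of (near_heights r)))).
move=> A /mapP[Z]; rewrite mem_filter eqnE => /andP[/eqP neq Zc] ->.
exact: loserP neq (half_circs_sub Zc).
Qed.

Let m := partners_of (gpath g).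
Let stab := [seq s <- perms | every (sees m s) fs].

Lemma group_okE : [/\ all (regular_ok fs us) (gregular g),
  all (irregular_ok half_circs an us) (girregular g) &
  exhausted (fun Ls => matched (group_reps us g) stab Ls |||
                       refuted (map flag_side fs) (an ++ Ls)) us [::]].
Proof.
have := group_okP; rewrite /group_ok -!everyE => /andP[/andP[okR okI] ex].
by split; [exact: okR|exact: okI|exact: ex].
Qed.

Lemma group_sees T s p : tri R T -> (forall q, q \in fs -> T (gr (flag_side q))) ->
  s \in perms -> p \in perms -> sees m s p <-> T (gr (move_side s (flag_side p))).
Proof.
move=> tT Tf sP pP; apply: (sees_pair _ sP pP tT); first exact: group_path_size.
apply: Tf; apply: chosen_flags; first exact: group_path_size.
by rewrite mk_wf // !(inj_eq (permsP _ _)).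
Qed.

Lemma rep_flags r q : tri R (avoid (an ++ r)) -> q \in fs ->
  avoid (an ++ r) (gr (flag_side q)).
Proof.
move=> tL qf; have [//|[A Aq [_ avA]]] := quad_pair tL (flags_perms qf).
have /avA : A \in an ++ r by rewrite mem_cat; apply/orP; left; apply/antisP; exists q.
by rewrite fintype.subxx.
Qed.

Lemma group_rep_tri r : r \in group_reps us g -> tri R (avoid (an ++ r)).
Proof.
have [/allP okR /allP okI _] := group_okE; rewrite mem_cat => /orP[] /mapP[x xg ->].
  by case: (regular_rep_tri (okR x xg)).
by case: (irregular_rep_tri (okI x xg)).
Qed.

(** At each circuit the branch forbidding a side that satisfies [P] is followed. *)
Lemma exhausted_sound (P : side -> Prop) test Zs Ls :
  (forall Z, Z \in Zs -> P Z.1 \/ P Z.2) -> (forall A, A \in Ls -> P A) ->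
  exhausted test Zs Ls -> exists Ks, [/\ test Ks, forall A, A \in Ks -> P A &
    (forall Z, Z \in Zs -> Z.1 \in Ks \/ Z.2 \in Ks) /\ {subset Ls <= Ks}].
Proof.
elim: Zs Ls => [|Z Zs IHZ] Ls PZ; first by move=> PL tL; exists Ls; split=> //; split.
move=> PL.
move=> /=; case: ifP => // ex1 ex2.
have PZs Y : Y \in Zs -> P Y.1 \/ P Y.2 by move=> Ys; apply: PZ; rewrite inE Ys orbT.
case: (PZ Z (mem_head _ _)) => PA.
  have [|Ks [tK PK [ZK LK]]] := IHZ (Z.1 :: Ls) PZs _ ex1.
    by move=> A; rewrite inE => /predU1P[-> //|/PL].
  exists Ks; split=> //; split=> [Y|A AL]; last by rewrite LK // inE AL orbT.
  by rewrite inE => /predU1P[->|/ZK //]; left; rewrite LK ?mem_head.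
have [|Ks [tK PK [ZK LK]]] := IHZ (Z.2 :: Ls) PZs _ ex2.
  by move=> A; rewrite inE => /predU1P[-> //|/PL].
exists Ks; split=> //; split=> [Y|A AL]; last by rewrite LK // inE AL orbT.
by rewrite inE => /predU1P[->|/ZK //]; right; rewrite LK ?mem_head.
Qed.

(** In [T] each undecided circuit has a side that is not a cell. These sides are matched
    by a representative, and then no circuit distinguishes [T] from the relabelled
    representative: a decided circuit contains an excluded pair, and both contain the
    same pairs. *)
Lemma group_rep_found T : tri R T -> (forall q, q \in fs -> T (gr (flag_side q))) ->
  exists2 r, r \in group_reps us g & exists s, T = relabel_complex s (avoid (an ++ r)).
Proof.
move=> tT Tf; have not_an A : A \in an -> ~ T (gr A).
  by move=> /antisP[q qf Aq]; apply: anti_conflict tT (flags_perms qf) Aq (Tf q qf).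
have [_ _ ex] := group_okE.
have [|//|Ks [test notK [ZK _]]] := exhausted_sound (P := fun A => ~ T (gr A)) _ _ ex.
  move=> Z /us_half_circs/half_circs_sub Zc; have [T1|T1] := pselect (T (gr Z.1)); last by left.
  by right=> T2; apply: tri_circ tT Zc T1 T2.
have not_refuted : refuted (map flag_side fs) (an ++ Ks) = false.
  apply/negP; rewrite /refuted anyE => /hasP[_ /mapP[q qf ->]].
  apply: (refute_sound tT _ cut_functionals_ok (Tf q qf)); last exact/flag_side_wf/flags_perms/qf.
  by move=> A; rewrite mem_cat => /orP[/not_an|/notK].
move: test; case: ifP => [mt _|_]; last by rewrite not_refuted.
move: mt; rewrite /matched anyE => /hasP[r rr]; rewrite anyE => /hasP[s].
rewrite mem_filter everyE => /andP[/allP s_sees sP]; rewrite everyE => /allP s_meets.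
exists r => //; have [t def_t] := hexS_surj sP; exists t^-1%g.
have tL := group_rep_tri rr; have tT' := relabel_tri t^-1%g tL.
set L := an ++ r; set T' := relabel_complex _ _.
have T'f q : q \in fs -> T' (gr (flag_side q)).
  move=> qf; apply/relabel_complex_gr; rewrite def_t.
  apply: (proj1 (group_sees tL _ sP (flags_perms qf))); last exact: s_sees.
  by move=> p; apply: rep_flags.
have not_an' A : A \in an -> ~ T' (gr A).
  by move=> /antisP[q qf Aq]; apply: anti_conflict tT' (flags_perms qf) Aq (T'f q qf).
have notK' A : A \in Ks -> ~ T' (gr A).
  move=> AK /relabel_complex_gr[_ avA]; move: (s_meets A AK) => /meetsP[B Br sB].
  have /avA : B \in L by rewrite mem_cat Br orbT.
  by rewrite def_t (sub_gr sB (fintype.subxx _)).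
apply: (tri_eq tT tT') => Z Zc.
pose P (Y : circuit) := (T (gr Y.1) -> T' (gr Y.2) -> False) /\
                        (T (gr Y.2) -> T' (gr Y.1) -> False).
suff : P Z by case.
apply: circuit_split Zc => [Y [P1 P2]|Y /decided]; first by split.
have meet_an A U : tri R U -> (forall B, B \in an -> ~ U (gr B)) -> meets an A -> U (gr A) -> False.
  move=> tU nU /meetsP[B Ban sB] UA; apply: (nU B Ban); exact: tri_sub_gr tU sB UA.
case=> [/ZK[YK|YK]|[mY|mY]]; split=> T1 T2.
- exact: notK YK T1.
- exact: notK' YK T2.
- exact: notK' YK T2.
- exact: notK YK T1.
- exact: meet_an tT not_an mY T1.
- exact: meet_an tT' not_an' mY T2.
- exact: meet_an tT' not_an' mY T2.
- exact: meet_an tT not_an mY T1.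
Qed.

End Reps.

(** * Listed triangulations are inequivalent *)
Local Open Scope nat_scope.
Local Open Scope classical_set_scope.

Lemma groups_locatedP : groups_located (triples id) group_trie.
Proof. vm_cast_no_check (erefl true). Qed.

Lemma groups_apartP : groups_apart half_circs (triples id) group_trie.
Proof. vm_cast_no_check (erefl true). Qed.

Lemma regular_orbit_sizes : orbit_sizes (regular_reps half_circs) (iota 0 (size groups)) = 194160%num.
Proof. vm_cast_no_check (erefl 194160%num). Qed.

Lemma irregular_orbit_sizes : orbit_sizes (irregular_reps half_circs) (iota 0 (size groups)) = 3840%num.
Proof. vm_cast_no_check (erefl 3840%num). Qed.

Lemma regular_rep_count : size (rep_lists (regular_reps half_circs)) = 339.
Proof. vm_cast_no_check (erefl 339). Qed.

Lemma irregular_rep_count : size (rep_lists (irregular_reps half_circs)) = 14.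
Proof. vm_cast_no_check (erefl 14). Qed.

Section Apart.
Variable R : realType.
Implicit Types (L : seq side) (T : complex 6) (i j : nat).

Lemma group_listsP i L : reflect (exists2 r, 
  r \in group_reps (undecided half_circs (index_sides (antis (gpath (nth_group i))))) (nth_group i) &
  L = antis (gpath (nth_group i)) ++ r) (L \in group_lists half_circs i).
Proof.
have -> : group_lists half_circs i = map (cat (antis (gpath (nth_group i))))
    (group_reps (undecided half_circs (index_sides (antis (gpath (nth_group i))))) (nth_group i)).
  by rewrite /group_lists /group_reps map_cat -!map_comp.
exact: mapP.
Qed.

Lemma group_lists_tri i L : i < size groups -> L \in group_lists half_circs i -> tri R (avoid L).
Proof. by move=> lt_i /group_listsP[r rr ->]; apply: group_rep_tri. Qed.

Lemma group_lists_flags i L q : i < size groups -> L \in group_lists half_circs i ->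
  q \in flags (gpath (nth_group i)) -> avoid L (gr (flag_side q)).
Proof.
move=> lt_i LL; have tL := group_lists_tri lt_i LL.
by move: LL tL => /group_listsP[r rr ->] tL; apply: (rep_flags tL).
Qed.

Lemma group_lists_wf i L A : i < size groups -> L \in group_lists half_circs i -> A \in L -> all wf A.
Proof.
move=> lt_i /group_listsP[r + ->]; rewrite !mem_cat => rr /orP[/antis_wf //|Ar].
move: rr => /orP[] /mapP[x _ eq_r]; move: Ar; rewrite eq_r.
  move=> /mapP[Z /us_half_circs/half_circs_sub Zc ->]; rewrite /loser.
  by case: ifP => _; [apply: circs_wf1|apply: circs_wf2].
exact: choose_sides_wf.
Qed.

Lemma regular_list i L : i < size groups -> L \in regular_reps half_circs (nth_group i) ->
  exists h : {set 'I_6} -> R, induced h = avoid L.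
Proof.
move=> lt_i /mapP[hs hsg ->]; have [/allP/(_ hs hsg) ok _ _] := group_okE lt_i.
by exists (heights R (table_of hs)); apply: (regular_rep_tri R ok).2.
Qed.

Lemma irregular_list i L : i < size groups -> L \in irregular_reps half_circs (nth_group i) ->
  forall h : {set 'I_6} -> R, induced h <> avoid L.
Proof.
move=> lt_i /mapP[r rg ->]; have [_ /allP/(_ r rg) ok _] := group_okE lt_i.
by have [_ nr] := irregular_rep_tri R ok; apply: nr.
Qed.

(** A triangulation is not properly contained in another one. *)
Lemma tri_le_eq T T' : tri R T -> tri R T' -> T `<=` T' -> T = T'.
Proof.
by move=> tT tT' sT; apply: (tri_eq tT tT') => Z Zc /sT T1 T2; apply: (tri_circ tT' Zc).
Qed.

Lemma maps_toP i j L L' (s : 'S_6) : i < size groups -> j < size groups ->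
  L \in group_lists half_circs i -> L' \in group_lists half_circs j ->
  reflect (relabel_complex s (avoid L) = avoid L') (maps_to L L' (hexS s)).
Proof.
move=> lt_i lt_j LL LL'; have tL := group_lists_tri lt_i LL.
have tL' := group_lists_tri lt_j LL'; have tsL := relabel_tri s tL.
have wfL := @group_lists_wf i L _ lt_i LL; have wfL' := @group_lists_wf j L' _ lt_j LL'.
rewrite /maps_to everyE; apply: (iffP allP) => [sL|eqL A AL].
  apply/esym; apply: tri_le_eq tL' tsL _ => G [sG avG]; apply/relabel_complexE.
  split; first by rewrite relabel_Kn.
  move=> A AL; apply/negP => sA; have /meetsP[B BL' sB] := sL A AL.
  have /negP := avG B BL'; apply; apply: (sub_gr sB).
  by rewrite -relabel_gr -(relabel_graphVK s G) relabel_subset.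
have wpA : all wf (move_side (hexS s) A) by apply: move_side_wf; [apply: hexS_perms|apply: wfL].
apply/negPn/negP => /meetsP nB.
have : avoid L' (gr (move_side (hexS s) A)).
  split; first exact: gr_Kn.
  by move=> B BL'; rewrite gr_sub // ?(wfL' B) //; apply/negP => sB; apply: nB; exists B.
rewrite -eqL -relabel_gr => /relabel_complexE; rewrite relabel_graphK => -[_ /(_ A AL)].
by rewrite fintype.subxx.
Qed.

Lemma group_sees_list i L s p : i < size groups -> L \in group_lists half_circs i ->
  s \in perms -> p \in perms ->
  sees (partners_of (gpath (nth_group i))) s p <-> avoid L (gr (move_side s (flag_side p))).
Proof.
move=> lt_i LL sP pP; apply: (group_sees lt_i (group_lists_tri lt_i LL)) => // q.
exact: group_lists_flags.
Qed.

Lemma locate_list i j L L' (s : 'S_6) : i < size groups -> j < size groups ->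
  L \in group_lists half_circs i -> L' \in group_lists half_circs j ->
  relabel_complex s (avoid L') = avoid L ->
  exists2 y, locate (partners_of (gpath (nth_group i))) (hexS s) (triples id) group_trie = Some y &
    gpath (nth_group y) = gpath (nth_group j).
Proof.
move=> lt_i lt_j LL LL' eqL; have sP := hexS_perms s.
have tL' := group_lists_tri lt_j LL'.
have seesE p : p \in perms -> sees (partners_of (gpath (nth_group i))) (hexS s) p <->
    avoid L' (gr (flag_side p)).
  move=> pP; apply: (iff_trans (group_sees_list lt_i LL sP pP)).
  rewrite -eqL -relabel_gr; apply: (iff_trans (relabel_complexE _ _ _)).
  by rewrite relabel_graphK.
have [||||y eq_y /group_tableP[_ eq_path]] := @locate_complete _ (partners_of (gpath (nth_group i)))
    (hexS s) (triples id) 15 group_table (gpath (nth_group j)) j group_table_size.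
- move=> t k k' /mapP[e ee ->] s1 s2.
  have we : wf e by rewrite -edges_wf.
  apply: (pairing_uniq tL' we); apply/seesE; do ?exact: flag_ofP.
    by case: (k) s1.
  by case: (k') s2.
- by apply/group_tableP.
- by rewrite size_map.
- rewrite pick_triples map_id; apply/allP => q qf; apply/(seesE q (flags_perms qf)).
  exact: group_lists_flags qf.
by exists y.
Qed.

Lemma group_apartE i : i < size groups ->
  located_only (triples id) group_trie (partners_of (gpath (nth_group i))) i /\
  all_apart (located_perms (triples id) group_trie (partners_of (gpath (nth_group i))))
    (group_lists half_circs i).
Proof.
move=> lt_i; have ii : i \in iota 0 (size groups) by rewrite mem_iota.
have := groups_locatedP; rewrite /groups_located everyE => /allP/(_ i ii) loc.
have := groups_apartP; rewrite /groups_apart everyE => /allP/(_ i ii) ap.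
by split.
Qed.

Lemma located_onlyP fs gt m i s j : located_only fs gt m i -> s \in perms ->
  locate m s fs gt = Some j -> i = j.
Proof.
rewrite /located_only everyE => /allP loc sP eq_j.
by have := loc s sP; rewrite eq_j eqnE => /eqP.
Qed.

(** In the choice of the first representative, the relabelling locates the choice of the
    second one, whereas only its own position is located. *)
Lemma same_group i j L L' (s : 'S_6) : i < size groups -> j < size groups ->
  L \in group_lists half_circs i -> L' \in group_lists half_circs j ->
  relabel_complex s (avoid L') = avoid L ->
  i = j.
Proof.
move=> lt_i lt_j LL LL' eqL; have [y eq_y eq_path] := locate_list lt_i lt_j LL LL' eqL.
have [loc_i _] := group_apartE lt_i; have [loc_j _] := group_apartE lt_j.
have eq_iy := located_onlyP loc_i (hexS_perms s) eq_y.
rewrite -eq_iy in eq_path; rewrite eq_path in eq_y.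
by rewrite (located_onlyP loc_j (hexS_perms s) eq_y).
Qed.

Lemma all_apart_nth ss Ls a b : all_apart ss Ls -> a < b < size Ls ->
  apart ss (nth [::] Ls a) (nth [::] Ls b).
Proof.
elim: Ls a b => [|L Ls IHL] a b; first by rewrite andbF.
rewrite /= everyE; case: ifP => // /allP apL apLs; case: b => // b; case: a => [|a] /andP[lt_ab lt_b].
  exact: (apL _ (mem_nth _ lt_b)).
by apply: (IHL a b apLs); apply/andP; split.
Qed.

(** A permutation between two representatives with the same choice preserves the choice,
    and none of those maps the forbidden sides suitably. *)
Lemma lists_inequivalent i a b (s : 'S_6) : i < size groups -> a < b < size (group_lists half_circs i) ->
  relabel_complex s (avoid (nth [::] (group_lists half_circs i) a)) <>
  avoid (nth [::] (group_lists half_circs i) b).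
Proof.
move=> lt_i lt_ab eqL; have /andP[lt1 lt_b] := lt_ab; have lt_a := ltn_trans lt1 lt_b.
have [_ /(all_apart_nth)/(_ lt_ab)] := group_apartE lt_i.
have [y eq_y _] := locate_list lt_i lt_i (mem_nth _ lt_b) (mem_nth _ lt_a) eqL.
have sloc : hexS s \in located_perms (triples id) group_trie (partners_of (gpath (nth_group i))).
  by rewrite mem_filter hexS_perms eq_y.
rewrite /apart anyE => /hasPn/(_ _ sloc)/negP; apply; apply/(maps_toP s lt_i lt_i) => //; exact: mem_nth.
Qed.

End Apart.

(** * Counting orbits *)

(** Complexes as elements of a finite type, to make the theory of actions of finite
    groups available. *)
Notation fin_complex := {set graph 6}.

Definition fin (T : complex 6) : fin_complex := [set G | `[< T G >]]%SET.
Definition unfin (x : fin_complex) : complex 6 := [set G | G \in x].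

Lemma finK : cancel fin unfin.
Proof.
move=> T; apply/seteqP; split=> G; rewrite /unfin /= inE; first by move/asboolP.
by move=> TG; apply/asboolP.
Qed.

Lemma unfinK : cancel unfin fin.
Proof. by move=> x; apply/finset.setP => G; rewrite inE; apply/asboolP/idP. Qed.

Definition relabel_fin (x : fin_complex) (s : 'S_6) : fin_complex :=
  fin (relabel_complex s (unfin x)).

Lemma relabel_fin_morph x : act_morph relabel_fin x.
Proof. by move=> s t; rewrite /relabel_fin finK relabel_complexM. Qed.

Lemma relabel_fin1 : relabel_fin^~ 1%g =1 id.
Proof. by move=> x; rewrite /relabel_fin relabel_complex1 unfinK. Qed.

Definition fin_action := TotalAction relabel_fin1 relabel_fin_morph.

Definition orbit_of (T : complex 6) : {set fin_complex} :=
  orbit fin_action [set: 'S_6]%SET (fin T).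

Lemma mem_orbit_of T T' : reflect (exists s, relabel_complex s T' = T) (fin T \in orbit_of T').
Proof.
apply: (iffP orbitP) => [[s _ eq_T]|[s eq_T]]; exists s; rewrite ?inE //.
  by apply: (can_inj finK); rewrite -eq_T /= /relabel_fin finK.
by rewrite /= /relabel_fin finK eq_T.
Qed.

Lemma orbit_of_eq T T' : orbit_of T = orbit_of T' -> exists s, relabel_complex s T' = T.
Proof. by move=> eqO; apply/mem_orbit_of; rewrite -eqO; apply: orbit_refl. Qed.

(** The orbit-stabiliser theorem. *)
Lemma card_orbit_of T :
  (#|orbit_of T| * #|[set s : 'S_6 | `[< relabel_complex s T = T >]]%SET|)%N = 720.
Proof.
rewrite -[RHS](_ : #|[set: 'S_6]%SET| = 720); last by rewrite cardsT card_Sn.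
rewrite -(card_orbit_stab fin_action [set: 'S_6]%G (fin T)) /orbit_of; congr (_ * _)%N.
apply: eq_card => s; rewrite [in RHS]inE [s \in [set: _]%G]inE inE.
apply/asboolP/astab1P => /= [|]; rewrite /relabel_fin finK.
  by move=> ->.
exact: (can_inj finK).
Qed.

Local Open Scope card_scope.

Lemma card_eq_index (Y : Type) (S : set Y) (Z : finType) (f : Y -> Z) (A : {set Z}) :
  set_bij S [set z | z \in A] f -> S #= `I_#|A|.
Proof.
move=> [fS f_inj f_surj]; apply/card_set_bijP; exists (fun y => index (f y) (enum A)); split.
- by move=> y Sy /=; rewrite cardE index_mem mem_enum; apply: fS.
- move=> y z yS zS eq_i; apply: f_inj => //.
  have inA u : u \in S -> f u \in enum A by rewrite inE mem_enum; apply: fS.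
  by rewrite -(nth_index (f y) (inA y yS)) eq_i nth_index // inA.
- move=> k /= lt_k; have := mem_nth; move: lt_k; rewrite cardE.
  case eq_e: (enum A) => [//|z0 e]; rewrite -eq_e => lt_k _.
  have : nth z0 (enum A) k \in A by rewrite -mem_enum mem_nth.
  move=> /f_surj[y Sy eq_y]; exists y => //=; rewrite eq_y index_uniq ?enum_uniq //.
Qed.

Section Classes.
Variables (P : set (complex 6)) (Ts : seq (complex 6)).
Hypothesis P_relabel : forall s T, P T -> P (relabel_complex s T).
Hypothesis P_reps : List.Forall P Ts.
Hypothesis P_cover : forall T, P T -> exists k s, (k < size Ts)%N /\
  T = relabel_complex s (nth set0 Ts k).
Hypothesis uniq_orbits : uniq (map orbit_of Ts).

Let FP : {set fin_complex} := [set x | `[< P (unfin x) >]]%SET.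

Lemma P_nth k : (k < size Ts)%N -> P (nth set0 Ts k).
Proof.
elim: Ts P_reps k => [//|T Ts' IHT] PT [|k] //= lt_k; inversion_clear PT => //.
exact: IHT.
Qed.

Lemma FP_acts : [acts [set: 'S_6]%G, on FP | fin_action].
Proof.
apply/actsP => s _ x; rewrite !inE /= /relabel_fin finK; apply/asboolP/asboolP => [Px|].
  by rewrite -[unfin x](relabel_complexK s); apply: P_relabel.
exact: P_relabel.
Qed.

Lemma orbits_FP : (orbit fin_action [set: 'S_6]%G @: FP)%SET = [set O in map orbit_of Ts]%SET.
Proof.
have sz : size (map orbit_of Ts) = size Ts by rewrite size_map.
have nthO k : (k < size Ts)%N -> nth finset.set0 (map orbit_of Ts) k = orbit_of (nth set0 Ts k).
  by move=> lt_k; rewrite (nth_map set0).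
apply/finset.setP => O; rewrite inE; apply/imsetP/idP => [[x]|Oin].
  rewrite inE => /asboolP/P_cover[k [s [lt_k eq_x]]] ->.
  suff -> : orbit fin_action [set: 'S_6]%G x = nth finset.set0 (map orbit_of Ts) k.
    by rewrite mem_nth ?sz.
  rewrite nthO //; apply/orbit_eqP; rewrite -[x]unfinK; apply/mem_orbit_of; exists s.
  by rewrite eq_x.
have /(nthP finset.set0)[k lt_k <-] := Oin; rewrite sz in lt_k.
exists (fin (nth set0 Ts k)); last exact: nthO.
by rewrite inE finK; apply/asboolP/P_nth.
Qed.

(** A set that is invariant under relabelling is the disjoint union of its orbits. *)
Lemma card_members : P #= `I_(\sum_(T <- Ts) #|orbit_of T|).
Proof.
have -> : (\sum_(T <- Ts) #|orbit_of T| = #|FP|)%N.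
  rewrite -(acts_sum_card_orbit FP_acts) orbits_FP -(big_map orbit_of predT (fun O => #|O|)).
  rewrite big_uniq //; apply: eq_bigl => O; by rewrite inE.
apply: (@card_eq_index _ _ _ fin); split.
- by move=> T PT /=; rewrite inE finK; apply/asboolP.
- by move=> T T' _ _; apply: (can_inj finK).
- move=> x /=; rewrite inE => /asboolP Px; exists (unfin x) => //; exact: unfinK.
Qed.

Lemma class_eq T T' s : T = relabel_complex s T' ->
  range ((@relabel_complex 6)^~ T) = range ((@relabel_complex 6)^~ T').
Proof.
move=> ->; apply/seteqP; split=> [_ [t _ <-]|_ [t _ <-]].
  by exists (s * t)%g; rewrite ?relabel_complexM.
by exists (s^-1 * t)%g => //=; rewrite -relabel_complexM mulKVg.
Qed.

(** Classes correspond to positions in the list of representatives. *)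
Lemma card_classes : symmetry_classes (@relabel_complex 6) P #= `I_(size Ts).
Proof.
rewrite card_eq_sym; apply/card_set_bijP.
exists (fun k => range ((@relabel_complex 6)^~ (nth set0 Ts k))); split.
- by move=> k /= lt_k; exists (nth set0 Ts k) => //; apply: P_nth.
- move=> k l; rewrite !inE /= => lt_k lt_l eq_kl.
  have [s _ eq_s] : range ((@relabel_complex 6)^~ (nth set0 Ts l)) (nth set0 Ts k).
    by rewrite -eq_kl; exists 1%g => //; apply: relabel_complex1.
  apply/eqP; rewrite -(nth_uniq finset.set0 _ _ uniq_orbits) ?size_map // !(nth_map set0) //.
  by apply/eqP/orbit_eqP/mem_orbit_of; exists s.
- move=> _ [T PT <-]; have [k [s [lt_k eq_T]]] := P_cover PT; exists k => //.
  exact/esym/(class_eq eq_T).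
Qed.

End Classes.

(** * The count *)
Local Open Scope nat_scope.
Local Open Scope classical_set_scope.
Local Open Scope card_scope.

Lemma uniq_flatten (I Y : eqType) (s : seq I) (f : I -> seq Y) : uniq s ->
  (forall i, i \in s -> uniq (f i)) ->
  (forall i j y, i \in s -> j \in s -> y \in f i -> y \in f j -> i = j) ->
  uniq (flatten [seq f i | i <- s]).
Proof.
elim: s => //= i s IHs /andP[nis us] uf dj; rewrite cat_uniq uf ?mem_head //= IHs //.
- rewrite andbT; apply/hasPn => y /flattenP[_ /mapP[j js ->] yj]; apply/negP => yi.
  by move: nis; rewrite (dj i j y) ?mem_head ?inE ?js ?orbT.
- by move=> j js; apply: uf; rewrite inE js orbT.
- by move=> j l y js ls; apply: dj; rewrite inE ?js ?ls orbT.
Qed.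

Section Final.
Variable R : realType.
Implicit Types (T : complex 6) (L : seq side).

Lemma rep_listsP reps L : reflect (exists2 i, (i < size groups)%N & L \in reps (nth_group i))
  (L \in rep_lists reps).
Proof.
apply: (iffP flattenP) => [[_ /mapP[i + ->] Li]|[i lt_i Li]].
  by rewrite mem_iota => lt_i; exists i.
by exists (reps (nth_group i)); rewrite // map_f // mem_iota.
Qed.

Definition list_orbit L := orbit_of (avoid L).

Lemma group_orbits_uniq i : (i < size groups)%N -> uniq (map list_orbit (group_lists half_circs i)).
Proof.
move=> lt_i; apply/(uniqP finset.set0) => a b; rewrite !inE size_map => lt_a lt_b.
rewrite !(nth_map [::]) // => eqO.
have [lt_ab|lt_ba|//] := ltngtP a b.
  have [s eq_s] := orbit_of_eq (esym eqO).
  by case: (@lists_inequivalent R i a b s lt_i); rewrite ?lt_ab.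
have [s eq_s] := orbit_of_eq eqO.
by case: (@lists_inequivalent R i b a s lt_i); rewrite ?lt_ba.
Qed.

(** Equivalent representatives belong to the same group by [same_group], and the
    representatives of one group are inequivalent. *)
Lemma rep_orbits_uniq reps : (forall i, uniq (map list_orbit (group_lists half_circs i)) ->
    uniq (map list_orbit (reps (nth_group i)))) ->
  (forall i, {subset reps (nth_group i) <= group_lists half_circs i}) ->
  uniq (map list_orbit (rep_lists reps)).
Proof.
move=> u_reps sub_reps; rewrite map_flatten -map_comp; apply: uniq_flatten.
- exact: iota_uniq.
- by move=> i; rewrite mem_iota => lt_i; apply/u_reps/group_orbits_uniq.
- move=> i j O; rewrite !mem_iota => lt_i lt_j /mapP[L Li ->] /mapP[L' Lj eqO].
  have [s eq_s] := orbit_of_eq eqO.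
  exact: (same_group R lt_i lt_j (sub_reps _ _ Li) (sub_reps _ _ Lj) eq_s).
Qed.

Lemma regular_sub i : {subset regular_reps half_circs (nth_group i) <= group_lists half_circs i}.
Proof. by move=> L Li; rewrite mem_cat Li. Qed.

Lemma irregular_sub i : {subset irregular_reps half_circs (nth_group i) <= group_lists half_circs i}.
Proof. by move=> L Li; rewrite mem_cat Li orbT. Qed.

Lemma regular_orbits_uniq : uniq (map list_orbit (rep_lists (regular_reps half_circs))).
Proof.
apply: rep_orbits_uniq regular_sub => i.
by rewrite /group_lists map_cat cat_uniq => /and3P[].
Qed.

Lemma irregular_orbits_uniq : uniq (map list_orbit (rep_lists (irregular_reps half_circs))).
Proof.
apply: rep_orbits_uniq irregular_sub => i.
by rewrite /group_lists map_cat cat_uniq => /and3P[].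
Qed.

(** A permutation fixing the triangulation preserves its choice of pairs, so that it is
    enough to count among those. *)
Lemma stabilizer_count i L : (i < size groups)%N -> L \in group_lists half_circs i ->
  #|[set s : 'S_6 | `[< relabel_complex s (avoid L) = avoid L >]]%SET| =
  count (maps_to L L) (group_stab (nth_group i)).
Proof.
move=> lt_i LL; rewrite /group_stab /seeing count_filter -card_hexS; apply: eq_card => s; rewrite !inE /=.
apply/asboolP/andP => [eqL|[/(maps_toP R s lt_i lt_i LL LL)//]].
split; first exact/(maps_toP R s lt_i lt_i LL LL).
rewrite everyE; apply/allP => q qf.
apply/(group_sees_list R lt_i LL (hexS_perms s) (flags_perms qf)).
rewrite -eqL -relabel_gr; apply/relabel_complexE; rewrite relabel_graphK.
exact: group_lists_flags R i L q lt_i LL qf.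
Qed.

Lemma orbit_quotient i L : (i < size groups)%N -> L \in group_lists half_circs i ->
  orbit_size (group_stab (nth_group i)) L = BinNat.N.of_nat #|list_orbit L|.
Proof.
move=> lt_i LL; rewrite /orbit_size -(stabilizer_count lt_i LL).
have := card_orbit_of (avoid L); rewrite -/(list_orbit L).
move: #|[set s : 'S_6 | _]%SET| #|list_orbit L| => k o ok.
have k_gt0 : (0 < k)%N by move: ok; case: (k) => //; rewrite muln0.
have -> : 720%num = BinNat.N.mul (BinNat.N.of_nat o) (BinNat.N.of_nat k).
  by rewrite -Nnat.Nat2N.inj_mul multE ok.
by rewrite BinNat.N.div_mul //; lia.
Qed.

Lemma add_orbitsE i Ls n : (i < size groups)%N -> {subset Ls <= group_lists half_circs i} ->
  add_orbits (group_stab (nth_group i)) Ls (BinNat.N.of_nat n) =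
  BinNat.N.of_nat (\sum_(L <- Ls) #|list_orbit L| + n).
Proof.
move=> lt_i; rewrite /add_orbits; elim: Ls => [|L Ls IHL] subL; first by rewrite big_nil.
rewrite big_cons [LHS]/= IHL; last by move=> L' L's; apply: subL; rewrite inE L's orbT.
by rewrite (orbit_quotient lt_i) ?subL ?mem_head // -Nnat.Nat2N.inj_add plusE addnA.
Qed.

Lemma orbit_sizesE reps s : all (fun i => (i < size groups)%N) s ->
  (forall i, {subset reps (nth_group i) <= group_lists half_circs i}) ->
  orbit_sizes reps s = BinNat.N.of_nat
    (\sum_(L <- flatten [seq reps (nth_group i) | i <- s]) #|list_orbit L|).
Proof.
move=> lt_s sub_reps; rewrite /orbit_sizes.
elim: s lt_s => [_|i s IHs]; first by rewrite big_nil.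
move=> /andP[lt_i /IHs]; rewrite [flatten _]/= big_cat [foldr _ _ (_ :: _)]/= => ->.
exact: add_orbitsE.
Qed.

Lemma relabel_regular s T : regular_triangulations R 6 T ->
  regular_triangulations R 6 (relabel_complex s T).
Proof.
move=> [/triP tT [d [md eqT]]]; split; first by apply/triP; apply: relabel_tri.
by exists (relabel_matrix s d); split; [apply: relabel_metric|rewrite relabel_Delta eqT].
Qed.

Lemma relabel_nonregular s T : nonregular_triangulations R 6 T ->
  nonregular_triangulations R 6 (relabel_complex s T).
Proof.
move=> [/triP tT nreg]; split; first by apply/triP; apply: relabel_tri.
by move=> /(relabel_regular s^-1%g); rewrite relabel_complexK.
Qed.

(** A choice of pairs from [group_found], and then a representative from
    [group_rep_found]. *)
Lemma rep_found T : tri R T -> exists i L s, [/\ (i < size groups)%N, L \in group_lists half_circs i &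
  T = relabel_complex s (avoid L)].
Proof.
move=> tT; have [s [i [lt_i flagsT]]] := group_found tT.
have [r rr [t eqT]] := group_rep_found lt_i (relabel_tri s tT) flagsT.
exists i, (antis (gpath (nth_group i)) ++ r), (t * s^-1)%g; split=> //.
  by apply/group_listsP; exists r.
by rewrite relabel_complexM -eqT relabel_complexK.
Qed.

Lemma regular_reps_regular i L : (i < size groups)%N -> L \in regular_reps half_circs (nth_group i) ->
  regular_triangulations R 6 (avoid L).
Proof.
move=> lt_i Li; apply/regularP; split; last exact: regular_list Li.
exact: group_lists_tri (regular_sub Li).
Qed.

Lemma irregular_reps_nonregular i L : (i < size groups)%N ->
  L \in irregular_reps half_circs (nth_group i) -> nonregular_triangulations R 6 (avoid L).
Proof.
move=> lt_i Li; split; first by apply/triP; apply: group_lists_tri (irregular_sub Li).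
by move=> /regularP[_ [h]]; apply: irregular_list Li _.
Qed.

Lemma nth_avoid reps L : L \in rep_lists reps ->
  exists2 k, (k < size (map avoid (rep_lists reps)))%N & nth set0 (map avoid (rep_lists reps)) k = avoid L.
Proof.
move=> Lin; exists (index L (rep_lists reps)); first by rewrite size_map index_mem.
by rewrite (nth_map [::]) ?index_mem // nth_index.
Qed.

Lemma Forall_avoid (P : set (complex 6)) Ls : (forall L, L \in Ls -> P (avoid L)) ->
  List.Forall P (map avoid Ls).
Proof.
elim: Ls => [|L Ls IHL] PL /=; constructor; first by apply: PL; rewrite mem_head.
by apply: IHL => L' L's; apply: PL; rewrite inE L's orbT.
Qed.

(** Regularity is invariant under relabelling, and the other representatives are not
    regular. *)
Lemma regular_cover T : regular_triangulations R 6 T -> exists k s,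
  (k < size (map avoid (rep_lists (regular_reps half_circs))))%N /\
  T = relabel_complex s (nth set0 (map avoid (rep_lists (regular_reps half_circs))) k).
Proof.
move=> rT; have [tT _] := proj1 (regularP R T) rT.
have [i [L [s [lt_i + eqT]]]] := rep_found tT; rewrite mem_cat => /orP[Li|Li].
  have [|k lt_k eq_k] := @nth_avoid (regular_reps half_circs) L; first by apply/rep_listsP; exists i.
  by exists k, s; rewrite eq_k.
have [_ []] := irregular_reps_nonregular lt_i Li.
by rewrite -(relabel_complexK s (avoid L)) -eqT; apply: relabel_regular.
Qed.

Lemma nonregular_cover T : nonregular_triangulations R 6 T -> exists k s,
  (k < size (map avoid (rep_lists (irregular_reps half_circs))))%N /\
  T = relabel_complex s (nth set0 (map avoid (rep_lists (irregular_reps half_circs))) k).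
Proof.
move=> [/triP tT nreg].
have [i [L [s [lt_i + eqT]]]] := rep_found tT; rewrite mem_cat => /orP[Li|Li].
  by case: nreg; rewrite eqT; apply/relabel_regular/(regular_reps_regular lt_i Li).
have [|k lt_k eq_k] := @nth_avoid (irregular_reps half_circs) L; first by apply/rep_listsP; exists i.
by exists k, s; rewrite eq_k.
Qed.

Lemma sum_orbits reps : (forall i, {subset reps (nth_group i) <= group_lists half_circs i}) ->
  (\sum_(T <- map avoid (rep_lists reps)) #|orbit_of T|)%N =
  BinNat.N.to_nat (orbit_sizes reps (iota 0 (size groups))).
Proof.
by move=> sub_reps; rewrite big_map orbit_sizesE ?Nnat.Nat2N.id //.
Qed.

Lemma card_regular : regular_triangulations R 6 #= `I_194160.
Proof.
have eqN : BinNat.N.to_nat 194160%num = 194160.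
  cbn [Nat.of_num_uint Nat.of_uint Nat.of_uint_acc].
  by rewrite !PeanoNat.Nat.tail_mul_spec; lia.
rewrite -eqN -regular_orbit_sizes -(sum_orbits regular_sub).
apply: card_members relabel_regular _ regular_cover _.
  by apply: Forall_avoid => L /rep_listsP[i lt_i Li]; apply: regular_reps_regular lt_i Li.
by rewrite -map_comp; apply: regular_orbits_uniq.
Qed.

Lemma card_nonregular : nonregular_triangulations R 6 #= `I_3840.
Proof.
have eqN : BinNat.N.to_nat 3840%num = 3840 by lia.
rewrite -eqN -irregular_orbit_sizes -(sum_orbits irregular_sub).
apply: card_members relabel_nonregular _ nonregular_cover _.
  by apply: Forall_avoid => L /rep_listsP[i lt_i Li]; apply: irregular_reps_nonregular lt_i Li.
by rewrite -map_comp; apply: irregular_orbits_uniq.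
Qed.

Lemma card_regular_classes :
  symmetry_classes (@relabel_complex 6) (regular_triangulations R 6) #= `I_339.
Proof.
rewrite -regular_rep_count -(size_map avoid (rep_lists (regular_reps half_circs))).
apply: card_classes _ regular_cover _.
  by apply: Forall_avoid => L /rep_listsP[i lt_i Li]; apply: regular_reps_regular lt_i Li.
by rewrite -map_comp; apply: regular_orbits_uniq.
Qed.

Lemma card_nonregular_classes :
  symmetry_classes (@relabel_complex 6) (nonregular_triangulations R 6) #= `I_14.
Proof.
rewrite -irregular_rep_count -(size_map avoid (rep_lists (irregular_reps half_circs))).
apply: card_classes _ nonregular_cover _.
  by apply: Forall_avoid => L /rep_listsP[i lt_i Li]; apply: irregular_reps_nonregular lt_i Li.
by rewrite -map_comp; apply: irregular_orbits_uniq.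
Qed.

Lemma bij_card (U V : Type) (A : set U) (B : set V) f : set_bij A B f -> A #= B.
Proof.
move=> [f_fun f_inj f_surj]; have <- : f @` A = B.
  by apply/seteqP; split=> [_ [x Ax <-]|y /f_surj //]; apply: f_fun.
by rewrite card_eq_sym; apply: inj_card_eq.
Qed.

End Final.

Theorem theorem1 (R : realType) :
  [/\ (* generic metrics up to type, and maximal cones of the metric fan *)
      [/\ generic_types R 6 #= `I_194160,
          maximal_cones R 6 #= `I_194160 &
          set_bij (generic_types R 6) (maximal_cones R 6) (@closure 'M[R]_6)],
      (* the bijection with regular triangulations, induced by d |-> Delta_d *)
      exists2 f : set 'M[R]_6 -> complex 6,
        forall d, generic d -> f (closure (fan_cell d)) = induced_subdivision d &
        set_bij (maximal_cones R 6) (regular_triangulations R 6) f,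
      (* symmetry classes under S_6 *)
      symmetry_classes (@relabel_cone 6 R) (maximal_cones R 6) #= `I_339 /\
      symmetry_classes (@relabel_complex 6) (regular_triangulations R 6)
        #= `I_339 &
      (* non-regular triangulations *)
      nonregular_triangulations R 6 #= `I_3840 /\
      symmetry_classes (@relabel_complex 6) (nonregular_triangulations R 6)
        #= `I_14].
Proof.
have card_cones : maximal_cones R 6 #= `I_194160.
  apply: card_eq_trans (card_regular R); exact: bij_card (cone_complex_bij R).
split.
- split=> //; last exact: closure_bij.
  exact: card_eq_trans (bij_card (closure_bij R)) card_cones.
- by exists (@cone_complex R); [apply: cone_complexE|apply: cone_complex_bij].
- split; last exact: card_regular_classes.
  exact: card_eq_trans (classes_card R) (card_regular_classes R).
- by split; [apply: card_nonregular|apply: card_nonregular_classes].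
Qed.
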